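(* Let $\mathbf{A}$ be the port-Hamiltonian operator associated with $(\mathbf{P}_1,\mathbf{P}_0,\mathbf{H},\mathbf{W}_B)$ on $[a,b]$ satisfying assumptions (a), (b), (c) of the context, and let $(\mathbf{T}(t))_{t\ge 0}$ be the contraction semigroup on $\mathcal{X}$ generated by $\mathbf{A}$. Furthermore, assume that $\gamma>0$ is large enough that $\gamma\mathbf{H}(\zeta)\ge \pm\mathbf{P}_1^{-1}$ for all $\zeta\in[a,b]$. Then the following assertions are equivalent: (i) The semigroup $(\mathbf{T}(t))_{t\ge 0}$ is exponentially stable. (ii) There exist real numbers $0<\sigma<\tau<T$ satisfying $\tau-\sigma>2\gamma(b-a)$ and $k>0$ such that $$\|x(T)\|_{\mathcal{X}}^2-\|x_0\|_{\mathcal{X}}^2\le -k\int_\sigma^\tau x(t,b)^*\mathbf{H}(b)x(t,b)\,\mathrm{d}t$$ for all $x_0\in D(\mathbf{A})$, where $x(t)=\mathbf{T}(t)x_0$. (iii) There exist real numbers $0<\sigma<\tau<T$ satisfying $\tau-\sigma>2\gamma(b-a)$ and $k>0$ such that $$\|x(T)\|_{\mathcal{X}}^2-\|x_0\|_{\mathcal{X}}^2\le -k\int_\sigma^\tau x(t,a)^*\mathbf{H}(a)x(t,a)\,\mathrm{d}t$$ for all $x_0\in D(\mathbf{A})$, where $x(t)=\mathbf{T}(t)x_0$.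
   Context: Let $a<b$ be real, $n\ge 1$, $\mathbb{K}=\mathbb{R}$ or $\mathbb{K}=\mathbb{C}$. For $v\in\mathbb{K}^n$ (or a matrix) $v^*$ denotes the conjugate transpose; inequalities between symmetric matrices are in the sense of quadratic forms (Loewner order), and ''$\gamma\mathbf{H}(\zeta)\ge\pm\mathbf{P}_1^{-1}$'' means that both $\gamma\mathbf{H}(\zeta)\ge\mathbf{P}_1^{-1}$ and $\gamma\mathbf{H}(\zeta)\ge-\mathbf{P}_1^{-1}$ hold. $\mathbf{0}_n,\mathbf{1}_n$ denote the $n\times n$ zero and identity matrices. Assumptions: (a) $\mathbf{W}_B\in\mathbb{R}^{n\times 2n}$ has rank $n$ and $\mathbf{W}_B\mathbf{\Sigma}\mathbf{W}_B^*\ge 0$ with $\mathbf{\Sigma}=\begin{pmatrix}\mathbf{0}_n&\mathbf{1}_n\\ \mathbf{1}_n&\mathbf{0}_n\end{pmatrix}$. (b) $\mathbf{H}\in C^1([a,b],\mathbb{R}^{n\times n})$, $\mathbf{H}(\zeta)$ is symmetric and $m\mathbf{1}_n\le\mathbf{H}(\zeta)\le M\mathbf{1}_n$ for all $\zeta\in[a,b]$, with constants $m,M>0$ independent of $\zeta$. (c) $\mathbf{P}_1\in\mathbb{R}^{n\times n}$ is symmetric and invertible, and $\mathbf{P}_0\in\mathbb{R}^{n\times n}$ is skew-symmetric. The port-Hamiltonian operator is $\mathbf{A}x=\mathbf{P}_1\frac{\partial}{\partial\zeta}(\mathbf{H}x)+\mathbf{P}_0\mathbf{H}x$ with domain $$D(\mathbf{A})=\left\{x\in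 L^2([a,b],\mathbb{K}^n)\ \middle|\ \mathbf{H}x\in H^1([a,b],\mathbb{K}^n),\ \mathbf{W}_B\begin{pmatrix}\mathbf{e}_\partial\\ \mathbf{f}_\partial\end{pmatrix}=0\right\},\qquad \begin{pmatrix}\mathbf{e}_\partial\\ \mathbf{f}_\partial\end{pmatrix}=\frac{1}{\sqrt2}\begin{pmatrix}\mathbf{1}_n&\mathbf{1}_n\\ \mathbf{P}_1&-\mathbf{P}_1\end{pmatrix}\begin{pmatrix}(\mathbf{H}x)(b)\\ (\mathbf{H}x)(a)\end{pmatrix}.$$ Elements with $\mathbf{H}x\in H^1$ are identified with their continuous representatives, so point values make sense. The state space is $\mathcal{X}=L^2([a,b],\mathbb{K}^n)$ with inner product $\langle f,g\rangle_{\mathcal{X}}=\frac12\int_a^b g(\zeta)^*\mathbf{H}(\zeta)f(\zeta)\,\mathrm{d}\zeta$ and induced norm $\|\cdot\|_{\mathcal{X}}$. Under (a)-(c) it is known that $\mathbf{A}$ generates a contraction semigroup $(\mathbf{T}(t))_{t\ge0}$ on $\mathcal{X}$; for $x_0\in D(\mathbf{A})$, $x(t)=\mathbf{T}(t)x_0$ is the unique classical solution of $\dot x=\mathbf{A}x$, $x(0)=x_0$, and one writes $x(t,\zeta)=(x(t))(\zeta)$. The semigroup is exponentially stable if there are constants $C,\omega>0$ with $\|\mathbf{T}(t)\|\le Ce^{-\omega t}$ for all $t\ge0$. *)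

(* Defs.v *)
From HB Require Import structures.
From mathcomp Require Import all_boot all_order all_algebra.
From mathcomp Require Import all_classical all_reals all_analysis.
From mathcomp Require Import complex.

Set Implicit Arguments.
Unset Strict Implicit.
Unset Printing Implicit Defensive.

Import Order.TTheory GRing.Theory Num.Theory.
Import numFieldNormedType.Exports.

Local Open Scope classical_set_scope.
Local Open Scope ring_scope.

Inductive scalar_kind := RealScalars | ComplexScalars.

Definition scalars (R : realType) (k : scalar_kind) : numFieldType :=
  match k with
  | RealScalars => R
  | ComplexScalars => R[i]
  end.

Section scalar_operations.
Variable R : realType.

Definition of_real (k : scalar_kind) : R -> scalars R k :=
  match k return R -> scalars R k with
  | RealScalars => id
  | ComplexScalars => fun x => Complex x 0
  end.

Definition re_part (k : scalar_kind) : scalars R k -> R :=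
  match k return scalars R k -> R with
  | RealScalars => id
  | ComplexScalars => @complex.Re R
  end.

Definition im_part (k : scalar_kind) : scalars R k -> R :=
  match k return scalars R k -> R with
  | RealScalars => fun=> 0
  | ComplexScalars => @complex.Im R
  end.

Definition conj_scalar (k : scalar_kind) : scalars R k -> scalars R k :=
  match k return scalars R k -> scalars R k with
  | RealScalars => id
  | ComplexScalars => @conjc R
  end.

Definition scalar_integral (k : scalar_kind) (D : set R) :
    (R -> scalars R k) -> scalars R k :=
  match k return (R -> scalars R k) -> scalars R k with
  | RealScalars => fun f => \int[lebesgue_measure]_(z in D) f z
  | ComplexScalars => fun f =>
      Complex (\int[lebesgue_measure]_(z in D) complex.Re (f z))
              (\int[lebesgue_measure]_(z in D) complex.Im (f z))
  end.

End scalar_operations.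

Section real_matrices.
Variable R : realType.

Definition quad_nonneg (n : nat) (A : 'M[R]_n) :=
  forall v : 'cV[R]_n, 0 <= (v^T *m A *m v) 0 0.

Definition loewner_le (n : nat) (A B : 'M[R]_n) := quad_nonneg (B - A).

Definition swap_mx (n : nat) : 'M[R]_(n + n) := block_mx 0 1%:M 1%:M 0.

(* Only the values on [a, b] are constrained: the derivative on ]a, b[ extends
   continuously to [a, b]. *)
Definition continuously_differentiable (a b : R) (n : nat)
    (H : R -> 'M[R]_n) :=
  exists dH : R -> 'M[R]_n, forall i j : 'I_n,
    [/\ {within `[a, b], continuous (fun z => H z i j)},
        {within `[a, b], continuous (fun z => dH z i j)} &
        forall z : R, z \in `]a, b[ ->
          is_derive z 1 (fun s => H s i j) (dH z i j)].

End real_matrices.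

Notation "A '⪯' B" := (loewner_le A B) (at level 70, no associativity).

Section port_hamiltonian.
Variables (R : realType) (k : scalar_kind) (n : nat) (a b : R).

Local Notation K := (scalars R k).
Local Notation mu := (@lebesgue_measure R).

(* Elements of the function spaces below are represented by functions on R, of
   which only the restriction to [a, b] matters, up to equality almost
   everywhere on [a, b]. *)
Local Notation state := (R -> 'cV[K]_n).

Definition of_real_mx (p q : nat) (A : 'M[R]_(p, q)) : 'M[K]_(p, q) :=
  map_mx (@of_real R k) A.

Definition adjoint (p q : nat) (A : 'M[K]_(p, q)) : 'M[K]_(q, p) :=
  map_mx (@conj_scalar R k) A^T.

Definition same_state (f g : state) :=
  \forall z \ae mu, z \in `[a, b] -> f z = g z.

Definition vec_integral (D : set R) (f : state) : 'cV[K]_n :=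
  \col_i scalar_integral D (fun z => f z i 0).

Definition L2 : set state :=
  [set f : state |
           [/\ forall i, measurable_fun `[a, b] (fun z : R => re_part (f z i 0)),
               forall i, measurable_fun `[a, b] (fun z : R => im_part (f z i 0)) &
               mu.-integrable `[a, b]
                 (fun z : R => (re_part ((adjoint (f z) *m f z) 0 0))%:E)]].

(* One-dimensional Sobolev space: u has weak derivative g in L2 iff u agrees
   almost everywhere with an (absolutely continuous) primitive of g. *)
Definition weak_derivative (u g : state) :=
  L2 g /\ exists h : state, same_state u h /\
    forall z, z \in `[a, b] -> h z = h a + vec_integral `[a, z] g.

Definition H1 : set state :=
  [set u | L2 u /\ exists g, weak_derivative u g].

(* As a < b, the continuous representative is unique on [a, b] when it
   exists. *)
Definition cont_rep (u : state) : state :=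
  xget u [set h | same_state u h /\ {within `[a, b], continuous h}].

Section operator.
Variables (P1 P0 : 'M[R]_n) (H : R -> 'M[R]_n) (WB : 'M[R]_(n, n + n)).

Definition mulH (x : state) : state := fun z => of_real_mx (H z) *m x z.

Definition boundary_vector (x : state) : 'cV[K]_(n + n) :=
  of_real k (Num.sqrt 2)^-1 *:
    (block_mx 1%:M 1%:M (of_real_mx P1) (- of_real_mx P1)
       *m col_mx (cont_rep (mulH x) b) (cont_rep (mulH x) a)).

Definition pH_domain : set state :=
  [set x | [/\ L2 x, H1 (mulH x) &
               of_real_mx WB *m boundary_vector x = 0]].

(* The graph of the operator: x is in its domain and y represents its value
   at x. *)
Definition pH_operator (x y : state) :=
  pH_domain x /\ exists g : state, weak_derivative (mulH x) g /\
    same_state y (fun z => of_real_mx P1 *m g z + of_real_mx P0 *m mulH x z).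

End operator.

Section energy_space.
Variable H : R -> 'M[R]_n.

Definition inner (f g : state) : K :=
  of_real k 2^-1 *
    scalar_integral `[a, b]
      (fun z => (adjoint (g z) *m of_real_mx (H z) *m f z) 0 0).

Definition energy_norm (f : state) : R := Num.sqrt (re_part (inner f f)).

Definition op_norm (S : state -> state) : \bar R :=
  ereal_sup [set (energy_norm (S f))%:E | f in
               [set f | L2 f /\ energy_norm f <= 1]].

Definition L2_operator (S : state -> state) :=
  [/\ forall f, L2 f -> L2 (S f),
      forall f g, L2 f -> L2 g -> same_state f g -> same_state (S f) (S g) &
      forall (c : K) f g, L2 f -> L2 g ->
        same_state (S (c *: f + g)) (c *: S f + S g)].

(* Only the values of T at nonnegative times matter. *)
Definition contraction_semigroup (T : R -> state -> state) :=
  [/\ forall t, 0 <= t -> L2_operator (T t) /\ (op_norm (T t) <= 1)%E,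
      forall f, L2 f -> same_state (T 0 f) f,
      forall s t f, 0 <= s -> 0 <= t -> L2 f ->
        same_state (T (s + t) f) (T s (T t f)) &
      forall f, L2 f -> energy_norm (T t f - f) @[t --> 0^'+] --> 0].

Definition generated_by (A : state -> state -> Prop)
    (T : R -> state -> state) :=
  forall f y, L2 f -> L2 y ->
    (A f y <->
     energy_norm (of_real k t^-1 *: (T t f - f) - y) @[t --> 0^'+] --> 0).

Definition exponentially_stable (T : R -> state -> state) :=
  exists C omega : R, [/\ 0 < C, 0 < omega &
    forall t, 0 <= t -> (op_norm (T t) <= (C * expR (- omega * t))%:E)%E].

(* x^* H x at the point z, for the continuous representative of x. *)
Definition energy_at (x : state) (z : R) : R :=
  re_part ((adjoint (cont_rep x z) *m of_real_mx (H z) *m cont_rep x z) 0 0).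

End energy_space.

End port_hamiltonian.

Arguments pH_domain {R} k {n}.
Arguments pH_operator {R} k {n}.
Arguments contraction_semigroup {R} k {n}.

(* Main.v *)
Require Import Defs.
From mathcomp Require Import all_boot all_order all_algebra.
From mathcomp Require Import all_classical all_reals all_analysis.
From mathcomp Require Import measurable_realfun complex ring lra.

Set Implicit Arguments.
Unset Strict Implicit.
Unset Printing Implicit Defensive.

Import Order.TTheory GRing.Theory Num.Theory.
Import numFieldNormedType.Exports.

Local Open Scope classical_set_scope.
Local Open Scope ring_scope.

(** The state [x = x(t)] carries the energy [|x|^2 = 1/2 int x^* H x], which is
    nonincreasing in time.  Everything rests on one identity.  Let [x] be in the
    domain of the operator, [y = A x], let [beta] be a scalar C1 weight, and put
    [N = H' + 2 P1^-1 P0 H].  Then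
      [ [beta x^* H x]_a^b = int beta' x^* H x
           + 2 Re int beta x^* P1^-1 y - int beta x^* N x ]
    ([energy_identity]).  It is the product rule for [beta h^* H^-1 h] with
    [h = H x] absolutely continuous, together with [h' = P1^-1 y - P1^-1 P0 h].
    Along an orbit, [2 Re int beta x^* P1^-1 y] is the time derivative of
    [Q(t) = int beta x^* P1^-1 x]; so the energy density at the ends is
    controlled by [Q'] and by the total energy.

    From stability to observation, the weight [beta = z - c'], which vanishes at
    the end [c'] opposite to the observed end [c], and an integration over time
    give [int_s^t x(c)^* H x(c) <= C |x_0|^2] ([observation_admissible]).  Take
    [T] with [|x(T)|^2 <= 1/2 |x_0|^2]; then [|x(T)|^2 - |x_0|^2] is at most
    [- 1/2 |x_0|^2], hence at most a negative multiple of the observation.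

    From observation to stability, [beta] is an exponential growing towards [c]
    at rate [mu = nu gamma + kappa + 1], where [kappa] bounds [N] relative to
    [H], and time is weighted by [alpha = sech_weight nu q], which decays like
    [exp (- nu |t - q|)] away from the middle [q] of the observation interval.
    As [gamma H >= +- P1^-1], the derivative of [alpha] costs at most
    [nu gamma alpha int |beta| x^* H x]; the spatial weight gains
    [mu alpha int |beta| x^* H x], which pays for that and for the lower order
    terms and leaves [alpha int |beta| x^* H x] ([sideways_estimate]).  The price
    is the boundary term at [c], of the good sign at [c'], and the values of
    [alpha Q] at the two ends of the time interval.  With [L] half the length of
    that interval and [d = (L - gamma (b - a)) / 2], these are of the order
    [exp (nu gamma (b - a) - nu L) = exp (- 2 nu d)], whereas the integral of
    [alpha], the coefficient of the final energy, is at least of the order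
    [exp (- nu d)].  As [d > 0], they are negligible for [nu] large
    ([decay_rate_exists]).  What results is
    [p |x(tau)|^2 <= int x(c)^* H x(c) + r |x_0|^2] with [r < p]
    ([final_energy_observed]), and combining it with the assumed energy loss
    yields [|x(T)| <= q |x_0|] with [q < 1] on the domain
    ([observed_contraction]).  The domain is dense ([pH_domain_dense]), so this
    holds on the whole space, and iteration gives exponential decay.

    The two ends play symmetric roles and are treated together ([endpoint]).
    Real and complex scalars are also treated together: every form in use has a
    real coefficient matrix, so it splits into the same form evaluated on real
    and on imaginary parts ([bilc]). *)

(** * Real quadratic forms *)

Section quadratic_forms.
Variables (R : realType) (n : nat).
Implicit Types (A B : 'M[R]_n) (u v w : 'cV[R]_n) (r C : R).

Definition bil A v w : R := (v^T *m A *m w) 0 0.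

Lemma bilE A v w : bil A v w = \sum_i \sum_j A i j * v i 0 * w j 0.
Proof.
rewrite /bil mxE exchange_big /=; apply: eq_bigr => j _.
rewrite mxE big_distrl /=; apply: eq_bigr => i _.
by rewrite mxE; ring.
Qed.

Lemma bilDl A u v w : bil A (u + v) w = bil A u w + bil A v w.
Proof. by rewrite /bil linearD /= !mulmxDl mxE. Qed.

Lemma bilDr A u v w : bil A u (v + w) = bil A u v + bil A u w.
Proof. by rewrite /bil mulmxDr mxE. Qed.

Lemma bilZl A r v w : bil A (r *: v) w = r * bil A v w.
Proof. by rewrite /bil linearZ /= -!scalemxAl mxE. Qed.

Lemma bilZr A r v w : bil A v (r *: w) = r * bil A v w.
Proof. by rewrite /bil -scalemxAr mxE. Qed.

Lemma bilDm A B v w : bil (A + B) v w = bil A v w + bil B v w.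
Proof. by rewrite /bil mulmxDr mulmxDl mxE. Qed.

Lemma bilZm A r v w : bil (r *: A) v w = r * bil A v w.
Proof. by rewrite /bil -scalemxAr -scalemxAl mxE. Qed.

Lemma bilNm A v w : bil (- A) v w = - bil A v w.
Proof. by rewrite /bil mulmxN mulNmx mxE. Qed.

Lemma bil_mulr A B v w : bil A v (B *m w) = bil (A *m B) v w.
Proof. by rewrite /bil !mulmxA. Qed.

Lemma bil_mull A B v w : bil A (B *m v) w = bil (B^T *m A) v w.
Proof. by rewrite /bil trmx_mul !mulmxA. Qed.

Lemma bil_tr A v w : bil A^T v w = bil A w v.
Proof.
rewrite !bilE exchange_big /=; apply: eq_bigr => i _; apply: eq_bigr => j _.
by rewrite mxE; ring.
Qed.

Lemma bil_sym A v w : A^T = A -> bil A v w = bil A w v.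
Proof. by move=> A_sym; rewrite -bil_tr A_sym. Qed.

Lemma bil_scalar r v : bil r%:M v v = r * \sum_i (v i 0) ^+ 2.
Proof.
rewrite bilE mulr_sumr; apply: eq_bigr => i _.
rewrite (bigD1 i) //= big1 => [|j ji]; first by rewrite mxE eqxx mulr1n; ring.
by rewrite mxE eq_sym (negPf ji) mulr0n !mul0r.
Qed.

Lemma loewner_le_bil A B v : A ⪯ B -> bil A v v <= bil B v v.
Proof.
move=> /(_ v); rewrite -/(bil (B - A) v v) bilDm bilNm; lra.
Qed.

(** The weighted arithmetic-geometric inequality, entry by entry. The free
    parameter [r] is what later turns the bound into a product of norms. *)
Lemma bil_amgm A v w C r : 0 < r -> (forall i j, `|A i j| <= C) ->
  bil A v w <= C * n%:R * (r * bil 1%:M v v + r^-1 * bil 1%:M w w).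
Proof.
move=> r0 AC; rewrite bilE.
have step i j : A i j * v i 0 * w j 0 <=
    C * (r * (v i 0) ^+ 2 + r^-1 * (w j 0) ^+ 2).
  have C0 : 0 <= C := le_trans (normr_ge0 _) (AC i j).
  apply: (le_trans (ler_norm _)); rewrite -mulrA normrM.
  apply: ler_pM => //.
  have := sqr_ge0 (r * `|v i 0| - `|w j 0|).
  rewrite normrM -[v i 0 ^+ 2]real_normK ?num_real//.
  rewrite -[w j 0 ^+ 2]real_normK ?num_real//.
  set x := `|v i 0|; set y := `|w j 0| => h.
  have -> : r * x ^+ 2 + r^-1 * y ^+ 2 =
      r^-1 * (r * x - y) ^+ 2 + 2 * (x * y) by field; rewrite gt_eqF.
  have : 0 <= r^-1 * (r * x - y) ^+ 2 by rewrite mulr_ge0// invr_ge0 ltW.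
  have : 0 <= x * y by rewrite mulr_ge0 // normr_ge0.
  lra.
apply: (le_trans (ler_sum _ (fun i _ => ler_sum _ (fun j _ => step i j)))).
under eq_bigr do rewrite -mulr_sumr big_split /= sumr_const card_ord -mulr_natr.
rewrite -mulr_sumr big_split /= !bil_scalar !mul1r sumr_const card_ord.
rewrite -mulr_suml -!mulr_sumr.
set x := \sum_(i < n) v i 0 ^+ 2; set y := \sum_(i < n) w i 0 ^+ 2.
rewrite -[r^-1 * y *+ n]mulr_natr.
by have -> : C * (r * x * n%:R + r^-1 * y * n%:R) = C * n%:R * (r * x + r^-1 * y) by ring.
Qed.

End quadratic_forms.

Section optimize.
Variable R : realType.
Implicit Types A B x : R.

(** Choosing the parameter optimally; if one of the two terms vanishes, the
    infimum is only approached. *)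
Lemma amgm_opt A B x : 0 <= A -> 0 <= B ->
  (forall s, 0 < s -> x <= s * A ^+ 2 + s^-1 * B ^+ 2) -> x <= 2 * A * B.
Proof.
move=> A0 B0 h; apply/ler_addgt0Pr => e e0.
have pos (d : R) : 0 < d -> x <= 2 * A * B + d * (A + B).
  move=> d0.
  have Ad : 0 < A + d by lra.
  have Bd : 0 < B + d by lra.
  have /h := divr_gt0 Bd Ad; rewrite invf_div => /le_trans; apply.
  rewrite -[leLHS]/((B + d) / (A + d) * A ^+ 2 + (A + d) / (B + d) * B ^+ 2).
  have -> : 2 * A * B + d * (A + B) = (B + d) * A + (A + d) * B by ring.
  apply: lerD.
    rewrite -mulrA ler_wpM2l ?(ltW Bd)// mulrC ler_pdivrMr// expr2.
    by rewrite ler_wpM2l//; lra.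
  rewrite -mulrA ler_wpM2l ?(ltW Ad)// mulrC ler_pdivrMr// expr2.
  by rewrite ler_wpM2l//; lra.
have AB : 0 < A + B + 1 by lra.
apply: (le_trans (pos _ (divr_gt0 e0 AB))); rewrite lerD2l.
by rewrite mulrAC ler_pdivrMr// ler_wpM2l ?(ltW e0)//; lra.
Qed.

End optimize.

(** * Real and imaginary parts *)

Section components.
Variables (R : realType) (k : scalar_kind).
Local Notation K := (scalars R k).

(** [part true] and [part false] are the real and imaginary parts, so that
    statements about both can be made once. *)
Definition part (c : bool) : K -> R :=
  if c then @re_part R k else @im_part R k.

Lemma part0 c : part c 0 = 0.
Proof. by case: c; rewrite /part; case: k. Qed.

Lemma partD c x y : part c (x + y) = part c x + part c y.
Proof.
rewrite /part; case: k x y => x y /=; first by case: c; rewrite //= addr0.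
by case: c; case: x => ? ?; case: y.
Qed.

Lemma part_sum c (I : Type) (s : seq I) (F : I -> K) :
  part c (\sum_(i <- s) F i) = \sum_(i <- s) part c (F i).
Proof.
by elim: s => [|i s IH]; rewrite ?big_nil ?part0// !big_cons partD IH.
Qed.

Lemma part_real_mul c r x : part c (of_real k r * x) = r * part c x.
Proof.
rewrite /part; case: k x => x /=; first by case: c; rewrite //= mulr0.
by case: c; case: x => ? ? /=; rewrite mul0r ?subr0 ?addr0.
Qed.

Lemma re_conj_mul r x y :
  re_part (conj_scalar x * of_real k r * y) =
  r * (part true x * part true y + part false x * part false y).
Proof.
rewrite /part; case: k x y => x y /=; first by ring.
by case: x => ? ?; case: y => ? ? /=; ring.
Qed.

Lemma of_real1 : of_real k (1 : R) = 1.
Proof. by case: k. Qed.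

Lemma of_realN (r : R) : of_real k (- r) = - of_real k r.
Proof. by case: k => //=; apply/eqP; rewrite eq_complex /= oppr0 !eqxx. Qed.

Lemma part_inj (x y : K) : (forall c, part c x = part c y) -> x = y.
Proof.
move=> h; have := h true; have := h false; rewrite /part.
by case: k x y {h} => //= [[? ?] [? ?]] /= -> ->.
Qed.

Variable n : nat.
Implicit Types (v w : 'cV[K]_n).

Definition vpart c v : 'cV[R]_n := map_mx (part c) v.

Lemma vpart0 c : vpart c 0 = 0.
Proof. by apply/matrixP => i j; rewrite !mxE part0. Qed.

Lemma vpartD c v w : vpart c (v + w) = vpart c v + vpart c w.
Proof. by apply/matrixP => i j; rewrite !mxE partD. Qed.

Lemma vpartZ c r v : vpart c (of_real k r *: v) = r *: vpart c v.
Proof. by apply/matrixP => i j; rewrite !mxE part_real_mul. Qed.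

Lemma vpartN c v : vpart c (- v) = - vpart c v.
Proof. by rewrite -scaleN1r -of_real1 -of_realN vpartZ scaleN1r. Qed.

Lemma vpartB c v w : vpart c (v - w) = vpart c v - vpart c w.
Proof. by rewrite vpartD vpartN. Qed.

Lemma vpart_mul c (A : 'M[R]_n) v : vpart c (of_real_mx k A *m v) = A *m vpart c v.
Proof.
apply/matrixP => i j; rewrite !mxE part_sum.
by apply: eq_bigr => l _; rewrite !mxE part_real_mul.
Qed.

Lemma vpart_inj v w : (forall c, vpart c v = vpart c w) -> v = w.
Proof.
move=> h; apply/matrixP => i j; apply: part_inj => c.
by have /matrixP/(_ i j) := h c; rewrite !mxE.
Qed.

(** A vector with prescribed parts; over the reals the imaginary part is
    dropped. *)
Definition cplx_of (u : bool -> 'cV[R]_n) : 'cV[K]_n :=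
  match k return 'cV[scalars R k]_n with
  | RealScalars => u true
  | ComplexScalars => \col_i Complex (u true i 0) (u false i 0)
  end.

(** The real part of [v^* A w] for a real matrix [A]. *)
Definition bilc (A : 'M[R]_n) v w : R :=
  bil A (vpart true v) (vpart true w) + bil A (vpart false v) (vpart false w).

Lemma re_adjoint (A : 'M[R]_n) v w :
  re_part ((adjoint v *m of_real_mx k A *m w) 0 0) = bilc A v w.
Proof.
have -> : @re_part R k = @part true by [].
rewrite /bilc !bilE mxE part_sum exchange_big.
rewrite [X in _ + X]exchange_big -big_split; apply: eq_bigr => j _.
rewrite mxE big_distrl part_sum -big_split; apply: eq_bigr => i _.
by rewrite !mxE; apply: (etrans (re_conj_mul _ _ _)) => /=; ring.
Qed.

Lemma of_real_mx1 : of_real_mx k (1%:M : 'M[R]_n) = 1%:M.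
Proof.
apply/matrixP => i j; rewrite !mxE; case: eqP => _; rewrite ?mulr1n ?mulr0n ?of_real1//.
by case: k.
Qed.

Lemma re_adjoint1 v w : re_part ((adjoint v *m w) 0 0) = bilc 1%:M v w.
Proof. by rewrite -re_adjoint of_real_mx1 mulmx1. Qed.

Lemma bilc_sum v : bilc 1%:M v v =
  \sum_(c : bool) \sum_i (part c (v i 0)) ^+ 2.
Proof.
rewrite big_bool /bilc !bil_scalar !mul1r /=.
by congr (_ + _); apply: eq_bigr => i _; rewrite mxE.
Qed.

Lemma bilc_amgm (A : 'M[R]_n) v w (C r : R) : 0 < r -> (forall i j, `|A i j| <= C) ->
  `|bilc A v w| <= C * n%:R * (r * bilc 1%:M v v + r^-1 * bilc 1%:M w w).
Proof.
move=> r0 AC; rewrite /bilc.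
have AC' i j : `|(- A) i j| <= C by rewrite mxE normrN.
have := bil_amgm (vpart true v) (vpart true w) r0 AC.
have := bil_amgm (vpart false v) (vpart false w) r0 AC.
have := bil_amgm (vpart true v) (vpart true w) r0 AC'.
have := bil_amgm (vpart false v) (vpart false w) r0 AC'.
rewrite !bilNm => h1 h2 h3 h4; rewrite ler_norml; apply/andP; split; lra.
Qed.

Lemma loewner_le_bilc (A B : 'M[R]_n) v : A ⪯ B -> bilc A v v <= bilc B v v.
Proof. by move=> AB; apply: lerD; apply: loewner_le_bil. Qed.

Lemma bilc1_ge0 v : 0 <= bilc 1%:M v v.
Proof. by rewrite bilc_sum; do 2 (apply: sumr_ge0 => ? _); exact: sqr_ge0. Qed.

End components.

(** * Forms on square integrable states *)

Section continuity_on_segments.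
Variables (R : realType) (a b : R).
Local Notation mu := (@lebesgue_measure R).
Implicit Types f g F G w : R -> R.

Definition cont_on f := {within `[a, b], continuous f}.

Lemma cont_on_cst (c : R) : cont_on (fun=> c).
Proof. by move=> x; exact: cvg_cst. Qed.

Lemma cont_onM f g : cont_on f -> cont_on g -> cont_on (fun z => f z * g z).
Proof. by move=> hf hg x; apply: continuousM; [exact: hf | exact: hg]. Qed.

Lemma cont_onD f g : cont_on f -> cont_on g -> cont_on (fun z => f z + g z).
Proof. by move=> hf hg x; apply: cvgD; [exact: hf | exact: hg]. Qed.

Lemma cont_on_sum n (F : 'I_n -> R -> R) : (forall i, cont_on (F i)) ->
  cont_on (fun z => \sum_i F i z).
Proof.
elim: n F => [|n IH] F hF.
  by under [X in cont_on X]eq_fun do rewrite big_ord0; exact: cont_on_cst.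
under [X in cont_on X]eq_fun do rewrite big_ord_recl.
by apply: cont_onD; [exact: hF | apply: IH].
Qed.

Lemma cont_on_measurable f : cont_on f -> measurable_fun `[a, b] f.
Proof.
by move=> hf; apply: measurable_realfun.subspace_continuous_measurable_fun.
Qed.

Lemma cont_on_integrable f : cont_on f -> mu.-integrable `[a, b] (EFin \o f).
Proof.
by move=> hf; apply: continuous_compact_integrable => //; exact: segment_compact.
Qed.

Lemma cont_on_bounded f : a <= b -> cont_on f ->
  exists2 C, 0 <= C & forall z, z \in `[a, b] -> `|f z| <= C.
Proof.
move=> ab hf.
have hN : cont_on (fun z => -1 * f z) by apply: cont_onM => //; exact: cont_on_cst.
have [c _ hc] := EVT_max ab hf.
have [d _ hd] := EVT_max ab hN.
exists (`|f c| + `|f d|) => [|z zab]; first by rewrite addr_ge0.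
have := hc _ zab; have := hd _ zab.
have := ler_norm (f c); have := ler_norm (- f d); rewrite normrN => *.
have := normr_ge0 (f c); have := normr_ge0 (f d).
by rewrite ler_norml => *; apply/andP; split; lra.
Qed.

Lemma cont_on_matrix_bounded n (W : R -> 'M[R]_n) : a <= b ->
  (forall i j, cont_on (fun z => W z i j)) ->
  exists2 C, 0 <= C & forall z i j, z \in `[a, b] -> `|W z i j| <= C.
Proof.
move=> ab hW.
have hB i j : exists C, 0 <= C /\ forall z, z \in `[a, b] -> `|W z i j| <= C.
  by have [C ? ?] := cont_on_bounded ab (hW i j); exists C.
exists (\sum_i \sum_j xget 0 [set C | 0 <= C /\
    forall z, z \in `[a, b] -> `|W z i j| <= C]).
  do 2 (apply: sumr_ge0 => ? _).
  by case: xgetP => [? ? []|].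
move=> z i j zab; have [C C0] := hB i j.
rewrite (bigD1 i)//= (bigD1 j)//= -addrA.
set x := xget _ _; have : `|W z i j| <= x.
  rewrite /x; case: xgetP => [y _ [_ ->//]|]; by move=> /(_ C).
move=> /le_trans; apply; rewrite lerDl addr_ge0//.
  by apply: sumr_ge0 => ? _; case: xgetP => [? ? []|].
by do 2 (apply: sumr_ge0 => ? _); case: xgetP => [? ? []|].
Qed.

End continuity_on_segments.

#[local] Instance lebesgue_ae_filter (R : realType) :
  Filter (nbhs (almost_everywhere (@lebesgue_measure R))).
Proof. exact: ae_filter_ringOfSetsType. Qed.

Section energy_forms.
Variables (R : realType) (k : scalar_kind) (n : nat) (a b : R).
Local Notation K := (scalars R k).
Local Notation mu := (@lebesgue_measure R).
Local Notation state := (R -> 'cV[K]_n).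
Implicit Types (f g h : state) (W : R -> 'M[R]_n) (r : R).
Local Notation L2 := (@L2 R k n a b).

Definition cont_mx W := forall i j, cont_on a b (fun z => W z i j).

Definition L2form W f g : R := \int[mu]_(z in `[a, b]) bilc (W z) (f z) (g z).

Lemma in_itv_set (z : R) : (z \in `[a, b]%classic) = (z \in `[a, b]).
Proof. by rewrite mem_setE. Qed.

Lemma L2P f : L2 f <->
  (forall c i, measurable_fun `[a, b] (fun z => part c (f z i 0))) /\
  mu.-integrable `[a, b] (EFin \o (fun z => bilc 1%:M (f z) (f z))).
Proof.
have e : (fun z => (re_part ((adjoint (f z) *m f z) 0 0))%:E) =
    EFin \o (fun z => bilc 1%:M (f z) (f z)).
  by apply/funext => z /=; rewrite re_adjoint1.
split=> [[h1 h2 h3]|[h1 h2]].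
  by split=> [[] //|]; rewrite -e.
by split; [exact: (h1 true)|exact: (h1 false)|rewrite e].
Qed.

Lemma measurable_bilc W f g : cont_mx W -> L2 f -> L2 g ->
  measurable_fun `[a, b] (fun z => bilc (W z) (f z) (g z)).
Proof.
move=> hW /L2P[mf _] /L2P[mg _].
have m1 c : measurable_fun `[a, b]
    (fun z => bil (W z) (vpart c (f z)) (vpart c (g z))).
  under [X in measurable_fun _ X]eq_fun do rewrite bilE.
  do 2 (apply: measurable_sum => ?).
  under [X in measurable_fun _ X]eq_fun do rewrite !mxE.
  apply: measurable_funM => //; apply: measurable_funM => //.
  exact: cont_on_measurable.
exact: measurable_funD.
Qed.

Lemma cont_mx1 : cont_mx (fun=> 1%:M).
Proof. by move=> i j; exact: cont_on_cst. Qed.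

Lemma cont_mx_cst A : cont_mx (fun=> A).
Proof. by move=> i j; exact: cont_on_cst. Qed.

Lemma cont_mxM W1 W2 : cont_mx W1 -> cont_mx W2 ->
  cont_mx (fun z => W1 z *m W2 z).
Proof.
move=> h1 h2 i j; under [X in cont_on _ _ X]eq_fun do rewrite mxE.
by apply: cont_on_sum => l; apply: cont_onM.
Qed.

Lemma cont_mxD W1 W2 : cont_mx W1 -> cont_mx W2 ->
  cont_mx (fun z => W1 z + W2 z).
Proof.
move=> h1 h2 i j; under [X in cont_on _ _ X]eq_fun do rewrite mxE.
exact: cont_onD.
Qed.

Lemma cont_mxZ (w : R -> R) W : cont_on a b w -> cont_mx W ->
  cont_mx (fun z => w z *: W z).
Proof.
move=> h1 h2 i j; under [X in cont_on _ _ X]eq_fun do rewrite mxE.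
exact: cont_onM.
Qed.

Hypothesis leab : a <= b.

Lemma bilc_bounded W : cont_mx W -> exists2 C, 0 <= C &
  forall z v w r, z \in `[a, b] -> 0 < r ->
    `|bilc (W z) v w| <=
    C * (r * bilc 1%:M v v + r^-1 * @bilc R k n 1%:M w w).
Proof.
move=> hW; have [C C0 hC] := cont_on_matrix_bounded leab hW.
exists (C * n%:R) => [|z v w r zab r0]; first by rewrite mulr_ge0.
by apply: bilc_amgm => // i j; exact: hC.
Qed.

Lemma integrable_bilc W f g : cont_mx W -> L2 f -> L2 g ->
  mu.-integrable `[a, b] (EFin \o (fun z => bilc (W z) (f z) (g z))).
Proof.
move=> hW hf hg; have [C C0 hC] := bilc_bounded hW.
have /L2P[_ If] := hf; have /L2P[_ Ig] := hg.
apply: (@le_integrable _ _ _ mu _ _ _ (EFin \o (fun z =>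
    C * (bilc 1%:M (f z) (f z) + bilc 1%:M (g z) (g z))))) => //.
- by apply/measurable_EFinP; exact: measurable_bilc.
- move=> z /= zab; rewrite lee_fin.
  apply: le_trans (ler_norm _).
  have := hC z (f z) (g z) 1; rewrite invr1 !mul1r; apply => //.
- have -> : (EFin \o (fun z => C * (bilc 1%:M (f z) (f z) + bilc 1%:M (g z) (g z)))) =
     (fun z => C%:E * (EFin (bilc 1%:M (f z) (f z)) + EFin (bilc 1%:M (g z) (g z))))%E by [].
  by apply: integrableZl => //; apply: integrableD.
Qed.

Lemma L2_lin r f g : L2 f -> L2 g -> L2 (of_real k r *: f + g).
Proof.
move=> hf hg; apply/L2P; have /L2P[mf If] := hf; have /L2P[mg Ig] := hg; split.
  move=> c i; under [X in measurable_fun _ X]eq_fun do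
    rewrite !mxE partD part_real_mul.
  by apply: measurable_funD => //; apply: measurable_funM.
have -> : EFin \o (fun z => bilc 1%:M ((of_real k r *: f + g) z) ((of_real k r *: f + g) z)) =
   (fun z => (r ^+ 2)%:E * (EFin \o (fun z => bilc 1%:M (f z) (f z))) z +
     ((r)%:E * (EFin \o (fun z => bilc 1%:M (f z) (g z))) z +
     ((r)%:E * (EFin \o (fun z => bilc 1%:M (g z) (f z))) z +
     (EFin \o (fun z => bilc 1%:M (g z) (g z))) z)))%E.
  apply/funext => z /=; rewrite -!EFinM -!EFinD; congr EFin.
  by rewrite /bilc !vpartD !vpartZ !bilDl !bilDr !bilZl !bilZr; ring.
have c1 := cont_mx1.
by do 3 (apply: integrableD => //; first by
  [apply: integrableZl => //; exact: (integrable_bilc c1)]).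
Qed.

Lemma L2_0 : L2 0.
Proof.
apply/L2P; split=> [c i|].
  under [X in measurable_fun _ X]eq_fun do rewrite !mxE part0.
  exact: measurable_cst.
have -> : (EFin \o (fun z => bilc 1%:M ((0 : state) z) ((0 : state) z))) = cst 0%E.
  by apply/funext => z /=; rewrite /bilc !vpart0 /bil !mulmx0 mxE addr0.
exact: integrable0.
Qed.

Lemma L2D f g : L2 f -> L2 g -> L2 (f + g).
Proof. by move=> hf hg; rewrite -[f]scale1r -(of_real1 R k); exact: L2_lin. Qed.

Lemma L2Z r f : L2 f -> L2 (of_real k r *: f).
Proof. by move=> hf; rewrite -[X in L2 X]addr0; apply: L2_lin => //; exact: L2_0. Qed.

Lemma L2B f g : L2 f -> L2 g -> L2 (f - g).
Proof.
move=> hf hg; rewrite addrC -scaleN1r -(of_real1 R k) -of_realN; exact: L2_lin.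
Qed.

Lemma L2formDl W f g h : cont_mx W -> L2 f -> L2 g -> L2 h ->
  L2form W (f + g) h = L2form W f h + L2form W g h.
Proof.
move=> hW hf hg hh; rewrite /L2form -RintegralD//; try exact: integrable_bilc.
apply: eq_Rintegral => z _; rewrite /bilc !vpartD !bilDl; ring.
Qed.

Lemma L2formDr W f g h : cont_mx W -> L2 f -> L2 g -> L2 h ->
  L2form W h (f + g) = L2form W h f + L2form W h g.
Proof.
move=> hW hf hg hh; rewrite /L2form -RintegralD//; try exact: integrable_bilc.
apply: eq_Rintegral => z _; rewrite /bilc !vpartD !bilDr; ring.
Qed.

Lemma L2formZl W r f g : cont_mx W -> L2 f -> L2 g ->
  L2form W (of_real k r *: f) g = r * L2form W f g.
Proof.
move=> hW hf hg; rewrite /L2form -RintegralZl//; try exact: integrable_bilc.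
apply: eq_Rintegral => z _; rewrite /bilc !vpartZ !bilZl; ring.
Qed.

Lemma L2formZr W r f g : cont_mx W -> L2 f -> L2 g ->
  L2form W g (of_real k r *: f) = r * L2form W g f.
Proof.
move=> hW hf hg; rewrite /L2form -RintegralZl//; try exact: integrable_bilc.
apply: eq_Rintegral => z _; rewrite /bilc !vpartZ !bilZr; ring.
Qed.

Lemma L2formNl W f g : cont_mx W -> L2 f -> L2 g -> L2form W (- f) g = - L2form W f g.
Proof.
move=> hW hf hg; rewrite -scaleN1r -(of_real1 R k) -of_realN L2formZl//; ring.
Qed.

Lemma L2formNr W f g : cont_mx W -> L2 f -> L2 g -> L2form W g (- f) = - L2form W g f.
Proof.
move=> hW hf hg; rewrite -scaleN1r -(of_real1 R k) -of_realN L2formZr//; ring.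
Qed.

Lemma L2form_sym W f g : (forall z, z \in `[a, b] -> (W z)^T = W z) ->
  L2form W f g = L2form W g f.
Proof.
move=> hW; apply: eq_Rintegral => z; rewrite in_itv_set => zab.
by have Wz := hW _ zab; congr (_ + _); exact: bil_sym.
Qed.

Lemma L2form_le W1 W2 f : cont_mx W1 -> cont_mx W2 -> L2 f ->
  (forall z, z \in `[a, b] -> bilc (W1 z) (f z) (f z) <= bilc (W2 z) (f z) (f z)) ->
  L2form W1 f f <= L2form W2 f f.
Proof.
move=> h1 h2 hf h; apply: le_Rintegral => //; try exact: integrable_bilc.
Qed.

Lemma L2formZm r W f g : cont_mx W -> L2 f -> L2 g ->
  L2form (fun z => r *: W z) f g = r * L2form W f g.
Proof.
move=> h1 hf hg; rewrite /L2form -RintegralZl//; try exact: integrable_bilc.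
apply: eq_Rintegral => z _; rewrite /bilc !bilZm; ring.
Qed.

Lemma L2form_congr W f f' g g' : cont_mx W -> L2 f -> L2 f' -> L2 g -> L2 g' ->
  same_state a b f f' -> same_state a b g g' -> L2form W f g = L2form W f' g'.
Proof.
move=> hW hf hf' hg hg' ff' gg'; rewrite /L2form /Rintegral; congr fine.
apply: ae_eq_integral => //.
- by apply/measurable_EFinP; exact: measurable_bilc.
- by apply/measurable_EFinP; exact: measurable_bilc.
- move: ff' gg'; apply: filterS2 => z e1 e2 /= zab.
  by rewrite e1// e2.
Qed.

Lemma same_refl f : same_state a b f f.
Proof. exact: aeW. Qed.

Lemma same_sym f g : same_state a b f g -> same_state a b g f.
Proof. by apply: filterS => z e zab; rewrite e. Qed.

Lemma same_trans f g h : same_state a b f g -> same_state a b g h ->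
  same_state a b f h.
Proof. by apply: filterS2 => z e1 e2 zab; rewrite e1// e2. Qed.

End energy_forms.

(** * Absolutely continuous functions and integration by parts *)

Section real_integrable.
Context d (T : measurableType d) (R : realType) (mu : {measure set T -> \bar R}).
Variables (D : set T) (mD : measurable D).
Implicit Types f g : T -> R.

Lemma integrable_realD f g :
  mu.-integrable D (EFin \o f) -> mu.-integrable D (EFin \o g) ->
  mu.-integrable D (EFin \o (fun z => f z + g z)).
Proof. by move=> If Ig; apply: eq_integrable (integrableD mD If Ig). Qed.

Lemma integrable_realZ (c : R) f :
  mu.-integrable D (EFin \o f) -> mu.-integrable D (EFin \o (fun z => c * f z)).
Proof. by move=> If; apply: eq_integrable (integrableZl mD c If). Qed.

Lemma integrable_real_cst0 : mu.-integrable D (EFin \o (fun=> 0 : R)).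
Proof. exact: integrable0. Qed.

End real_integrable.

Section triangle.
Variable R : realType.
Local Notation mu := (@lebesgue_measure R).
Implicit Types f g : R -> R.

(** Both sides integrate [f s * g t] over the half plane [t < s]. *)
Lemma triangle_Fubini f g :
  mu.-integrable setT (EFin \o f) -> mu.-integrable setT (EFin \o g) ->
  \int[mu]_s (f s * \int[mu]_(t in `]-oo, s[) g t) =
  \int[mu]_t (g t * \int[mu]_(s in `]t, +oo[) f s).
Proof.
move=> If Ig.
have mf : measurable_fun setT f by have /integrableP[/measurable_EFinP] := If.
have mg : measurable_fun setT g by have /integrableP[/measurable_EFinP] := Ig.
pose T := (measurableTypeR R * measurableTypeR R)%type.
pose h (p : T) : \bar R :=
  (if p.2 < p.1 :> R then f p.1 * g p.2 else 0)%:E.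
have mh : measurable_fun setT h.
  apply/measurable_EFinP; apply: measurable_fun_ifT.
  - by apply: measurable_fun_ltr; [exact: measurable_snd|exact: measurable_fst].
  - apply: measurable_funM.
      by apply: (measurableT_comp mf); exact: measurable_fst.
    by apply: (measurableT_comp mg); exact: measurable_snd.
  - exact: measurable_cst.
have Ih : (mu \x mu)%E.-integrable setT h.
  apply/integrable12ltyP => //.
  apply: (@le_lt_trans _ _ (\int[mu]_s (`|f s|%:E * \int[mu]_t `|g t|%:E))%E).
    apply: ge0_le_integral => //.
    + by move=> x _; apply: integral_ge0.
    + apply: (@measurable_fun_fubini_tonelli_F _ _ _ _ R mu (abse \o h)).
        exact: measurableT_comp.
      by move=> p; exact: abse_ge0.
    + apply: emeasurable_funM => //; apply/measurable_EFinP.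
      exact: measurableT_comp.
    + move=> s _; rewrite -ge0_integralZl//; last first.
        by apply/measurable_EFinP; apply: measurableT_comp.
      apply: ge0_le_integral => //.
      * apply: (measurableT_comp (f := abse) (g := fun t => h (s, t))) => //.
        exact: (measurableT_comp mh (measurable_pair1 s)).
      * apply/measurable_EFinP; apply: measurable_funM => //.
        exact: measurableT_comp.
      * move=> t _; rewrite /h /= lee_fin; case: ifP => _.
          by rewrite normrM.
        by rewrite normr0 mulr_ge0.
  have gfin : (\int[mu]_t `|g t|%:E)%E \is a fin_num.
    apply: integrable_fin_num => //; have := integrable_abse Ig.
    by apply: eq_integrable.
  rewrite -(fineK gfin).
  under eq_integral do rewrite muleC.
  rewrite integralZl//; last by have := integrable_abse If; exact: eq_integrable.
  apply: lte_mul_pinfty => //; first exact: fine_ge0 (integral_ge0 _ _).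
  have := integrable_abse If => /integrable_lty; exact.
rewrite /Rintegral; congr fine.
transitivity (\int[mu]_s \int[mu]_t h (s, t))%E.
  apply: eq_integral => s _; rewrite EFinM fineK; last first.
    by apply: integrable_fin_num => //; apply: integrableS Ig.
  rewrite -integralZl//; last by apply: integrableS Ig.
  rewrite integral_mkcond; apply: eq_integral => t _.
  by rewrite patchE /h /= mem_setE in_itv /=; case: ifP.
rewrite Fubini//; apply: eq_integral => t _; rewrite EFinM fineK; last first.
  by apply: integrable_fin_num => //; apply: integrableS If.
rewrite -integralZl//; last by apply: integrableS If.
rewrite [RHS]integral_mkcond; apply: eq_integral => s _.
by rewrite patchE /h /= mem_setE in_itv /= andbT; case: ifP => // _; rewrite EFinM muleC.
Qed.

End triangle.

Section primitives.
Variables (R : realType) (a b : R).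
Local Notation mu := (@lebesgue_measure R).
Implicit Types (f g F G : R -> R) (z : R).

Lemma triangle_Fubini_itv f g z :
  mu.-integrable `[a, z] (EFin \o f) -> mu.-integrable `[a, z] (EFin \o g) ->
  \int[mu]_(s in `[a, z]) (f s * \int[mu]_(t in `[a, s]) g t) =
  \int[mu]_(t in `[a, z])
     (g t * (\int[mu]_(s in `[a, z]) f s - \int[mu]_(s in `[a, t]) f s)).
Proof.
move=> If Ig.
have mk (h : R -> R) : mu.-integrable `[a, z] (EFin \o h) ->
    mu.-integrable setT (EFin \o (h \_ `[a, z])).
  by move/integrable_mkcond => /(_ (measurable_itv _)); rewrite restrict_EFin.
have := triangle_Fubini (mk _ If) (mk _ Ig).
have -> : \int[mu]_s ((f \_ `[a, z]) s * \int[mu]_(t in `]-oo, s[) (g \_ `[a, z]) t) =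
    \int[mu]_(s in `[a, z]) (f s * \int[mu]_(t in `[a, s]) g t).
  rewrite [RHS]Rintegral_mkcond; apply: eq_Rintegral => s _.
  rewrite !patchE; case: ifPn => [|_]; last by rewrite mul0r.
  rewrite mem_setE in_itv /= => /andP[as_ sz]; congr (_ * _).
  rewrite -Rintegral_mkcondr -Rintegral_itv_bndo_bndc; last first.
    apply: integrableS Ig => // t /=; rewrite !in_itv /= => /andP[-> ts].
    exact: (le_trans (ltW ts)).
  congr Rintegral; apply/seteqP; split=> t /=; rewrite !in_itv /=.
    by move=> [-> /andP[->]].
  by move=> /andP[-> ts]; rewrite ts (le_trans (ltW ts)).
move=> ->.
rewrite [RHS]Rintegral_mkcond; apply: eq_Rintegral => t _.
rewrite !patchE; case: ifPn => [|_]; last by rewrite mul0r.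
rewrite mem_setE in_itv /= => /andP[at_ tz]; congr (_ * _).
rewrite -Rintegral_mkcondr Rintegral_itvB// ?bnd_simp//.
congr Rintegral; apply/seteqP; split=> s /=; rewrite !in_itv /= ?andbT.
  by move=> [-> /andP[_ ->]].
by move=> /andP[ts ->]; rewrite ts (le_trans at_ (ltW ts)).
Qed.

(** [F] is absolutely continuous on the segment with derivative [f]. *)
Definition primitive_on F f := mu.-integrable `[a, b] (EFin \o f) /\
  forall z, z \in `[a, b] -> F z = F a + \int[mu]_(t in `[a, z]) f t.

Lemma integrable_sub f z : z \in `[a, b] ->
  mu.-integrable `[a, b] (EFin \o f) -> mu.-integrable `[a, z] (EFin \o f).
Proof.
rewrite in_itv /= => /andP[_ zb]; apply: integrableS => // t /=.
by rewrite !in_itv /= => /andP[-> /le_trans]; apply.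
Qed.

Hypothesis leab : a <= b.

Lemma primitive_on_cont F f : primitive_on F f -> cont_on a b F.
Proof.
move=> [If hF].
have hc := parameterized_integral_continuous leab If.
apply: (@subspace_eq_continuous _ _ _
  (fun z => F a + parameterized_integral mu a z f)).
  by move=> z; rewrite mem_setE => zab; rewrite -hF.
by apply: cont_onD; [exact: cont_on_cst|].
Qed.

Lemma integrable_cont_mul f F : mu.-integrable `[a, b] (EFin \o f) ->
  cont_on a b F -> mu.-integrable `[a, b] (EFin \o (fun z => f z * F z)).
Proof.
move=> If cF; have [C C0 hC] := cont_on_bounded leab cF.
have mf : measurable_fun `[a, b] f by have /integrableP[/measurable_EFinP] := If.
apply: (@le_integrable _ _ _ mu _ _ _ (EFin \o (fun z => C * f z))) => //.
- by apply/measurable_EFinP; apply: measurable_funM => //; exact: cont_on_measurable.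
- move=> z /= zab; rewrite lee_fin normrM [leRHS]normrM mulrC ler_wpM2r//.
  by apply: (le_trans (hC _ zab)); exact: ler_norm.
- exact: integrable_realZ.
Qed.

(** Expand [F = F a + int f] and [G = G a + int g]: of the products of integrals,
    the two triangles of the square [[a, z] x [a, z]] add up to the product of
    [int f] and [int g]. *)
Lemma primitive_onM F f G g : primitive_on F f -> primitive_on G g ->
  primitive_on (fun z => F z * G z) (fun z => f z * G z + g z * F z).
Proof.
move=> pF pG; have cF := primitive_on_cont pF; have cG := primitive_on_cont pG.
have [If hF] := pF; have [Ig hG] := pG.
have IfG := integrable_cont_mul If cG; have IgF := integrable_cont_mul Ig cF.
split=> [|z zab].
  exact: integrable_realD.
have sub t : t \in `[a, z] -> t \in `[a, b].
  move: zab; rewrite !in_itv /= => /andP[_ zb] /andP[-> tz].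
  exact: le_trans zb.
have Ifz := integrable_sub zab If; have Igz := integrable_sub zab Ig.
have cI h : mu.-integrable `[a, b] (EFin \o h) ->
    cont_on a b (fun s => \int[mu]_(t in `[a, s]) h t).
  by move=> Ih; exact: parameterized_integral_continuous.
have IfIg := integrable_sub zab (integrable_cont_mul If (cI _ Ig)).
have IgIf := integrable_sub zab (integrable_cont_mul Ig (cI _ If)).
rewrite RintegralD//; try exact: integrable_sub zab _.
have -> : \int[mu]_(t in `[a, z]) (f t * G t) =
    G a * \int[mu]_(t in `[a, z]) f t +
    \int[mu]_(s in `[a, z]) (f s * \int[mu]_(t in `[a, s]) g t).
  rewrite -RintegralZl// -RintegralD//; last first.
    by exact: integrable_realZ.
  apply: eq_Rintegral => t; rewrite mem_setE => /sub /hG ->; ring.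
have -> : \int[mu]_(t in `[a, z]) (g t * F t) =
    F a * \int[mu]_(t in `[a, z]) g t +
    \int[mu]_(s in `[a, z]) (g s * \int[mu]_(t in `[a, s]) f t).
  rewrite -RintegralZl// -RintegralD//; last first.
    by exact: integrable_realZ.
  apply: eq_Rintegral => t; rewrite mem_setE => /sub /hF ->; ring.
rewrite triangle_Fubini_itv//.
set x := \int[mu]_(s in `[a, z]) f s; set y := \int[mu]_(s in `[a, z]) g s.
have -> : \int[mu]_(t in `[a, z]) (g t * (x - \int[mu]_(s in `[a, t]) f s)) =
    x * y - \int[mu]_(s in `[a, z]) (g s * \int[mu]_(t in `[a, s]) f t).
  rewrite -RintegralZl// -RintegralB//; last first.
    by exact: integrable_realZ.
  by apply: eq_Rintegral => t _; ring.
by rewrite (hF _ zab) (hG _ zab) -/x -/y; ring.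
Qed.

Lemma primitive_onD F f G g : primitive_on F f -> primitive_on G g ->
  primitive_on (fun z => F z + G z) (fun z => f z + g z).
Proof.
move=> [If hF] [Ig hG]; split=> [|z zab].
  exact: integrable_realD.
rewrite RintegralD//; try exact: integrable_sub zab _.
by rewrite hF// [G z]hG//; ring.
Qed.

Lemma primitive_on_cst (c : R) : primitive_on (fun=> c) (fun=> 0).
Proof.
split=> [|z _]; first exact: integrable_real_cst0.
by rewrite Rintegral_cst// mul0r addr0.
Qed.

Lemma primitive_on_sum n (F f : 'I_n -> R -> R) :
  (forall i, primitive_on (F i) (f i)) ->
  primitive_on (fun z => \sum_i F i z) (fun z => \sum_i f i z).
Proof.
elim: n F f => [|n IH] F f hF.
  have -> : (fun z => \sum_(i < 0) F i z) = fun=> 0.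
    by apply/funext => z; rewrite big_ord0.
  have -> : (fun z => \sum_(i < 0) f i z) = fun=> 0.
    by apply/funext => z; rewrite big_ord0.
  exact: primitive_on_cst.
have -> : (fun z => \sum_(i < n.+1) F i z) =
    fun z => F ord0 z + \sum_(i < n) F (lift ord0 i) z.
  by apply/funext => z; rewrite big_ord_recl.
have -> : (fun z => \sum_(i < n.+1) f i z) =
    fun z => f ord0 z + \sum_(i < n) f (lift ord0 i) z.
  by apply/funext => z; rewrite big_ord_recl.
by apply: primitive_onD; [exact: hF | apply: IH].
Qed.

End primitives.

(** * Continuously differentiable functions and matrices *)

Section continuously_differentiable_functions.
Variables (R : realType) (a b : R).
Hypothesis ltab : a < b.
Local Notation mu := (@lebesgue_measure R).
Implicit Types (f g F G : R -> R) (z : R).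

Definition C1_on F f := [/\ cont_on a b F, cont_on a b f &
  forall z, z \in `]a, b[ -> is_derive z 1 F (f z)].

Lemma C1_on_primitive F f : C1_on F f -> primitive_on a b F f.
Proof.
move=> [cF cf dF]; split; first exact: cont_on_integrable.
move=> z; rewrite in_itv /= => /andP[az zb].
have [->|neaz] := eqVneq z a.
  by rewrite set_itv1 Rintegral_set1 addr0.
have ltaz : a < z by rewrite lt_neqAle eq_sym neaz.
have sub : `[a, z] `<=` `[a, b].
  by move=> t /=; rewrite !in_itv /= => /andP[-> /le_trans ->].
have cFz : cont_on a z F := continuous_subspaceW sub cF.
have cfz : cont_on a z f := continuous_subspaceW sub cf.
have subo t : t \in `]a, z[ -> t \in `]a, b[.
  by rewrite !in_itv /= => /andP[-> /lt_le_trans ->].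
have [_ FL FR] := (continuous_within_itvP F ltaz).1 cFz.
rewrite /Rintegral (continuous_FTC2 ltaz cfz (F := F)).
- by rewrite -EFinB /=; ring.
- split=> // t /subo taz; exact: (@ex_derive _ _ _ _ _ _ _ (dF _ taz)).
- move=> t /subo taz; rewrite derive1E; exact: (@derive_val _ _ _ _ _ _ _ (dF _ taz)).
Qed.

Lemma C1_on_cst (c : R) : C1_on (fun=> c) (fun=> 0).
Proof.
split; [exact: cont_on_cst|exact: cont_on_cst|move=> z _; exact: is_derive_cst].
Qed.

Lemma C1_on_id : C1_on id (fun=> 1).
Proof.
split; [|exact: cont_on_cst|move=> z _; exact: is_derive_id].
by move=> z; apply: continuous_subspaceT => ?; exact: cvg_id.
Qed.

Lemma C1_onD F f G g : C1_on F f -> C1_on G g ->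
  C1_on (fun z => F z + G z) (fun z => f z + g z).
Proof.
move=> [cF cf dF] [cG cg dG]; split; [exact: cont_onD|exact: cont_onD|].
by move=> z zab; apply: is_deriveD; [exact: dF|exact: dG].
Qed.

Lemma C1_onM F f G g : C1_on F f -> C1_on G g ->
  C1_on (fun z => F z * G z) (fun z => F z * g z + G z * f z).
Proof.
move=> [cF cf dF] [cG cg dG]; split; [exact: cont_onM| |].
  by apply: cont_onD; exact: cont_onM.
move=> z zab; have h := is_deriveM (dF _ zab) (dG _ zab).
by apply: is_derive_eq h _.
Qed.

Lemma C1_onZ (c : R) F f : C1_on F f -> C1_on (fun z => c * F z) (fun z => c * f z).
Proof.
move=> [cF cf dF]; split.
- by apply: cont_onM => //; exact: cont_on_cst.
- by apply: cont_onM => //; exact: cont_on_cst.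
- move=> z zab; have h := is_deriveZ c (dF _ zab); exact: is_derive_eq h _.
Qed.

Lemma cont_onV f : cont_on a b f -> (forall z, z \in `[a, b] -> f z != 0) ->
  cont_on a b (fun z => (f z)^-1).
Proof.
move=> cf f0; apply: (@within_continuous_comp _ _ _ _ f (fun x : R => x^-1)) => //.
by move=> y; rewrite inE => -[z zab <-]; apply: inv_continuous; exact: f0.
Qed.

Lemma C1_onV F f : C1_on F f -> (forall z, z \in `[a, b] -> F z != 0) ->
  C1_on (fun z => (F z)^-1) (fun z => - (F z)^-1 * (F z)^-1 * f z).
Proof.
move=> [cF cf dF] F0; have cV := cont_onV cF F0; split=> //.
  have -> : (fun z => - (F z)^-1 * (F z)^-1 * f z) =
      (fun z => -1 * ((F z)^-1 * (F z)^-1 * f z)) by apply/funext => z; ring.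
  apply: cont_onM; first exact: cont_on_cst.
  by do 2 apply: cont_onM => //.
move=> z zab; have Fz : F z != 0.
  by apply: F0; move: zab; rewrite !in_itv /= => /andP[/ltW-> /ltW->].
apply: is_derive_eq (is_deriveV Fz (dF _ zab)) _.
by rewrite /GRing.scale /= expr2 invfM !mulNr.
Qed.

Definition is_C1_on F := exists f, C1_on F f.

Lemma is_C1_on_sum (I : Type) (s : seq I) (F : I -> R -> R) :
  (forall i, is_C1_on (F i)) -> is_C1_on (fun z => \sum_(i <- s) F i z).
Proof.
move=> hF; elim: s => [|i s [g hg]].
  exists (fun=> 0); under eq_fun do rewrite big_nil; exact: C1_on_cst.
have [f hf] := hF i; exists (fun z => f z + g z).
by under eq_fun do rewrite big_cons; exact: C1_onD.
Qed.

Lemma is_C1_on_prod (I : Type) (s : seq I) (F : I -> R -> R) :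
  (forall i, is_C1_on (F i)) -> is_C1_on (fun z => \prod_(i <- s) F i z).
Proof.
move=> hF; elim: s => [|i s [g hg]].
  exists (fun=> 0); under eq_fun do rewrite big_nil; exact: C1_on_cst.
have [f hf] := hF i; exists (fun z => F i z * g z + (\prod_(i <- s) F i z) * f z).
by under eq_fun do rewrite big_cons; exact: C1_onM.
Qed.

Lemma is_C1_on_det n (A : R -> 'M[R]_n) :
  (forall i j, is_C1_on (fun z => A z i j)) -> is_C1_on (fun z => \det (A z)).
Proof.
move=> hA; rewrite /determinant; apply: is_C1_on_sum => s.
have [f hf] : is_C1_on (fun z => \prod_i A z i (perm.fun_of_perm s i)).
  exact: is_C1_on_prod.
by eexists; exact: C1_onZ hf.
Qed.

(** Cramer's formula, which is manifestly differentiable in the entries. *)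
Definition cramer_inv n (A : 'M[R]_n) := (\det A)^-1 *: \adj A.

Lemma cramer_inv_l n (A : 'M[R]_n) : \det A != 0 -> cramer_inv A *m A = 1%:M.
Proof.
by move=> d0; rewrite /cramer_inv -scalemxAl mul_adj_mx scale_scalar_mx mulVf.
Qed.

Lemma cramer_inv_r n (A : 'M[R]_n) : \det A != 0 -> A *m cramer_inv A = 1%:M.
Proof.
by move=> d0; rewrite /cramer_inv -scalemxAr mul_mx_adj scale_scalar_mx mulVf.
Qed.

Lemma is_C1_on_cramer_inv n (A : R -> 'M[R]_n) :
  (forall i j, is_C1_on (fun z => A z i j)) ->
  (forall z, z \in `[a, b] -> \det (A z) != 0) ->
  forall i j, is_C1_on (fun z => cramer_inv (A z) i j).
Proof.
move=> hA d0 i j; have [d hd] := is_C1_on_det hA.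
have [c hc] : is_C1_on (fun z => \adj (A z) i j).
  under eq_fun do rewrite mxE /cofactor.
  have [f hf] : is_C1_on (fun z => \det (row' j (col' i (A z)))).
    by apply: is_C1_on_det => i' j'; under eq_fun do rewrite !mxE.
  by eexists; exact: C1_onZ hf.
under eq_fun do rewrite mxE.
by eexists; exact: (C1_onM (C1_onV hd d0) hc).
Qed.

(** Differentiating [K A = 1]. *)
Lemma derive_inverse_mx n (A dA K dK : R -> 'M[R]_n) :
  (forall i j, C1_on (fun z => A z i j) (fun z => dA z i j)) ->
  (forall i j, C1_on (fun z => K z i j) (fun z => dK z i j)) ->
  (forall z, z \in `[a, b] -> K z *m A z = 1%:M) ->
  (forall z, z \in `[a, b] -> A z *m K z = 1%:M) ->
  forall z, z \in `]a, b[ -> dK z = - (K z *m dA z *m K z).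
Proof.
move=> hA hK KA AK z zab.
have zab' : z \in `[a, b] by move: zab; rewrite !in_itv /= => /andP[/ltW-> /ltW->].
suff h : dK z *m A z + K z *m dA z = 0.
  have := congr1 (fun M => M *m K z) h.
  rewrite mulmxDl mul0mx -mulmxA AK// mulmx1 => /eqP.
  by rewrite addr_eq0 => /eqP.
apply/matrixP => i j; rewrite !mxE -big_split /=.
have dsum : is_derive z 1 (fun s => \sum_l K s i l * A s l j)
    (\sum_l (dK z i l * A z l j + K z i l * dA z l j)).
  have -> : (fun s => \sum_l K s i l * A s l j) =
      \sum_l (fun s => K s i l * A s l j) by apply/funext => s; rewrite fct_sumE.
  apply: is_derive_sum => l.
  have [_ _ dKl] := hK i l; have [_ _ dAl] := hA l j.
  apply: is_derive_eq (is_deriveM (dKl _ zab) (dAl _ zab)) _.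
  by rewrite /GRing.scale /=; ring.
rewrite -(@derive_val _ _ _ _ _ _ _ dsum).
rewrite (@near_eq_derive _ _ _ _ (cst ((1%:M : 'M[R]_n) i j))) ?derive_cst//.
near=> s; rewrite /cst -(KA s) ?mxE//.
have : s \in `]a, b[ by near: s; exact: near_in_itvoo.
by rewrite !in_itv /= => /andP[/ltW-> /ltW->].
Unshelve. all: by end_near.
Qed.

Lemma det_neq0_coercive n (A : 'M[R]_n) (m : R) : 0 < m -> m%:M ⪯ A -> \det A != 0.
Proof.
move=> m0 mA; rewrite -unitfE -unitmxE -row_free_unit -kermx_eq0.
apply/eqP/row_matrixP => i; rewrite row0.
set u := row i (kermx A).
have uA : u *m A = 0 by apply/sub_kermxP; exact: row_sub.
have := loewner_le_bil u^T mA.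
rewrite {2}/bil trmxK uA mul0mx mxE bil_scalar => h.
have h0 : \sum_j (u^T j 0) ^+ 2 = 0.
  apply/eqP; rewrite eq_le sumr_ge0 ?andbT; last by move=> ? _; exact: sqr_ge0.
  by rewrite -(pmulr_rle0 _ m0).
apply/matrixP => i' j; rewrite ord1 [RHS]mxE.
have /eqP := h0; rewrite psumr_eq0; last by move=> ? _; exact: sqr_ge0.
by move=> /allP/(_ j (mem_index_enum _)); rewrite sqrf_eq0 mxE => /eqP.
Qed.

End continuously_differentiable_functions.

(** * Continuous representatives *)

Section continuous_representatives.
Variables (R : realType) (k : scalar_kind).
Local Notation K := (scalars R k).

(** The order and the norm of complex numbers are complex valued, so the bound
    is on the real part of [e]. *)
Lemma complex_part_lipschitz (c : bool) (x y : R[i]) (e : R[i]) :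
  `|x - y| < e ->
  `|(if c then complex.Re x else complex.Im x) -
    (if c then complex.Re y else complex.Im y)| < complex.Re e.
Proof.
rewrite ltcE => /andP[_]; apply: le_lt_trans.
case: c x y => -[x1 x2] [y1 y2] /=.
  by rewrite -sqrtr_sqr ler_wsqrtr// lerDl sqr_ge0.
by rewrite -sqrtr_sqr ler_wsqrtr// lerDr sqr_ge0.
Qed.

Lemma part_near (c : bool) (x : K) (e : R) : 0 < e ->
  exists2 d : K, 0 < d & forall y, `|x - y| < d -> `|part c x - part c y| < e.
Proof.
rewrite /part; case: k x => x e0 /=.
  case: c; first by exists e.
  by exists 1 => // y _; rewrite subrr normr0.
exists (Complex e 0) => [|y]; first by rewrite ltcE /= eqxx.
by move=> /(complex_part_lipschitz c); case: c.
Qed.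

Lemma near_part (d : K) : 0 < d -> exists2 e : R, 0 < e &
  forall x y : K, (forall c, `|part c x - part c y| < e) -> `|x - y| < d.
Proof.
rewrite /part; case: k d => d d0 /=.
  by exists d => // x y /(_ true).
case: d d0 => d1 d2; rewrite ltcE /= => /andP[/eqP -> d10].
exists (d1 / 2) => [|[x1 x2] [y1 y2] h]; first by rewrite divr_gt0.
have := h true; have := h false; rewrite /= => h2 h1.
rewrite ltcE /= eqxx /=.
rewrite -(ger0_norm (ltW d10)) -sqrtr_sqr ltr_sqrt ?exprn_gt0//.
rewrite -[X in X + _]real_normK ?num_real// -[X in _ + X]real_normK ?num_real//.
set u := `|_|; set v := `|_|.
have u0 : 0 <= u by exact: normr_ge0.
have v0 : 0 <= v by exact: normr_ge0.
have : u * u <= d1 / 2 * (d1 / 2) by apply: ler_pM => //; exact: ltW.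
have : v * v <= d1 / 2 * (d1 / 2) by apply: ler_pM => //; exact: ltW.
have : 0 < d1 * d1 by rewrite mulr_gt0.
rewrite !expr2; lra.
Qed.

Lemma part_continuous (c : bool) : continuous (part c : K -> R).
Proof.
move=> x; apply/(@cvgrPdist_lt _ _ _ (nbhs x) (nbhs_filter x)) => e e0.
have [d d0 hd] := part_near c x e0.
have : \forall y \near x, `|x - y| < d.
  exact: (@cvgr_dist_lt _ _ _ (nbhs x) (nbhs_filter x) id x (@cvg_id _ _) d d0).
by apply: filterS => y; exact: hd.
Qed.

Variables (n : nat) (a b : R).
Local Notation state := (R -> 'cV[K]_n).
Local Notation mu := (@lebesgue_measure R).
Implicit Types u h : state.

Lemma cont_on_part h c i : {within `[a, b], continuous h} ->
  cont_on a b (fun z => part c (h z i 0)).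
Proof.
have cc : continuous (fun M : 'cV[K]_n => part c (M i 0)).
  move=> M; apply: (cvg_comp (fun M : 'cV[K]_n => M i 0) (part c)).
    exact: coord_continuous.
  exact: part_continuous.
move=> ch z.
exact: (cvg_comp h (fun M : 'cV[K]_n => part c (M i 0)) (ch z) (cc (h z))).
Qed.

Lemma part_cont_on h : (forall c i, cont_on a b (fun z => part c (h z i 0))) ->
  {within `[a, b], continuous h}.
Proof.
move=> ch z; apply/cvg_ballP => d d0.
have [e e0 he] := near_part d0.
have : \forall y \near nbhs (z : subspace `[a, b]), forall (c : bool) (i : 'I_n),
    `|part c (h z i 0) - part c (h y i 0)| < e.
  apply: filter_forall => c; apply: filter_forall => i.
  exact: (@cvgr_dist_lt _ _ _ _ _ _ _ (ch c i z) _ e0).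
apply: filterS => y hy; rewrite mx_norm_ball.
rewrite /ball_ /=.
have : ball (h z) d (h y).
  by split=> // i j; rewrite ord1; apply: he.
by rewrite mx_norm_ball.
Qed.

(** If they differ at a point they differ on a relative neighbourhood, which
    contains an interval of positive length. *)
Lemma cont_on_ae_eq (f g : R -> R) : a < b -> cont_on a b f -> cont_on a b g ->
  (\forall z \ae mu, z \in `[a, b] -> f z = g z) ->
  forall z, z \in `[a, b] -> f z = g z.
Proof.
move=> ltab cf cg fg z zab; apply: contrapT => /eqP fgz.
have cd : cont_on a b (fun z => f z + -1 * g z).
  by apply: cont_onD => //; apply: cont_onM => //; exact: cont_on_cst.
have d0 : 0 < `|f z + -1 * g z| by rewrite normr_gt0 mulN1r subr_eq0.
have : \forall y \near within `[a, b] (nbhs z), f y != g y.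
  have := @cvgr_dist_lt _ _ _ _ (nbhs_filter _) _ _ (cd z) _ d0.
  rewrite nbhs_subspace_in//; apply: filterS => y hy; apply/eqP => fgy.
  move: hy; rewrite /from_subspace /= fgy.
  have -> : g y + -1 * g y = 0 by ring.
  by rewrite subr0 ltxx.
rewrite near_withinE => /nbhs_ballP[e /= e0 he].
set l := Num.max a (z - e); set r := Num.min b (z + e).
have lr : l < r.
  move: zab; rewrite in_itv /= => /andP[az zb].
  by rewrite lt_min !gt_max ltab /=; apply/and3P; split; lra.
have : mu.-negligible `]l, r[.
  apply: negligibleS fg => y /=; rewrite in_itv /= gt_max lt_min.
  move=> /andP[/andP[ay zy] /andP[yb yz]] fgy.
  have yab : y \in `[a, b] by rewrite in_itv /= !ltW.
  have /eqP : f y != g y.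
    apply: he => //; rewrite /ball /= ltr_norml; apply/andP; split; lra.
  by apply; exact: fgy.
move=> neg; have : mu `]l, r[%classic = 0 by apply/negligibleP.
rewrite /= lebesgue_measure_itv /= lte_fin lr -EFinD => -[] /eqP.
by rewrite subr_eq0 gt_eqF.
Qed.

Lemma cont_rep_unique u h : a < b -> same_state a b u h ->
  (forall c i, cont_on a b (fun z => part c (h z i 0))) ->
  forall z, z \in `[a, b] -> cont_rep a b u z = h z.
Proof.
move=> ltab uh ch z zab; rewrite /cont_rep.
case: xgetP => [h' _ [uh' ch']|/(_ h)[]]; last first.
  by split=> //; exact: part_cont_on.
apply: vpart_inj => c; apply/matrixP => i j; rewrite ord1 !mxE.
apply: (@cont_on_ae_eq (fun z => part c (h' z i 0)) (fun z => part c (h z i 0))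
  ltab (cont_on_part ch') (ch c i)) => //.
by move: uh uh'; apply: filterS2 => y e1 e2 yab; rewrite -e1// e2.
Qed.

End continuous_representatives.

(** * The energy identity *)

Section energy_identity.
Variables (R : realType) (k : scalar_kind) (n : nat) (a b m : R).
Local Notation K := (scalars R k).
Local Notation mu := (@lebesgue_measure R).
Local Notation state := (R -> 'cV[K]_n).
Local Notation L2 := (@L2 R k n a b).
Implicit Types (x y g h : state).

Lemma Rintegral_ae_eq (D : set R) (f g : R -> R) : measurable D ->
  mu.-integrable D (EFin \o f) -> mu.-integrable D (EFin \o g) ->
  (\forall z \ae mu, D z -> f z = g z) ->
  \int[mu]_(z in D) f z = \int[mu]_(z in D) g z.
Proof.
move=> mD If Ig fg; rewrite /Rintegral; congr fine.
apply: ae_eq_integral => //.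
- by have /integrableP[] := If.
- by have /integrableP[] := Ig.
- by move: fg; apply: filterS => z e zD; rewrite e.
Qed.

Lemma ae_neq (c : R) : \forall z \ae mu, z != c.
Proof.
have : mu.-negligible [set c].
  by apply/negligibleP => //; exact: lebesgue_measure_set1.
by apply: negligibleS => z /= /negP; rewrite negbK => /eqP.
Qed.

Lemma part_vec_integral (D : set R) g c i :
  part c (vec_integral D g i 0) = \int[mu]_(z in D) part c (g z i 0).
Proof.
rewrite mxE /part; case: k g => g; case: c => //=.
by rewrite Rintegral_mkcond; under eq_Rintegral do rewrite patchE if_same;
   rewrite Rintegral_cst// mul0r.
Qed.

Lemma part_sqr_le (v : 'cV[K]_n) c i : part c (v i 0) ^+ 2 <= bilc 1%:M v v.
Proof.
rewrite bilc_sum (bigD1 c)//= (bigD1 i)//= -addrA lerDl addr_ge0//.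
  by apply: sumr_ge0 => ? _; exact: sqr_ge0.
by do 2 (apply: sumr_ge0 => ? _); exact: sqr_ge0.
Qed.

Lemma L2_part_integrable g c i : L2 g ->
  mu.-integrable `[a, b] (EFin \o (fun z => part c (g z i 0))).
Proof.
move=> /L2P[mg Ig].
apply: (@le_integrable _ _ _ mu _ _ _
    (EFin \o (fun z => 1 + bilc 1%:M (g z) (g z)))) => //.
- by apply/measurable_EFinP; exact: mg.
- move=> z /= zab; rewrite lee_fin.
  apply: le_trans (ler_norm _).
  have := part_sqr_le (g z) c i; have := sqr_ge0 (`|part c (g z i 0)| - 1).
  have := sqr_ge0 (part c (g z i 0)).
  rewrite -[part c (g z i 0) ^+ 2]real_normK ?num_real// !expr2.
  set t := `|_|; lra.
- apply: integrable_realD => //; apply: cont_on_integrable; exact: cont_on_cst.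
Qed.

Hypothesis ltab : a < b.
Let leab := ltW ltab.

Lemma weak_derivative_primitive u g : weak_derivative a b u g ->
  exists2 h : state, same_state a b u h &
    forall c i, primitive_on a b (fun z => part c (h z i 0))
                                 (fun z => part c (g z i 0)).
Proof.
move=> [L2g [h [uh hh]]]; exists h => // c i; split.
  exact: L2_part_integrable.
move=> z zab; by rewrite -part_vec_integral hh// mxE partD.
Qed.

Variables (P1 P0 : 'M[R]_n) (H dH : R -> 'M[R]_n).
Hypothesis H_C1 : forall i j, C1_on a b (fun z => H z i j) (fun z => dH z i j).
Hypothesis H_sym : forall z, z \in `[a, b] -> (H z)^T = H z.
Hypothesis m_gt0 : 0 < m.
Hypothesis H_ge : forall z, z \in `[a, b] -> m%:M ⪯ H z.
Hypothesis P1_unit : P1 \in unitmx.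

Definition Hinv z := cramer_inv (H z).

Lemma det_H z : z \in `[a, b] -> \det (H z) != 0.
Proof. by move=> zab; apply: det_neq0_coercive m_gt0 (H_ge zab). Qed.

Lemma HinvK z : z \in `[a, b] -> Hinv z *m H z = 1%:M.
Proof. by move=> /det_H; exact: cramer_inv_l. Qed.

Lemma HHinv z : z \in `[a, b] -> H z *m Hinv z = 1%:M.
Proof. by move=> /det_H; exact: cramer_inv_r. Qed.

Lemma Hinv_sym z : z \in `[a, b] -> (Hinv z)^T = Hinv z.
Proof.
move=> zab; rewrite -[LHS]mulmx1 -(HHinv zab) mulmxA.
by rewrite -{1}(H_sym zab) -trmx_mul HHinv// trmx1 mul1mx.
Qed.

Lemma cont_mxH : cont_mx a b H.
Proof. by move=> i j; have [] := H_C1 i j. Qed.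

Lemma cont_mxdH : cont_mx a b dH.
Proof. by move=> i j; have [] := H_C1 i j. Qed.

Lemma Hinv_C1 : exists dK : R -> 'M[R]_n,
  (forall i j, C1_on a b (fun z => Hinv z i j) (fun z => dK z i j)) /\
  forall z, z \in `]a, b[ -> dK z = - (Hinv z *m dH z *m Hinv z).
Proof.
have hK i j : is_C1_on a b (fun z => Hinv z i j).
  apply: is_C1_on_cramer_inv => [i' j'|]; last exact: det_H.
  by eexists; exact: H_C1.
have hex : forall ij : 'I_n * 'I_n, exists f, C1_on a b (fun z => Hinv z ij.1 ij.2) f.
  by move=> ij; exact: hK.
have [F hF] := choice hex.
pose dK z := \matrix_(i, j) F (i, j) z.
have C1K i j : C1_on a b (fun z => Hinv z i j) (fun z => dK z i j).
  by under [X in C1_on _ _ _ X]eq_fun do rewrite mxE; exact: (hF (i, j)).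
exists dK; split=> //; apply: (derive_inverse_mx H_C1 C1K).
- exact: HinvK.
- exact: HHinv.
Qed.

Lemma cont_mxHinv : cont_mx a b Hinv.
Proof. by have [dK [hK _]] := Hinv_C1 => i j; have [] := hK i j. Qed.

Lemma bil_H_Hinv z (u w : 'cV[R]_n) : z \in `[a, b] ->
  bil (H z) (Hinv z *m u) (Hinv z *m w) = bil (Hinv z) u w.
Proof.
by move=> zab; rewrite bil_mulr HHinv// bil_mull mulmx1 Hinv_sym.
Qed.

(** The state itself is continuous, being [H^-1] applied to the
    representative of [H x]. *)
Lemma cont_rep_Hinv x h : same_state a b (mulH H x) h ->
  (forall c i, cont_on a b (fun z => part c (h z i 0))) ->
  same_state a b x (fun z => of_real_mx k (Hinv z) *m h z) /\
  forall z, z \in `[a, b] -> cont_rep a b x z = of_real_mx k (Hinv z) *m h z.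
Proof.
move=> xh ch.
have sx : same_state a b x (fun z => of_real_mx k (Hinv z) *m h z).
  move: xh; apply: filterS => z e zab; rewrite -e// /mulH.
  by apply: vpart_inj => c; rewrite !vpart_mul mulmxA HinvK// mul1mx.
split=> //; apply: cont_rep_unique => // c i.
have -> : (fun z => part c ((of_real_mx k (Hinv z) *m h z) i 0)) =
    (fun z => \sum_j Hinv z i j * part c (h z j 0)).
  apply/funext => z; have := congr1 (fun v : 'cV[R]_n => v i 0) (vpart_mul c (Hinv z) (h z)).
  rewrite mxE [(Hinv z *m _) i 0]mxE => ->.
  by apply: eq_bigr => j _; rewrite [vpart _ _ _ _]mxE.
by apply: cont_on_sum => j; apply: cont_onM => //; exact: cont_mxHinv.
Qed.

Lemma energy_at_Hinv x h z : same_state a b (mulH H x) h ->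
  (forall c i, cont_on a b (fun z => part c (h z i 0))) -> z \in `[a, b] ->
  energy_at a b H x z = bilc (Hinv z) (h z) (h z).
Proof.
move=> xh ch zab; have [_ cx] := cont_rep_Hinv xh ch.
by rewrite /energy_at re_adjoint cx// /bilc !vpart_mul !bil_H_Hinv.
Qed.

(** The zeroth order term left over when the principal part is integrated by
    parts. *)
Definition lower_order z : 'M[R]_n := dH z + 2 *: (invmx P1 *m P0 *m H z).

Lemma cont_mx_lower_order : cont_mx a b lower_order.
Proof.
apply: cont_mxD; first exact: cont_mxdH.
apply: cont_mxZ; first exact: cont_on_cst.
by apply: cont_mxM; [exact: cont_mx_cst|exact: cont_mxH].
Qed.

(** Integrate the derivative of [beta h^* H^-1 h], where [h] represents [H x].
    Differentiating [H^-1] produces [- x^* H' x], and substituting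
    [h' = P1^-1 y - P1^-1 P0 h] produces the remaining terms. *)
Lemma energy_identity beta dbeta x y : C1_on a b beta dbeta ->
  L2 x -> L2 y ->
  (exists g, weak_derivative a b (mulH H x) g /\
     same_state a b y (fun z => of_real_mx k P1 *m g z + of_real_mx k P0 *m mulH H x z)) ->
  beta b * energy_at a b H x b - beta a * energy_at a b H x a =
  L2form a b (fun z => dbeta z *: H z) x x +
  2 * L2form a b (fun z => beta z *: invmx P1) x y -
  L2form a b (fun z => beta z *: lower_order z) x x.
Proof.
move=> hbeta L2x L2y [g [wg ey]].
have [h xh ph] := weak_derivative_primitive wg.
have ch c i : cont_on a b (fun z => part c (h z i 0)).
  exact: (primitive_on_cont leab (ph c i)).
have [sx _] := cont_rep_Hinv xh ch.
rewrite !(energy_at_Hinv xh ch) ?in_itv /= ?lexx ?leab//.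
have [dK [hK dKE]] := Hinv_C1.
pose E c z := \sum_i \sum_j Hinv z i j * part c (h z i 0) * part c (h z j 0).
pose dE c z := \sum_i \sum_j
  ((dK z i j * part c (h z i 0) + part c (g z i 0) * Hinv z i j) * part c (h z j 0) +
   part c (g z j 0) * (Hinv z i j * part c (h z i 0))).
have pE c : primitive_on a b (E c) (dE c).
  apply: primitive_on_sum => i; apply: primitive_on_sum => j.
  apply: primitive_onM => //; apply: primitive_onM => //.
  exact: C1_on_primitive.
pose F z := beta z * (E true z + E false z).
pose dF z := dbeta z * (E true z + E false z) + (dE true z + dE false z) * beta z.
have pF : primitive_on a b F dF.
  have pEE := primitive_onD (pE true) (pE false).
  have pb := C1_on_primitive hbeta.
  have h1 := primitive_onM leab pb pEE.
  exact: h1.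
have EE c z : E c z = bil (Hinv z) (vpart c (h z)) (vpart c (h z)).
  by rewrite bilE; do 2 apply: eq_bigr => ? _; rewrite !mxE.
have dEE c z : dE c z = bil (dK z) (vpart c (h z)) (vpart c (h z)) +
    bil (Hinv z) (vpart c (g z)) (vpart c (h z)) +
    bil (Hinv z) (vpart c (h z)) (vpart c (g z)).
  rewrite !bilE -!big_split; apply: eq_bigr => i _; rewrite -!big_split.
  by apply: eq_bigr => j _; rewrite !mxE /=; ring.
have [IdF hF] := pF.
have -> : beta b * bilc (Hinv b) (h b) (h b) - beta a * bilc (Hinv a) (h a) (h a) =
    \int[mu]_(z in `[a, b]) dF z.
  rewrite /bilc -!EE -/(F b) -/(F a) hF ?in_itv /= ?lexx ?leab//; ring.
have [cbeta cdbeta _] := hbeta.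
have cN := cont_mxZ cbeta cont_mx_lower_order.
have cH := cont_mxZ cdbeta cont_mxH.
have cP := cont_mxZ cbeta (@cont_mx_cst R n a b (invmx P1)).
have I1 := integrable_bilc leab cH L2x L2x.
have I2 : mu.-integrable `[a, b]
    (EFin \o (fun z => 2 * bilc (beta z *: invmx P1) (x z) (y z))).
  by apply: integrable_realZ => //; exact: integrable_bilc.
have I3 : mu.-integrable `[a, b]
    (EFin \o (fun z => -1 * bilc (beta z *: lower_order z) (x z) (x z))).
  by apply: integrable_realZ => //; exact: integrable_bilc.
have -> : L2form a b (fun z => dbeta z *: H z) x x +
    2 * L2form a b (fun z => beta z *: invmx P1) x y -
    L2form a b (fun z => beta z *: lower_order z) x x =
  \int[mu]_(z in `[a, b]) (bilc (dbeta z *: H z) (x z) (x z) +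
     2 * bilc (beta z *: invmx P1) (x z) (y z) +
     -1 * bilc (beta z *: lower_order z) (x z) (x z)).
  rewrite RintegralD//; last exact: integrable_realD.
  rewrite RintegralD// !RintegralZl//; try exact: integrable_bilc.
  by rewrite mulN1r.
apply: Rintegral_ae_eq => //.
  by apply: integrable_realD => //; exact: integrable_realD.
(* The derivative of [H^-1] is only known in the open interval. *)
have ab_ne : \forall z \ae mu, z != a /\ z != b.
  by move: (ae_neq a) (ae_neq b); apply: filterS2.
have xhe : \forall z \ae mu, z \in `[a, b] ->
    x z = of_real_mx k (Hinv z) *m h z /\ mulH H x z = h z.
  by move: sx xh; apply: filterS2 => z e1 e2 zab; rewrite e1// e2.
move: ab_ne xhe ey; apply: filterS3 => z [za zb] exh ey' zab'.
have zab : z \in `[a, b] by [].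
have zoo : z \in `]a, b[.
  move: zab; rewrite !in_itv /= => /andP[az bz].
  by rewrite !lt_neqAle eq_sym za az zb.
have -> : dF z = \sum_(c : bool) (dbeta z * E c z + dE c z * beta z).
  by rewrite big_bool /= /dF; ring.
have -> : bilc (dbeta z *: H z) (x z) (x z) +
     2 * bilc (beta z *: invmx P1) (x z) (y z) +
     -1 * bilc (beta z *: lower_order z) (x z) (x z) =
  \sum_(c : bool) (bil (dbeta z *: H z) (vpart c (x z)) (vpart c (x z)) +
     2 * bil (beta z *: invmx P1) (vpart c (x z)) (vpart c (y z)) +
     -1 * bil (beta z *: lower_order z) (vpart c (x z)) (vpart c (x z))).
  by rewrite big_bool /= /bilc; ring.
have [ex eh] := exh zab.
apply: eq_bigr => c _; rewrite EE dEE dKE// ex ey'// eh.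
rewrite !vpartD !vpart_mul.
set u := vpart c (h z); set w := vpart c (g z).
have Ks := Hinv_sym zab.
rewrite [bil (dbeta z *: _) _ _]bilZm [bil (beta z *: invmx _) _ _]bilZm.
rewrite [bil (beta z *: _) _ _]bilZm bil_H_Hinv// /lower_order bilDm.
rewrite [bil (2 *: _) _ _]bilZm.
rewrite bilDr bil_mulr mulVmx// [bil _ _ (P0 *m u)]bil_mulr.
have e1 : bil (dH z) (Hinv z *m u) (Hinv z *m u) = bil (Hinv z *m dH z *m Hinv z) u u.
  by rewrite bil_mulr bil_mull Ks mulmxA.
have e2 : bil 1%:M (Hinv z *m u) w = bil (Hinv z) u w.
  by rewrite bil_mull Ks mulmx1.
have e3 : bil (invmx P1 *m P0 *m H z) (Hinv z *m u) (Hinv z *m u) =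
    bil (invmx P1 *m P0) (Hinv z *m u) u.
  by rewrite bil_mulr -[_ *m H z *m _]mulmxA HHinv// mulmx1.
rewrite e1 e2 e3 bilNm (bil_sym w u Ks); ring.
Qed.

End energy_identity.

(** * The energy norm *)

Section energy_space.
Variables (R : realType) (k : scalar_kind) (n : nat) (a b m : R).
Local Notation K := (scalars R k).
Local Notation mu := (@lebesgue_measure R).
Local Notation state := (R -> 'cV[K]_n).
Local Notation L2 := (@L2 R k n a b).
Local Notation "f ~ g" := (same_state a b f g) (at level 70).
Implicit Types (f g h x y : state).

Hypothesis leab : a <= b.
Variable H : R -> 'M[R]_n.
Hypothesis H_cont : cont_mx a b H.
Hypothesis H_sym : forall z, z \in `[a, b] -> (H z)^T = H z.
Hypothesis m_gt0 : 0 < m.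
Hypothesis H_ge : forall z, z \in `[a, b] -> m%:M ⪯ H z.
Local Notation N := (@energy_norm R k n a b H).
Local Notation form := (@L2form R k n a b).

Lemma re_inner f g : re_part (inner a b H f g) = 2^-1 * form H g f.
Proof.
rewrite /inner -[re_part _]/(part true _) part_real_mul; congr (_ * _).
rewrite -[RHS]/(\int[mu]_(z in `[a, b]) bilc (H z) (g z) (f z)).
under [RHS]eq_Rintegral do rewrite -re_adjoint.
by move: f g; rewrite /part; case: k.
Qed.

Lemma bilc_H_ge0 z v : z \in `[a, b] -> 0 <= @bilc R k n (H z) v v.
Proof.
move=> zab; apply: le_trans (loewner_le_bilc v (H_ge zab)).
by rewrite /bilc !bil_scalar addr_ge0// mulr_ge0 ?(ltW m_gt0)//;
   apply: sumr_ge0 => ? _; exact: sqr_ge0.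
Qed.

Lemma form_H_ge0 f : 0 <= form H f f.
Proof. by apply: Rintegral_ge0 => z zab; exact: bilc_H_ge0. Qed.

Lemma energy_norm_ge0 f : 0 <= N f.
Proof. exact: sqrtr_ge0. Qed.

Lemma energy_norm_sqr f : N f ^+ 2 = 2^-1 * form H f f.
Proof.
by rewrite sqr_sqrtr re_inner// mulr_ge0// ?invr_ge0//; exact: form_H_ge0.
Qed.

(** The weighted bound [r |f|^2 + r^-1 |g|^2] is integrated first and optimized
    over [r] afterwards, which gives the product of the norms. *)
Lemma L2form_norm_bounded W : cont_mx a b W -> exists2 C, 0 <= C &
  forall f g, L2 f -> L2 g -> `|form W f g| <= C * N f * N g.
Proof.
move=> hW; have [C C0 hC] := bilc_bounded k leab hW.
have D0 : 0 < (C + 1) * (2 / m) by rewrite mulr_gt0 ?divr_gt0//; lra.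
exists (2 * ((C + 1) * (2 / m))) => [|f g hf hg]; first by rewrite mulr_ge0// ltW.
suff : `|form W f g| / ((C + 1) * (2 / m)) <= 2 * N f * N g.
  by rewrite ler_pdivrMr// => h; apply: (le_trans h); rewrite le_eqVlt; apply/orP; left; apply/eqP; ring.
apply: amgm_opt; try exact: energy_norm_ge0.
move=> r r0; rewrite ler_pdivrMr//.
have one_le x : L2 x -> form (fun=> 1%:M) x x <= 2 / m * N x ^+ 2.
  move=> hx; rewrite energy_norm_sqr.
  have -> : 2 / m * (2^-1 * form H x x) = m^-1 * form H x x by field; rewrite gt_eqF.
  rewrite -ler_pdivrMl ?invr_gt0// invrK.
  rewrite -L2formZm//; last exact: cont_mx1.
  apply: L2form_le => //.
    by apply: cont_mxZ; [exact: cont_on_cst|exact: cont_mx1].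
  move=> z zab; apply: le_trans (loewner_le_bilc _ (H_ge zab)).
  by rewrite scale_scalar_mx mulr1.
apply: (@le_trans _ _ (C * (r * form (fun=> 1%:M) f f + r^-1 * form (fun=> 1%:M) g g))).
  apply: (le_trans (le_normr_Rintegral _ _)) => //; first exact: integrable_bilc.
  have I1 x : L2 x -> mu.-integrable `[a, b]
      (EFin \o (fun z => bilc 1%:M (x z) (x z))) by move=> /L2P[].
  have If := I1 _ hf; have Ig := I1 _ hg.
  rewrite /L2form -!RintegralZl// -RintegralD//; try exact: integrable_realZ.
  rewrite -RintegralZl//; last by apply: integrable_realD => //; exact: integrable_realZ.
  apply: le_Rintegral => //.
  - have := integrable_abse (integrable_bilc leab hW hf hg).
    exact: eq_integrable.
  - by apply: integrable_realZ => //; apply: integrable_realD => //; exact: integrable_realZ.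
  - by move=> z zab; exact: hC.
have := one_le _ hf; have := one_le _ hg => hg1 hf1.
have ri0 : 0 < r^-1 by rewrite invr_gt0.
apply: (@le_trans _ _ ((C + 1) * (r * (2 / m * N f ^+ 2) + r^-1 * (2 / m * N g ^+ 2)))).
  apply: ler_pM => //; last 2 first.
  - lra.
  - by apply: lerD; rewrite ler_pM2l.
  have I0 x : 0 <= form (fun=> 1%:M) x x by apply: Rintegral_ge0 => z _; exact: bilc1_ge0.
  by rewrite addr_ge0// mulr_ge0 ?(ltW r0) ?(ltW ri0)//.
by rewrite le_eqVlt; apply/orP; left; apply/eqP; ring.
Qed.

(** Cauchy-Schwarz for the inner product itself: expand
    [0 <= form H (r f - g) (r f - g)] and optimize over [r]. *)
Lemma form_H_le f g : L2 f -> L2 g -> form H f g <= 2 * N f * N g.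
Proof.
move=> hf hg; apply: amgm_opt; try exact: energy_norm_ge0.
move=> r r0; rewrite !energy_norm_sqr.
have hrf : L2 (of_real k r *: f) by exact: L2Z.
have hN : L2 (- g) by rewrite -[- g]add0r; apply: L2B => //; exact: L2_0.
have := form_H_ge0 (of_real k r *: f - g).
rewrite L2formDl//; last exact: L2B.
rewrite !L2formDr// !L2formNr// !L2formNl// !L2formZl// !L2formZr//.
rewrite (L2form_sym g f H_sym).
set F := form H f f; set G := form H g g; set X := form H f g => h.
have : 0 <= r^-1 * (r * (r * F) + - (r * X) + (- (r * X) - - G)).
  apply: mulr_ge0; first by rewrite invr_ge0 ltW.
  exact: h.
have -> : r^-1 * (r * (r * F) + - (r * X) + (- (r * X) - - G)) =
  r * F - 2 * X + r^-1 * G by field; rewrite gt_eqF.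
lra.
Qed.

Lemma energy_normD f g : L2 f -> L2 g -> N (f + g) <= N f + N g.
Proof.
move=> hf hg; have n0 := energy_norm_ge0.
rewrite -(@ler_pXn2r _ 2)// ?nnegrE ?addr_ge0//.
rewrite energy_norm_sqr sqrrD !energy_norm_sqr L2formDl//; last exact: L2D.
rewrite !L2formDr// (L2form_sym g f H_sym).
have := form_H_le hf hg; rewrite -mulr_natr; lra.
Qed.

Lemma energy_normZ r f : L2 f -> N (of_real k r *: f) = `|r| * N f.
Proof.
move=> hf; have n0 := energy_norm_ge0.
apply/eqP; rewrite -(@eqrXn2 _ 2)// ?mulr_ge0//.
rewrite exprMn !energy_norm_sqr L2formZl// ?L2formZr//; last exact: L2Z.
by rewrite real_normK ?num_real//; apply/eqP; ring.
Qed.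

Lemma energy_normN f : L2 f -> N (- f) = N f.
Proof.
move=> hf; rewrite -scaleN1r -(of_real1 R k) -of_realN energy_normZ//.
by rewrite normrN normr1 mul1r.
Qed.

Lemma energy_norm_distC f g : L2 f -> L2 g -> N (f - g) = N (g - f).
Proof. by move=> hf hg; rewrite -opprB energy_normN//; exact: L2B. Qed.

Lemma energy_norm0 : N 0 = 0.
Proof.
have h : L2 (0 : state) by exact: L2_0.
by have := energy_normZ 0 h; rewrite scaler0 normr0 mul0r.
Qed.

Lemma energy_norm_congr f g : L2 f -> L2 g -> f ~ g -> N f = N g.
Proof.
move=> hf hg fg; have n0 := energy_norm_ge0.
apply/eqP; rewrite -(@eqrXn2 _ 2)// !energy_norm_sqr.
by rewrite (L2form_congr H_cont hf hg hf hg fg fg).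
Qed.

Section bounded_operators.
Variable S : state -> state.
Hypothesis S_op : L2_operator a b S.

Lemma operator_L2 f : L2 f -> L2 (S f).
Proof. by have [h _ _] := S_op; exact: h. Qed.

Lemma operator_lin r f g : L2 f -> L2 g ->
  S (of_real k r *: f + g) ~ of_real k r *: S f + S g.
Proof. by have [_ _ h] := S_op; exact: h. Qed.

Lemma operator0 : S 0 ~ 0.
Proof.
have h0 : L2 (0 : state) by exact: L2_0.
have := operator_lin 1 h0 h0; rewrite scaler0 addr0 of_real1 scale1r.
apply: filterS => z e zab; have := e zab.
by move/eqP; rewrite -subr_eq0 opprD addNKr oppr_eq0 => /eqP.
Qed.

Lemma operatorZ r f : L2 f -> S (of_real k r *: f) ~ of_real k r *: S f.
Proof.
move=> hf; have := operator_lin r hf (L2_0 k n a b); rewrite addr0 => h.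
apply: (same_trans h); have := operator0; apply: filterS => z e zab.
by rewrite -[LHS]/(of_real k r *: S f z + S 0 z) e// addr0.
Qed.

Lemma operatorB f g : L2 f -> L2 g -> S (f - g) ~ S f - S g.
Proof.
move=> hf hg; have := operator_lin (-1) hg hf.
by rewrite of_realN of_real1 !scaleN1r addrC [X in _ ~ X]addrC.
Qed.

Lemma operator_normB f g : L2 f -> L2 g -> N (S f - S g) = N (S (f - g)).
Proof.
move=> hf hg; apply: energy_norm_congr.
- by apply: L2B => //; exact: operator_L2.
- by apply: operator_L2; exact: L2B.
- by apply: same_sym; exact: operatorB.
Qed.

(** [f] is scaled by [(N f + e)^-1] rather than by [(N f)^-1], to allow
    [N f = 0]. *)
Lemma op_norm_le_bound (c : R) f : 0 <= c -> (op_norm a b H S <= c%:E)%E ->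
  L2 f -> N (S f) <= c * N f.
Proof.
move=> c0 Sc hf; have n0 := energy_norm_ge0.
have step (e : R) : 0 < e -> N (S f) <= c * (N f + e).
  move=> e0; have d0 : 0 < N f + e by rewrite ltr_wpDl.
  have hr : L2 (of_real k (N f + e)^-1 *: f) by exact: L2Z.
  have : ((N (S (of_real k (N f + e)^-1 *: f)))%:E <= c%:E)%E.
    apply: le_trans Sc; apply: ereal_sup_ubound.
    exists (of_real k (N f + e)^-1 *: f) => //; split=> //.
    rewrite energy_normZ// ger0_norm ?invr_ge0 ?(ltW d0)// ler_pdivrMl// mulr1.
    by rewrite lerDl ltW.
  rewrite lee_fin (energy_norm_congr _ _ (operatorZ _ hf)); last 2 first.
  - exact: operator_L2.
  - by apply: L2Z => //; exact: operator_L2.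
  rewrite energy_normZ; last exact: operator_L2.
  by rewrite ger0_norm ?invr_ge0 ?(ltW d0)// ler_pdivrMl// mulrC.
apply/ler_addgt0Pr => e e0.
have c1 : 0 < c + 1 by lra.
apply: (le_trans (step _ (divr_gt0 e0 c1))); rewrite mulrDr lerD2l.
by rewrite mulrCA -[leRHS]mulr1 ler_wpM2l ?(ltW e0)// ler_pdivrMr// mul1r; lra.
Qed.

Lemma op_norm_le (c : R) : (forall f, L2 f -> N (S f) <= c * N f) -> 0 <= c ->
  (op_norm a b H S <= c%:E)%E.
Proof.
move=> hc c0; apply: ub_ereal_sup => _ [f [hf f1] <-].
rewrite lee_fin; apply: (le_trans (hc _ hf)).
by rewrite -[leRHS]mulr1 ler_wpM2l.
Qed.

End bounded_operators.

End energy_space.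

(** * Orbits of a contraction semigroup *)

Section orbits.
Variables (R : realType) (k : scalar_kind) (n : nat) (a b m : R).
Local Notation K := (scalars R k).
Local Notation state := (R -> 'cV[K]_n).
Local Notation L2 := (@L2 R k n a b).
Local Notation "f ~ g" := (same_state a b f g) (at level 70).
Implicit Types (f g x y : state) (e d r s t h : R).

Hypothesis leab : a <= b.
Variable H : R -> 'M[R]_n.
Hypothesis H_cont : cont_mx a b H.
Hypothesis H_sym : forall z, z \in `[a, b] -> (H z)^T = H z.
Hypothesis m_gt0 : 0 < m.
Hypothesis H_ge : forall z, z \in `[a, b] -> m%:M ⪯ H z.
Local Notation N := (@energy_norm R k n a b H).
Local Notation form := (@L2form R k n a b).

Variable T : R -> state -> state.
Hypothesis T_semigroup : contraction_semigroup k a b H T.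

Lemma orbit_op t : 0 <= t -> L2_operator a b (T t).
Proof. by have [h _ _ _] := T_semigroup => /h[]. Qed.

Lemma orbit_L2 t f : 0 <= t -> L2 f -> L2 (T t f).
Proof. by move=> t0; apply: operator_L2; exact: orbit_op. Qed.

Lemma orbit_contract t f : 0 <= t -> L2 f -> N (T t f) <= N f.
Proof.
move=> t0 hf; rewrite -[leRHS]mul1r.
apply: (op_norm_le_bound leab H_cont m_gt0 H_ge) => //; first exact: orbit_op.
by have [h _ _ _] := T_semigroup; have [] := h _ t0.
Qed.

Lemma orbit_add s t f : 0 <= s -> 0 <= t -> L2 f -> T (s + t) f ~ T s (T t f).
Proof. by have [_ _ h _] := T_semigroup; exact: h. Qed.

Lemma energy_norm_sub_congr f f' g g' : L2 f -> L2 f' -> L2 g -> L2 g' ->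
  f ~ f' -> g ~ g' -> N (f - g) = N (f' - g').
Proof.
move=> hf hf' hg hg' ff gg.
apply: (energy_norm_congr H_cont m_gt0 H_ge); try exact: L2B.
move: ff gg; apply: filterS2 => z e1 e2 zab.
by rewrite -[LHS]/(f z - g z) e1// e2.
Qed.

Lemma orbit_dist s t f g : 0 <= s -> 0 <= t -> L2 f -> L2 g ->
  N (T (s + t) f - T s g) <= N (T t f - g).
Proof.
move=> s0 t0 hf hg.
have hTf := orbit_L2 t0 hf.
rewrite (@energy_norm_sub_congr _ (T s (T t f)) _ (T s g)) //.
- rewrite (operator_normB leab H_cont m_gt0 H_ge (orbit_op s0))//.
  by apply: orbit_contract => //; exact: L2B.
- by apply: orbit_L2 => //; exact: addr_ge0.
- exact: orbit_L2.
- exact: orbit_L2.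
- exact: orbit_L2.
- exact: orbit_add.
- exact: same_refl.
Qed.

Lemma cvg_at_right0P (F : R -> R) : F t @[t --> 0^'+] --> 0 <->
  forall e, 0 < e -> exists2 d, 0 < d & forall t, 0 < t -> t < d -> `|F t| < e.
Proof.
split=> [h e e0|h].
  have := @cvgr_dist_lt _ _ _ _ (at_right_proper_filter _) _ _ h _ e0.
  rewrite near_withinE => /nbhs_ballP[d /= d0 hd]; exists d => // t t0 td.
  have := hd t; rewrite /ball /= sub0r normrN => /(_ _ t0).
  by rewrite sub0r normrN; apply; rewrite ger0_norm ?ltW.
apply/cvgrPdist_lt => e e0; have [d d0 hd] := h _ e0.
rewrite near_withinE; apply/nbhs_ballP; exists d => // t.
rewrite /ball /= sub0r normrN => td t0.
by rewrite sub0r normrN; apply: hd => //; apply: le_lt_trans td; exact: ler_norm.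
Qed.

(** Two-sided continuity from the right continuity at zero: contractivity
    transports the estimate at zero to any time, and for [s < t] the roles of
    [s] and [t] are exchanged. *)
Lemma orbit_continuous t f e : 0 <= t -> L2 f -> 0 < e ->
  exists2 d, 0 < d & forall s, 0 <= s -> `|s - t| < d -> N (T s f - T t f) < e.
Proof.
move=> t0 hf e0.
have [_ _ _ /(_ _ hf)/cvg_at_right0P/(_ _ e0)[d d0 hd]] := T_semigroup.
have pos h : 0 <= h -> h < d -> N (T h f - f) < e.
  rewrite le_eqVlt => /orP[/eqP <- _|h0 hlt].
    rewrite (@energy_norm_sub_congr _ f _ f)// ?subrr.
    - by rewrite (energy_norm0 k leab H_cont m_gt0 H_ge).
    - exact: orbit_L2.
    - by have [_ hT0 _ _] := T_semigroup; exact: hT0.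
    - exact: same_refl.
  by apply: le_lt_trans (hd _ h0 hlt); exact: ler_norm.
exists d => // s s0 st.
have [ts|st'] := leP t s.
  have h0 : 0 <= s - t by rewrite subr_ge0.
  rewrite -{1}(subrKC t s); apply: le_lt_trans (orbit_dist t0 h0 hf hf) _.
  by apply: pos => //; rewrite -(ger0_norm h0).
have h0 : 0 <= t - s by rewrite subr_ge0 ltW.
rewrite (energy_norm_distC leab H_cont m_gt0 H_ge); try exact: orbit_L2.
rewrite -{1}(subrKC s t); apply: le_lt_trans (orbit_dist s0 h0 hf hf) _.
by apply: pos => //; rewrite -(ger0_norm h0) distrC.
Qed.

Definition right_derivative x y :=
  N (of_real k t^-1 *: (T t x - x) - y) @[t --> 0^'+] --> 0.

Lemma difference_quotient_congr r x y x' y' f f' : L2 x -> L2 y -> L2 x' -> L2 y' ->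
  L2 f -> L2 f' -> x ~ x' -> y ~ y' -> f ~ f' ->
  N (of_real k r *: (x - y) - f) = N (of_real k r *: (x' - y') - f').
Proof.
move=> *; apply: energy_norm_sub_congr => //; try (by apply: L2Z => //; exact: L2B).
have : x - y ~ x' - y'.
  match goal with h1 : x ~ x', h2 : y ~ y' |- _ => move: h1 h2 end.
  apply: filterS2 => z e1 e2 zab; by rewrite -[LHS]/(x z - y z) e1// e2.
apply: filterS => z e zab.
by rewrite -[LHS]/(of_real k r *: ((x - y) z)) e.
Qed.

Lemma orbit_quotient s r x y t : 0 <= s -> 0 <= t -> L2 x -> L2 y ->
  N (of_real k r *: (T (s + t) x - T s x) - T s y) <=
  N (of_real k r *: (T t x - x) - y).
Proof.
move=> s0 t0 hx hy; have hTx := orbit_L2 t0 hx.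
have hop := orbit_op s0.
have hdx : L2 (T t x - x) by exact: L2B.
have -> : N (of_real k r *: (T (s + t) x - T s x) - T s y) =
    N (T s (of_real k r *: (T t x - x)) - T s y).
  apply: energy_norm_sub_congr; try exact: orbit_L2.
  - by apply: L2Z => //; apply: L2B => //; apply: orbit_L2 => //; exact: addr_ge0.
  - by apply: orbit_L2 => //; exact: L2Z.
  - apply: same_sym; apply: (same_trans (operatorZ hop r hdx)).
    have := operatorB hop hTx hx; have := orbit_add s0 t0 hx.
    apply: filterS2 => z e1 e2 zab.
    by rewrite -[LHS]/(of_real k r *: (T s (T t x - x) z)) e2// -[(T s _ - _) z]/(T s (T t x) z - T s x z) -e1.
  - exact: same_refl.
rewrite (operator_normB leab H_cont m_gt0 H_ge hop)//; last exact: L2Z.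
by apply: orbit_contract => //; apply: L2B => //; exact: L2Z.
Qed.

Lemma orbit_right_derivative x y s : 0 <= s -> L2 x -> L2 y ->
  right_derivative x y -> right_derivative (T s x) (T s y).
Proof.
move=> s0 hx hy /cvg_at_right0P h; apply/cvg_at_right0P => e e0.
have [d d0 hd] := h _ e0; exists d => // t t0 td.
rewrite ger0_norm ?(energy_norm_ge0)//.
apply: le_lt_trans (le_lt_trans (ler_norm _) (hd _ t0 td)).
apply: le_trans (orbit_quotient t^-1 s0 (ltW t0) hx hy).
have t0' := ltW t0.
rewrite le_eqVlt; apply/orP; left; apply/eqP.
have hsx := orbit_L2 s0 hx; have hsy := orbit_L2 s0 hy.
apply: difference_quotient_congr => //; try exact: same_refl.
- exact: orbit_L2.
- by apply: orbit_L2 => //; exact: addr_ge0.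
- by rewrite addrC; apply: same_sym; exact: orbit_add.
Qed.

(** The left difference quotient at [t] is the right one at [t + h], [h < 0]. It
    is close to [T (t + h) y] uniformly in [t + h], by contractivity, and
    [T (t + h) y] is close to [T t y]. *)
Lemma orbit_derivative x y t e : 0 < t -> L2 x -> L2 y ->
  right_derivative x y -> 0 < e ->
  exists2 d, 0 < d & forall h, h != 0 -> `|h| < d -> 0 <= t + h /\
    N (of_real k h^-1 *: (T (t + h) x - T t x) - T t y) < e.
Proof.
move=> t0 hx hy /cvg_at_right0P hxy e0.
have e20 : 0 < e / 2 by rewrite divr_gt0.
have [d1 d10 hd1] := hxy _ e20.
have [d2 d20 hd2] := orbit_continuous (ltW t0) hy e20.
exists (Num.min t (Num.min d1 d2)) => [|h h0]; first by rewrite !lt_min t0 d10.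
rewrite !lt_min => /and3P[ht h1 h2].
have th : 0 <= t + h.
  by have := ler_norm (- h); rewrite normrN; lra.
split=> //; have [hpos|hneg] := ltP 0 h.
  apply: le_lt_trans (orbit_quotient h^-1 (ltW t0) (ltW hpos) hx hy) _.
  have hh : h < d1 by apply: le_lt_trans h1; exact: ler_norm.
  by have := le_lt_trans (ler_norm _) (hd1 _ hpos hh); lra.
have hneg' : 0 < - h by rewrite oppr_gt0 lt_neqAle h0.
have hh : - h < d1 by rewrite -(ltr0_norm (_ : h < 0))// -oppr_gt0.
have L2s f : L2 f -> L2 (T (t + h) f) by exact: orbit_L2.
have L2t f : L2 f -> L2 (T t f) by apply: orbit_L2; exact: ltW.
have -> : of_real k h^-1 *: (T (t + h) x - T t x) - T t y =
    (of_real k (- h)^-1 *: (T (t + h + - h) x - T (t + h) x) - T (t + h) y) +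
    (T (t + h) y - T t y).
  rewrite addrA subrK addrK invrN of_realN scaleNr -scalerN opprB//.
apply: le_lt_trans (energy_normD leab H_cont H_sym m_gt0 H_ge _ _) _.
- by apply: L2B; [exact: leab|apply: L2Z => //; apply: L2B => //; rewrite ?addrK|]; auto.
- by apply: L2B => //; auto.
have q := orbit_quotient (- h)^-1 th (ltW hneg') hx hy.
have := le_lt_trans (ler_norm _) (hd1 _ hneg' hh).
have := hd2 _ th; rewrite [t + h - t]addrAC subrr add0r => /(_ h2).
lra.
Qed.

Lemma orbit_form_continuous W f g t : cont_mx a b W -> 0 < t -> L2 f -> L2 g ->
  {for t, continuous (fun s => form W (T s f) (T s g))}.
Proof.
move=> hW t0 hf hg; have n0 := @energy_norm_ge0 R k n a b H.
have [C C0 hC] := L2form_norm_bounded k leab H_cont m_gt0 H_ge hW.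
apply/(@cvgrPdist_lt _ _ _ (nbhs t) (nbhs_filter t)) => e e0.
have c0 : 0 < C * (N f + N g) + 1 by rewrite ltr_wpDl// mulr_ge0// addr_ge0.
have [d1 d10 h1] := orbit_continuous (ltW t0) hf (divr_gt0 e0 c0).
have [d2 d20 h2] := orbit_continuous (ltW t0) hg (divr_gt0 e0 c0).
have d0 : 0 < Num.min t (Num.min d1 d2) by rewrite !lt_min t0 d10.
near=> s.
have : `|s - t| < Num.min t (Num.min d1 d2).
  rewrite distrC; near: s.
  exact: (@cvgr_dist_lt _ _ _ (nbhs t) (nbhs_filter t) id t (@cvg_id _ _) _ d0).
rewrite !lt_min => /and3P[st s1 s2].
have s0 : 0 <= s by have := ler_norm (t - s); rewrite distrC; lra.
have {}h1 := h1 _ s0 s1; have {}h2 := h2 _ s0 s2.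
have Lt x : L2 x -> L2 (T t x) by apply: orbit_L2; exact: ltW.
have Ls x : L2 x -> L2 (T s x) by exact: orbit_L2.
have hdf : L2 (T s f - T t f) by apply: L2B => //; auto.
have hdg : L2 (T s g - T t g) by apply: L2B => //; auto.
have -> : form W (T t f) (T t g) - form W (T s f) (T s g) =
   - (form W (T s f - T t f) (T s g) + form W (T t f) (T s g - T t g)).
  have E1 : form W (T s f) (T s g) = form W (T s f - T t f) (T s g) + form W (T t f) (T s g).
    by rewrite -L2formDl ?subrK//; auto.
  have E2 : form W (T t f) (T s g) = form W (T t f) (T s g - T t g) + form W (T t f) (T t g).
    by rewrite -L2formDr ?subrK//; auto.
  by rewrite E1 E2; ring.
rewrite normrN; apply: (le_lt_trans (ler_normD _ _)).
have := hC _ _ hdf (Ls _ hg); have := hC _ _ (Lt _ hf) hdg.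
have b1 : C * N (T s f - T t f) * N (T s g) <= C * (e / (C * (N f + N g) + 1)) * N g.
  apply: ler_pM => //; first by rewrite mulr_ge0.
    by rewrite ler_wpM2l// ltW.
  exact: orbit_contract.
have b2 : C * N (T t f) * N (T s g - T t g) <= C * N f * (e / (C * (N f + N g) + 1)).
  apply: ler_pM => //; first by rewrite mulr_ge0.
    by rewrite ler_wpM2l//; apply: orbit_contract => //; exact: ltW.
  exact: ltW.
have : C * (e / (C * (N f + N g) + 1)) * N g + C * N f * (e / (C * (N f + N g) + 1)) < e.
  have -> : C * (e / (C * (N f + N g) + 1)) * N g + C * N f * (e / (C * (N f + N g) + 1)) =
     e * (C * (N f + N g) / (C * (N f + N g) + 1)) by ring.
  by rewrite -[ltRHS]mulr1 ltr_pM2l// ltr_pdivrMr// mul1r ltrDl.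
lra.
Unshelve. all: by end_near.
Qed.

(** By symmetry of [W], the difference of [form W] at two states [X'] and [X] is
    [form W (X' - X) (X' + X)]. *)
Lemma orbit_form_derive W x y t : cont_mx a b W ->
  (forall z, z \in `[a, b] -> (W z)^T = W z) -> 0 < t -> L2 x -> L2 y ->
  right_derivative x y ->
  is_derive (t : R) (1 : R) (fun s : R => form W (T s x) (T s x)) (2 * form W (T t x) (T t y)).
Proof.
move=> hW W_sym t0 hx hy hxy; have n0 := @energy_norm_ge0 R k n a b H.
have [C C0 hC] := L2form_norm_bounded k leab H_cont m_gt0 H_ge hW.
suff hlim : h^-1 *: (form W (T (h *: (1 : R) + t) x) (T (h *: (1 : R) + t) x) -
      form W (T t x) (T t x)) @[h --> 0^'] --> 2 * form W (T t x) (T t y).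
  by split; [apply/cvg_ex; eexists; exact: hlim | exact: cvg_lim hlim].
apply/cvgrPdist_lt => e e0.
have c0 : 0 < C * (2 * N x + N y) + 1.
  by rewrite ltr_wpDl// mulr_ge0// addr_ge0// mulr_ge0.
have [d1 d10 h1] := orbit_derivative t0 hx hy hxy (divr_gt0 e0 c0).
have [d2 d20 h2] := orbit_continuous (ltW t0) hx (divr_gt0 e0 c0).
have d0 : 0 < Num.min d1 d2 by rewrite !lt_min d10.
near=> h.
have hn0 : h != 0 by near: h; exact: nbhs_dnbhs_neq.
have : `|h| < Num.min d1 d2.
  by near: h; apply: dnbhs0_lt.
rewrite lt_min => /andP[hd1 hd2].
have [th q] := h1 _ hn0 hd1.
have {}h2 := h2 _ th; rewrite [t + h - t]addrAC subrr add0r in h2.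
have {}h2 := h2 hd2.
rewrite /GRing.scale /= mulr1 [h + t]addrC.
have Lt f : L2 f -> L2 (T t f) by apply: orbit_L2; exact: ltW.
have Ls f : L2 f -> L2 (T (t + h) f) by exact: orbit_L2.
have LX := Lt _ hx; have LX' := Ls _ hx; have LY := Lt _ hy.
have LD : L2 (T (t + h) x - T t x) by exact: L2B.
have LQ : L2 (of_real k h^-1 *: (T (t + h) x - T t x) - T t y).
  by apply: L2B => //; exact: L2Z.
have LSum : L2 (T (t + h) x + T t x) by exact: L2D.
set X := T t x in LX LD LQ LSum h2 q *; set X' := T (t + h) x in LX' LD LQ LSum h2 q *.
set Y := T t y in LY LQ q *.
have E1 : form W (of_real k h^-1 *: (X' - X) - Y) (X' + X) =
    h^-1 * (form W X' X' - form W X X) - form W Y (X' + X).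
  rewrite L2formDl//; last 2 first.
  - exact: L2Z.
  - by rewrite -[- Y]add0r; apply: L2B => //; exact: L2_0.
  rewrite L2formZl// L2formNl// L2formDl//; last first.
    by rewrite -[- X]add0r; apply: L2B => //; exact: L2_0.
  by rewrite L2formNl// !L2formDr// (L2form_sym X' X W_sym); ring.
have E2 : form W Y (X' + X) = form W Y (X' - X) + 2 * form W X Y.
  rewrite !L2formDr//; last first.
    by rewrite -[- X]add0r; apply: L2B => //; exact: L2_0.
  by rewrite L2formNr// (L2form_sym Y X W_sym); ring.
have -> : 2 * form W X Y - h^-1 * (form W X' X' - form W X X) =
   - (form W (of_real k h^-1 *: (X' - X) - Y) (X' + X) + form W Y (X' - X)).
  by rewrite E1 E2; ring.
rewrite normrN; apply: (le_lt_trans (ler_normD _ _)).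
have := hC _ _ LQ LSum; have := hC _ _ LY LD.
have Xle : N (X' + X) <= 2 * N x.
  apply: (le_trans (energy_normD leab H_cont H_sym m_gt0 H_ge LX' LX)).
  have := orbit_contract th hx; have := orbit_contract (ltW t0) hx.
  rewrite -/X -/X'; lra.
set A := N (of_real k h^-1 *: (X' - X) - Y) in q *.
have b1 : C * A * N (X' + X) <= C * (e / (C * (2 * N x + N y) + 1)) * (2 * N x).
  apply: ler_pM => //; first by rewrite mulr_ge0 // /A.
  by rewrite ler_wpM2l// ltW.
have b2 : C * N Y * N (X' - X) <= C * N y * (e / (C * (2 * N x + N y) + 1)).
  apply: ler_pM => //; first by rewrite mulr_ge0.
    by rewrite ler_wpM2l//; apply: orbit_contract => //; exact: ltW.
  exact: ltW.
have : C * (e / (C * (2 * N x + N y) + 1)) * (2 * N x) +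
    C * N y * (e / (C * (2 * N x + N y) + 1)) < e.
  have -> : C * (e / (C * (2 * N x + N y) + 1)) * (2 * N x) +
    C * N y * (e / (C * (2 * N x + N y) + 1)) =
     e * (C * (2 * N x + N y) / (C * (2 * N x + N y) + 1)) by ring.
  by rewrite -[ltRHS]mulr1 ltr_pM2l// ltr_pdivrMr// mul1r ltrDl.
lra.
Unshelve. all: by end_near.
Qed.

End orbits.

(** * Weights *)

Lemma Rintegral_itv_cst (R : realType) (s t c : R) : s < t ->
  \int[@lebesgue_measure R]_(z in `[s, t]) c = c * (t - s).
Proof.
move=> st; have [_ h] := C1_on_primitive (C1_onZ c (C1_on_id s t)).
have := h t; rewrite in_itv /= lexx (ltW st) mulr1 => /(_ isT) /eqP.
by rewrite addrC -subr_eq -mulrBr => /eqP.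
Qed.

Section weights.
Variables (R : realType) (a b : R).
Local Notation mu := (@lebesgue_measure R).
Hypothesis ltab : a < b.

Lemma C1_on_continuous (F f : R -> R) :
  (forall z : R, z \in `[a, b] -> is_derive z 1 F (f z)) ->
  (forall z : R, z \in `[a, b] -> {for z, continuous f}) -> C1_on a b F f.
Proof.
move=> dF cf; split.
- apply: derivable_within_continuous => z zab.
  exact: (@ex_derive _ _ _ _ _ _ _ (dF _ zab)).
- by apply: continuous_in_subspaceT => z; rewrite mem_setE; exact: cf.
- move=> z zab; apply: dF; move: zab; rewrite !in_itv /=.
  by move=> /andP[/ltW-> /ltW->].
Qed.

Lemma C1_on_exp (p q : R) :
  C1_on a b (fun z => expR (p * (z - q))) (fun z => p * expR (p * (z - q))).
Proof.
have d (z : R) : is_derive z 1 (fun z => expR (p * (z - q))) (p * expR (p * (z - q))).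
  have h : is_derive z 1 (fun z : R => p * (z - q)) p.
    have h1 := is_deriveZ p (is_deriveB (is_derive_id z (1 : R)) (is_derive_cst q z (1 : R))).
    by apply: is_derive_eq h1 _; rewrite subr0 /GRing.scale /= mulr1.
  have h2 := @is_derive1_comp _ expR (fun z : R => p * (z - q)) z _ _
    (is_derive_expR (p * (z - q))) h.
  by rewrite mulrC; exact: h2.
apply: C1_on_continuous => z _.
have /derivable1_diffP/differentiable_continuous h := @ex_derive _ _ _ _ _ _ _ (d z).
by apply: cvgM; [exact: cvg_cst|exact: h].
Qed.

Lemma primitive_on_increment (F f g : R -> R) : primitive_on a b F f ->
  mu.-integrable `[a, b] (EFin \o g) ->
  (forall z, z \in `[a, b] -> f z <= g z) ->
  F b - F a <= \int[mu]_(z in `[a, b]) g z.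
Proof.
move=> [If hF] Ig fg; rewrite (hF b) ?in_itv /= ?lexx ?(ltW ltab)//.
by rewrite addrC addKr; apply: le_Rintegral.
Qed.

(** A smooth substitute for [exp (- nu |t - q|)]. *)
Definition sech_weight (nu q t : R) : R :=
  (expR (nu * (t - q)) + expR (- nu * (t - q)))^-1.

Lemma sech_weight_gt0 nu q t : 0 < sech_weight nu q t.
Proof. by rewrite invr_gt0 addr_gt0// expR_gt0. Qed.

(** The bound on the derivative is the reason for this shape: no smoothing
    error, just the rate [nu], as for [exp (- nu |t - q|)] itself. *)
Lemma sech_weight_C1 nu q : 0 <= nu -> exists2 dw, C1_on a b (sech_weight nu q) dw &
  forall t, `|dw t| <= nu * sech_weight nu q t.
Proof.
move=> nu0; have hV := C1_onV (C1_onD (C1_on_exp nu q) (C1_on_exp (- nu) q)).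
eexists; first by apply: hV => z _; rewrite gt_eqF// addr_gt0// expR_gt0.
move=> t /=; rewrite /sech_weight.
have e1 := expR_gt0 (nu * (t - q)); have e2 := expR_gt0 (- nu * (t - q)).
set x := expR (nu * (t - q)) in e1 *; set y := expR (- nu * (t - q)) in e2 *.
have xy : 0 < x + y by rewrite addr_gt0.
have -> : - (x + y)^-1 * (x + y)^-1 * (nu * x + - nu * y) =
  nu * (x + y)^-1 * ((y - x) / (x + y)) by field; rewrite gt_eqF.
rewrite normrM ger0_norm ?mulr_ge0// ?invr_ge0 ?(ltW xy)//.
rewrite -[leRHS]mulr1 ler_wpM2l ?mulr_ge0 ?invr_ge0 ?(ltW xy)//.
rewrite normrM [`|(x + y)^-1|]ger0_norm ?invr_ge0 ?(ltW xy)// ler_pdivrMr// mul1r.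
by rewrite ler_norml; apply/andP; split; lra.
Qed.

Lemma sech_weight_le nu q t : 0 <= nu -> sech_weight nu q t <= expR (- nu * `|t - q|).
Proof.
move=> nu0; rewrite mulNr expRN lef_pV2 ?posrE ?addr_gt0 ?expR_gt0//.
have [h|h] := leP 0 (t - q).
  by rewrite ger0_norm// lerDl ltW// expR_gt0.
by rewrite ltr0_norm// mulrN -mulNr lerDr ltW// expR_gt0.
Qed.

Lemma sech_weight_ge nu q t : 0 <= nu ->
  2^-1 * expR (- nu * `|t - q|) <= sech_weight nu q t.
Proof.
move=> nu0; rewrite mulNr expRN -invfM lef_pV2 ?posrE ?addr_gt0 ?mulr_gt0 ?expR_gt0//.
have h1 : expR (nu * (t - q)) <= expR (nu * `|t - q|).
  by rewrite ler_expR ler_wpM2l// ler_norm.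
have h2 : expR (- nu * (t - q)) <= expR (nu * `|t - q|).
  by rewrite ler_expR mulNr -mulrN ler_wpM2l// -normrN ler_norm.
lra.
Qed.

Lemma sech_weight_le1 nu q t : 0 <= nu -> sech_weight nu q t <= 1.
Proof.
move=> nu0; apply: (le_trans (sech_weight_le q t nu0)).
by rewrite -expR0 ler_expR mulNr oppr_le0 mulr_ge0.
Qed.

End weights.

(** * Energy estimates along trajectories *)

Section trajectories.
Variables (R : realType) (k : scalar_kind) (n : nat) (a b m : R).
Local Notation K := (scalars R k).
Local Notation mu := (@lebesgue_measure R).
Local Notation state := (R -> 'cV[K]_n).
Local Notation L2 := (@L2 R k n a b).
Local Notation "f ~ g" := (same_state a b f g) (at level 70).
Implicit Types (f g x y : state) (e d r s t h : R).

Hypothesis ltab : a < b.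
Let leab := ltW ltab.
Variables (P1 P0 : 'M[R]_n) (H dH : R -> 'M[R]_n) (WB : 'M[R]_(n, n + n)).
Hypothesis H_C1 : forall i j, C1_on a b (fun z => H z i j) (fun z => dH z i j).
Hypothesis H_sym : forall z, z \in `[a, b] -> (H z)^T = H z.
Hypothesis m_gt0 : 0 < m.
Hypothesis H_ge : forall z, z \in `[a, b] -> m%:M ⪯ H z.
Hypothesis P1_sym : P1^T = P1.
Hypothesis P1_unit : P1 \in unitmx.
Local Notation N := (@energy_norm R k n a b H).
Local Notation form := (@L2form R k n a b).

Variable T : R -> state -> state.
Hypothesis T_semigroup : contraction_semigroup k a b H T.
Hypothesis T_generated : generated_by a b H (pH_operator k a b P1 P0 H WB) T.
Local Notation A := (pH_operator k a b P1 P0 H WB).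

Let H_cont : cont_mx a b H.
Proof. exact: cont_mxH H_C1. Qed.

Lemma L2_mulmx W f : cont_mx a b W -> L2 f ->
  L2 (fun z => of_real_mx k (W z) *m f z).
Proof.
move=> hW hf; have /L2P[mf _] := hf; apply/L2P; split=> [c i|].
  have -> : (fun z => part c ((of_real_mx k (W z) *m f z) i 0)) =
      (fun z => \sum_j W z i j * part c (f z j 0)).
    apply/funext => z; have := congr1 (fun v : 'cV[R]_n => v i 0) (vpart_mul c (W z) (f z)).
    rewrite mxE [(W z *m _) i 0]mxE => ->.
    by apply: eq_bigr => j _; rewrite mxE.
  apply: measurable_sum => j; apply: measurable_funM => //.
  exact: cont_on_measurable.
have -> : (fun z => bilc 1%:M (of_real_mx k (W z) *m f z) (of_real_mx k (W z) *m f z)) =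
    (fun z => bilc ((W z)^T *m W z) (f z) (f z)).
  apply/funext => z; rewrite /bilc !vpart_mul.
  by rewrite !bil_mull !bil_mulr !mulmx1.
apply: integrable_bilc => //; apply: cont_mxM => // i j.
by under [X in cont_on _ _ X]eq_fun do rewrite mxE; exact: hW.
Qed.

Lemma pH_domain_operator x : pH_domain k a b P1 H WB x -> exists2 y, L2 y & A x y.
Proof.
move=> dx; have [L2x [L2Hx [g wg]] _] := dx; have [L2g _] := wg.
exists ((fun z => of_real_mx k P1 *m g z) + (fun z => of_real_mx k P0 *m mulH H x z)).
  apply: L2D => //; apply: (@L2_mulmx (fun=> _)) => //; exact: cont_mx_cst.
by split=> //; exists g; split=> //; exact: same_refl.
Qed.

Lemma pH_operator_orbit x y t : 0 <= t -> L2 y -> A x y -> A (T t x) (T t y).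
Proof.
move=> t0 L2y Axy; have [L2x _ _] := Axy.1.
apply/(T_generated (orbit_L2 T_semigroup t0 L2x) (orbit_L2 T_semigroup t0 L2y)).
apply: (orbit_right_derivative leab H_cont m_gt0 H_ge T_semigroup) => //.
exact/(T_generated L2x L2y).
Qed.

Lemma energy_at_ge0 f z : z \in `[a, b] -> 0 <= energy_at a b H f z.
Proof.
by move=> zab; rewrite /energy_at re_adjoint; exact: (bilc_H_ge0 m_gt0 H_ge).
Qed.

Lemma C1_on_shift (c : R) : C1_on a b (fun z => z + - c) (fun=> 1).
Proof.
have := C1_onD (C1_on_id a b) (C1_on_cst a b (- c)).
by rewrite (_ : (fun=> 1 + 0) = (fun=> 1 : R)) //; apply/funext => ?; rewrite addr0.
Qed.

Let invP1_sym : (invmx P1)^T = invmx P1.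
Proof. by rewrite trmx_inv P1_sym. Qed.

Lemma weighted_P1_cont (beta : R -> R) : cont_on a b beta ->
  cont_mx a b (fun z => beta z *: invmx P1).
Proof. by move=> hb; apply: cont_mxZ => //; exact: cont_mx_cst. Qed.

Lemma weighted_P1_sym (beta : R -> R) z : (beta z *: invmx P1)^T = beta z *: invmx P1.
Proof. by rewrite linearZ /= invP1_sym. Qed.

(** An end [c] of the segment, the opposite end [c'], and the sign [s] with
    which the boundary term at [c] enters when integrating over the segment. *)
Definition endpoint (c c' s : R) :=
  [/\ c = b, c' = a & s = 1] \/ [/\ c = a, c' = b & s = -1].

Lemma endpoint_in c c' s : endpoint c c' s -> c \in `[a, b].
Proof. by case=> -[-> _ _]; rewrite in_itv /= lexx leab. Qed.

Section one_trajectory.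
Variables x y : state.
Hypotheses (L2y : L2 y) (Axy : A x y).
Let L2x : L2 x. Proof. by have [] := Axy.1. Qed.
Local Notation X t := (T t x).
Local Notation Y t := (T t y).
Local Notation N_ := (lower_order P1 P0 H dH).

Lemma orbit_energy_identity beta dbeta t : C1_on a b beta dbeta -> 0 <= t ->
  beta b * energy_at a b H (X t) b - beta a * energy_at a b H (X t) a =
  form (fun z => dbeta z *: H z) (X t) (X t) +
  2 * form (fun z => beta z *: invmx P1) (X t) (Y t) -
  form (fun z => beta z *: N_ z) (X t) (X t).
Proof.
move=> hbeta t0.
apply: (energy_identity ltab H_C1 H_sym m_gt0 H_ge P1_unit hbeta).
- exact: (orbit_L2 T_semigroup).
- exact: (orbit_L2 T_semigroup).
- exact: (pH_operator_orbit t0 L2y Axy).2.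
Qed.

Lemma orbit_energy_nonincreasing s t : 0 <= s -> s <= t -> N (X t) <= N (X s).
Proof.
move=> s0 st; have ts : 0 <= t - s by rewrite subr_ge0.
have L2s := orbit_L2 T_semigroup s0 L2x.
have := orbit_add T_semigroup ts s0 L2x; rewrite subrK => e.
rewrite (energy_norm_congr H_cont m_gt0 H_ge _ _ e).
- exact: (orbit_contract leab H_cont m_gt0 H_ge T_semigroup).
- by apply: (orbit_L2 T_semigroup) => //; exact: le_trans st.
- exact: (orbit_L2 T_semigroup).
Qed.

Lemma orbit_form_cont W f g s t : 0 < s -> cont_mx a b W -> L2 f -> L2 g ->
  cont_on s t (fun r => form W (T r f) (T r g)).
Proof.
move=> s0 hW hf hg; apply: continuous_in_subspaceT => r.
rewrite mem_setE in_itv /= => /andP[sr _].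
apply: (orbit_form_continuous leab H_cont m_gt0 H_ge T_semigroup) => //.
exact: lt_le_trans sr.
Qed.

Lemma orbit_form_C1 W s t : 0 < s -> cont_mx a b W ->
  (forall z, z \in `[a, b] -> (W z)^T = W z) ->
  C1_on s t (fun r => form W (X r) (X r)) (fun r => 2 * form W (X r) (Y r)).
Proof.
move=> s0 hW W_sym; split.
- exact: orbit_form_cont.
- by apply: cont_onM; [exact: cont_on_cst|exact: orbit_form_cont].
- move=> r; rewrite in_itv /= => /andP[sr _].
  apply: (orbit_form_derive leab H_cont H_sym m_gt0 H_ge T_semigroup) => //.
    exact: lt_trans sr.
  exact/(T_generated L2x L2y).
Qed.

(** The energy identity for the weight [z - c'], of slope one and vanishing at
    the opposite end: only the observed end contributes. *)
Lemma orbit_observation c c' s t : endpoint c c' s -> 0 <= t ->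
  (b - a) * energy_at a b H (X t) c =
  form (fun z => 1 *: H z) (X t) (X t) +
  2 * form (fun z => (z + - c') *: invmx P1) (X t) (Y t) -
  form (fun z => (z + - c') *: N_ z) (X t) (X t).
Proof.
by move=> cs t0; rewrite -(orbit_energy_identity (C1_on_shift c') t0);
   case: cs => -[-> -> _]; rewrite subrr; ring.
Qed.

(** The right-hand side of the previous identity is continuous in time, hence so
    is the point value at the end. *)
Lemma orbit_observation_cont c c' s r t : endpoint c c' s -> 0 < r ->
  cont_on r t (fun u => energy_at a b H (X u) c).
Proof.
move=> cs r0; have ab0 : 0 < b - a by rewrite subr_gt0.
have [cb _ _] := C1_on_shift c'.
have c1 : cont_on r t (fun u => (b - a)^-1 *
   (form (fun z => 1 *: H z) (X u) (X u) +
    2 * form (fun z => (z + - c') *: invmx P1) (X u) (Y u) +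
    -1 * form (fun z => (z + - c') *: N_ z) (X u) (X u))).
  have cc p : cont_on r t (fun=> p : R) by exact: cont_on_cst.
  apply: cont_onM => //; apply: cont_onD; first apply: cont_onD.
  - by apply: orbit_form_cont => //; apply: cont_mxZ => //; exact: cont_on_cst.
  - by apply: cont_onM => //; apply: orbit_form_cont => //; exact: weighted_P1_cont.
  - apply: cont_onM => //; apply: orbit_form_cont => //.
    by apply: cont_mxZ => //; exact: cont_mx_lower_order.
apply: (subspace_eq_continuous _ c1) => u; rewrite mem_setE in_itv /= => /andP[ru _].
have u0 : 0 <= u by rewrite (le_trans (ltW r0)).
apply: (@mulfI _ (b - a)); first by rewrite gt_eqF.
by rewrite /from_subspace /= (orbit_observation cs u0) mulrA mulfV ?gt_eqF// mul1r mulN1r.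
Qed.

End one_trajectory.

(** Integrate [orbit_observation] over time: the term with [y] is the derivative
    of [form ((z - c') P1^-1) x x], so it integrates to boundary values in time,
    and all that remains is bounded by the energy. *)
Lemma observation_admissible c c' s0 s t : endpoint c c' s0 -> 0 < s -> s < t ->
  exists2 C, 0 <= C & forall x, pH_domain k a b P1 H WB x ->
    \int[mu]_(r in `[s, t]) energy_at a b H (T r x) c <= C * N x ^+ 2.
Proof.
move=> cs spos st; have ab0 : 0 < b - a by rewrite subr_gt0.
have [cb _ _] := C1_on_shift c'.
have cW1 : cont_mx a b (fun z => 1 *: H z) by apply: cont_mxZ => //; exact: cont_on_cst.
have cW2 := weighted_P1_cont cb.
have cW3 : cont_mx a b (fun z => (z + - c') *: lower_order P1 P0 H dH z).
  by apply: cont_mxZ => //; exact: cont_mx_lower_order.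
have [C1 C10 h1] := L2form_norm_bounded k leab H_cont m_gt0 H_ge cW1.
have [C2 C20 h2] := L2form_norm_bounded k leab H_cont m_gt0 H_ge cW2.
have [C3 C30 h3] := L2form_norm_bounded k leab H_cont m_gt0 H_ge cW3.
exists ((b - a)^-1 * (2 * C2 + (C1 + C3) * (t - s))) => [|x dx].
  have ts : 0 <= t - s by rewrite subr_ge0 ltW.
  by rewrite mulr_ge0 ?invr_ge0 ?(ltW ab0)// addr_ge0 ?mulr_ge0// ?addr_ge0.
have [y L2y Axy] := pH_domain_operator dx; have [L2x _ _] := dx.
have n0 := @energy_norm_ge0 R k n a b H.
have bnd W C r : 0 <= C -> (forall f g, L2 f -> L2 g -> `|form W f g| <= C * N f * N g) ->
    0 <= r -> `|form W (T r x) (T r x)| <= C * N x ^+ 2.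
  move=> C0 hC r0; have Lr := orbit_L2 T_semigroup r0 L2x.
  apply: (le_trans (hC _ _ Lr Lr)); rewrite expr2 mulrA.
  have := orbit_contract leab H_cont m_gt0 H_ge T_semigroup r0 L2x => le.
  by apply: ler_pM => //; rewrite ?mulr_ge0// ler_wpM2l.
have hQ := orbit_form_C1 L2y Axy t spos cW2
  (fun z _ => weighted_P1_sym (fun z => z + - c') z).
have [IQ' hQ'] := C1_on_primitive hQ.
have cE : cont_on s t (fun r => energy_at a b H (T r x) c).
  exact: (orbit_observation_cont L2y Axy cs spos).
rewrite -mulrA ler_pdivlMl//.
rewrite -RintegralZl//; last exact: cont_on_integrable.
set Q := fun r => form _ (T r x) (T r x) in hQ hQ'.
set Q' := fun r => 2 * form _ (T r x) (T r y) in hQ hQ' IQ'.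
have Iu : mu.-integrable `[s, t] (EFin \o (fun r => Q' r + (C1 + C3) * N x ^+ 2)).
  by apply: integrable_realD => //; apply: cont_on_integrable; exact: cont_on_cst.
apply: (@le_trans _ _ (\int[mu]_(r in `[s, t]) (Q' r + (C1 + C3) * N x ^+ 2))).
  apply: le_Rintegral => //.
    by apply: integrable_realZ => //; exact: cont_on_integrable.
  move=> r; rewrite /= in_itv /= => /andP[sr _].
  have r0 : 0 <= r by rewrite (le_trans (ltW spos)).
  rewrite (orbit_observation L2y Axy cs r0) -/(Q' r).
  have := bnd _ _ _ C10 h1 r0; have := bnd _ _ _ C30 h3 r0.
  set u := form _ _ _; set v := form _ _ _ => hu hv.
  have := ler_norm v; have := ler_norm (- u); rewrite normrN; lra.
have Icst : mu.-integrable `[s, t] (EFin \o (fun=> (C1 + C3) * N x ^+ 2)).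
  by apply: cont_on_integrable; exact: cont_on_cst.
rewrite RintegralD// (Rintegral_itv_cst _ st).
have : Q t = Q s + \int[mu]_(r in `[s, t]) Q' r.
  by apply: hQ'; rewrite in_itv /= lexx (ltW st).
move=> /eqP; rewrite addrC -subr_eq => /eqP <-.
have := bnd _ _ _ C20 h2 (ltW spos); have := bnd _ _ _ C20 h2 (ltW (lt_trans spos st)).
rewrite -/(Q s) -/(Q t).
have := ler_norm (Q t); have := ler_norm (- Q s); rewrite normrN => *.
apply: (@le_trans _ _ (2 * C2 * N x ^+ 2 + (C1 + C3) * N x ^+ 2 * (t - s))); first by lra.
by rewrite le_eqVlt; apply/orP; left; apply/eqP; ring.
Qed.

Variable gamma : R.
Hypothesis gamma_gt0 : 0 < gamma.
Hypothesis gamma_large : forall z, z \in `[a, b] ->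
  invmx P1 ⪯ gamma *: H z /\ - invmx P1 ⪯ gamma *: H z.

Lemma bilc_P1_le z v : z \in `[a, b] ->
  `|@bilc R k n (invmx P1) v v| <= gamma * bilc (H z) v v.
Proof.
move=> zab; have [h1 h2] := gamma_large zab.
have := loewner_le_bilc v h1; have := loewner_le_bilc v h2.
rewrite /bilc !bilNm !bilZm => *; rewrite ler_norml; apply/andP; split; lra.
Qed.

Lemma bilc_lower_order_le : exists2 kappa, 0 <= kappa & forall z v, z \in `[a, b] ->
  `|@bilc R k n (lower_order P1 P0 H dH z) v v| <= kappa * bilc (H z) v v.
Proof.
have [C C0 hC] := bilc_bounded k leab (cont_mx_lower_order (P1 := P1) (P0 := P0) H_C1).
exists (2 * C / m) => [|z v zab]; first by rewrite mulr_ge0 ?mulr_ge0 ?invr_ge0 ?(ltW m_gt0).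
apply: (le_trans (hC _ v v 1 zab ltr01)); rewrite invr1 !mul1r.
have := loewner_le_bilc v (H_ge zab).
have -> : bilc m%:M v v = m * bilc 1%:M v v.
  by rewrite /bilc !bil_scalar !mul1r -mulrDr.
rewrite mulrC -ler_pdivlMr// => h.
have -> : 2 * C / m * bilc (H z) v v = C * (bilc (H z) v v / m + bilc (H z) v v / m).
  by field; rewrite gt_eqF.
by rewrite ler_wpM2l// lerD.
Qed.

(** With [w] the spatial weight, growing towards the observed end [c] at rate
    [mu_ = nu gamma + kappa + 1], let [Q = form (beta P1^-1) x x] with [beta = w]
    up to sign, and [G = form (w H) x x]. Then [|Q| <= gamma G], while the energy
    identity gives [Q' <= w(c) E + (kappa - mu_) G], the boundary term at the
    other end having the good sign. Since [|alpha'| <= nu alpha], the derivative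
    of [alpha Q] is at most [w(c) E - alpha G], and [G] is at least twice the
    final energy, because [w >= 1] and the energy decreases. *)
Lemma sideways_estimate c c' s0 : endpoint c c' s0 ->
  exists2 kappa, 0 <= kappa &
  forall nu q s t x, 0 <= nu -> 0 < s -> s < t -> pH_domain k a b P1 H WB x ->
  2 * N (T t x) ^+ 2 * \int[mu]_(r in `[s, t]) sech_weight nu q r <=
  expR ((nu * gamma + kappa + 1) * (b - a)) * \int[mu]_(r in `[s, t]) energy_at a b H (T r x) c +
  2 * gamma * expR ((nu * gamma + kappa + 1) * (b - a)) * N x ^+ 2 *
    (sech_weight nu q s + sech_weight nu q t).
Proof.
move=> cs; have [kappa kappa0 hkappa] := bilc_lower_order_le; exists kappa => //.
move=> nu q s t x nu0 spos st dx; set mu_ := nu * gamma + kappa + 1.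
have [y L2y Axy] := pH_domain_operator dx; have [L2x _ _] := dx.
have mu0 : 0 <= mu_ by rewrite addr_ge0 ?addr_ge0 ?mulr_ge0// ltW.
pose w z := expR (s0 * mu_ * (z - c')).
pose beta z := s0 * w z; pose dbeta z := mu_ * w z.
have s02 : s0 * s0 = 1 by case: cs => -[_ _ ->]; ring.
have s0n : `|s0| = 1 by case: cs => -[_ _ ->]; rewrite ?normrN normr1.
have w0 z : 0 < w z by exact: expR_gt0.
have Cw := C1_on_exp a b (s0 * mu_) c'.
have Cbeta : C1_on a b beta dbeta.
  have h := C1_onZ s0 Cw.
  rewrite /beta /dbeta /w; move: h; congr (C1_on _ _ _ _).
  by apply/funext => z; rewrite !mulrA s02 mul1r.
have cw : cont_on a b w by have [] := Cw.
have [cbeta cdbeta _] := Cbeta.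
have w_ge1 z : z \in `[a, b] -> 1 <= w z.
  rewrite in_itv /= => /andP[az zb]; rewrite -expR0 ler_expR -mulrA mulrCA.
  by rewrite mulr_ge0//; case: cs => -[_ -> ->]; lra.
have w_le z : z \in `[a, b] -> w z <= expR (mu_ * (b - a)).
  rewrite in_itv /= => /andP[az zb]; rewrite ler_expR -mulrA mulrCA.
  by rewrite ler_wpM2l//; case: cs => -[_ -> ->]; lra.
have cab := endpoint_in cs.
have cwH : cont_mx a b (fun z => w z *: H z) by exact: cont_mxZ.
have cbH : cont_mx a b (fun z => dbeta z *: H z) by exact: cont_mxZ.
have cbP := weighted_P1_cont cbeta.
have cbN : cont_mx a b (fun z => beta z *: lower_order P1 P0 H dH z).
  by apply: cont_mxZ => //; exact: cont_mx_lower_order.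
have L2r r : 0 <= r -> L2 (T r x) by move=> r0; exact: (orbit_L2 T_semigroup).
pose Q r := form (fun z => beta z *: invmx P1) (T r x) (T r x).
pose Q' r := 2 * form (fun z => beta z *: invmx P1) (T r x) (T r y).
pose G r := form (fun z => w z *: H z) (T r x) (T r x).
pose E r := energy_at a b H (T r x) c.
have hQ : C1_on s t Q Q'.
  exact: (orbit_form_C1 L2y Axy t spos cbP (fun z _ => weighted_P1_sym beta z)).
have [alpha' Ca hda] := sech_weight_C1 s t q nu0.
set alpha := sech_weight nu q in Ca hda *.
have a0 r : 0 < alpha r by exact: sech_weight_gt0.
have cE : cont_on s t E by exact: (orbit_observation_cont L2y Axy cs spos).
have QG r : 0 <= r -> `|Q r| <= gamma * G r.
  move=> r0; have Lr := L2r _ r0; have rcs (p : R) : cont_on a b (fun=> p) by exact: cont_on_cst.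
  have cgH : cont_mx a b (fun z => gamma *: (w z *: H z)) by exact: cont_mxZ.
  have pt z : z \in `[a, b] -> `|bilc (beta z *: invmx P1) (T r x z) (T r x z)| <=
      bilc (gamma *: (w z *: H z)) (T r x z) (T r x z).
    move=> zab; rewrite /bilc !bilZm -!mulrDr normrM /beta normrM s0n mul1r.
    rewrite ger0_norm ?(ltW (w0 _))// mulrCA ler_wpM2l ?(ltW (w0 _))//.
    exact: bilc_P1_le.
  rewrite -(L2formZm leab _ cwH Lr Lr) ler_norml; apply/andP; split.
    rewrite -mulN1r -[leRHS]mul1r; rewrite -(L2formZm leab _ cgH Lr Lr) mul1r.
    apply: L2form_le => //; first by apply: cont_mxZ => //.
    move=> z zab; have := pt _ zab; rewrite ler_norml => /andP[+ _].
    by rewrite scaleN1r /bilc !bilNm -opprD.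
  apply: L2form_le => // z zab; exact: le_trans (ler_norm _) (pt _ zab).
have G_ge r : 0 <= r -> r <= t -> 2 * N (T t x) ^+ 2 <= G r.
  move=> r0 rt; have Lr := L2r _ r0.
  apply: (@le_trans _ _ (2 * N (T r x) ^+ 2)).
    rewrite ler_pM2l// ler_pXn2r ?nnegrE ?energy_norm_ge0//.
    have Nle := orbit_energy_nonincreasing Axy r0 rt.
    exact: Nle.
  rewrite (energy_norm_sqr m_gt0 H_ge) mulrA mulfV// mul1r.
  apply: L2form_le => // z zab; rewrite /bilc !bilZm -mulrDr.
  rewrite -[leLHS]mul1r; apply: ler_wpM2r; last exact: w_ge1.
  exact: (bilc_H_ge0 m_gt0 H_ge).
have G_le r : 0 <= r -> G r <= 2 * expR (mu_ * (b - a)) * N x ^+ 2.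
  move=> r0; have Lr := L2r _ r0.
  apply: (@le_trans _ _ (2 * expR (mu_ * (b - a)) * N (T r x) ^+ 2)); last first.
    rewrite ler_pM2l ?mulr_gt0 ?expR_gt0// ler_pXn2r ?nnegrE ?energy_norm_ge0//.
    exact: (orbit_contract leab H_cont m_gt0 H_ge T_semigroup).
  rewrite (energy_norm_sqr m_gt0 H_ge).
  have -> : 2 * expR (mu_ * (b - a)) * (2^-1 * form H (T r x) (T r x)) =
     expR (mu_ * (b - a)) * form H (T r x) (T r x) by field.
  rewrite -(L2formZm leab _ H_cont Lr Lr); apply: L2form_le => //.
    by apply: cont_mxZ => //; exact: cont_on_cst.
  move=> z zab; rewrite /bilc !bilZm -!mulrDr; apply: ler_wpM2r; last exact: w_le.
  exact: (bilc_H_ge0 m_gt0 H_ge).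
have Q'_le r : 0 <= r -> Q' r <= expR (mu_ * (b - a)) * E r + (kappa - mu_) * G r.
  move=> r0; have Lr := L2r _ r0.
  have hid := orbit_energy_identity L2y Axy Cbeta r0; rewrite -/(Q' r) in hid.
  have e1 : form (fun z => dbeta z *: H z) (T r x) (T r x) = mu_ * G r.
    rewrite -(L2formZm leab _ cwH Lr Lr); apply: eq_Rintegral => z _.
    by rewrite /bilc !bilZm /dbeta; ring.
  have e2 : form (fun z => beta z *: lower_order P1 P0 H dH z) (T r x) (T r x) <= kappa * G r.
    rewrite -(L2formZm leab _ cwH Lr Lr); apply: L2form_le => //.
      by apply: cont_mxZ => //; exact: cont_on_cst.
    move=> z zab; apply: (le_trans (ler_norm _)).
    rewrite /bilc !bilZm -!mulrDr normrM /beta normrM s0n mul1r.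
    rewrite ger0_norm ?(ltW (w0 _))// mulrCA ler_wpM2l ?(ltW (w0 _))//.
    exact: hkappa.
  have e3 : beta b * energy_at a b H (T r x) b - beta a * energy_at a b H (T r x) a <=
      expR (mu_ * (b - a)) * E r.
    have Ea := energy_at_ge0 (T r x) (endpoint_in (or_intror (And3 erefl erefl erefl))).
    have Eb := energy_at_ge0 (T r x) (endpoint_in (or_introl (And3 erefl erefl erefl))).
    apply: (@le_trans _ _ (w c * E r)); last first.
      by rewrite ler_wpM2r ?w_le//; exact: energy_at_ge0.
    have wa := ltW (w0 a); have wb := ltW (w0 b).
    have := mulr_ge0 wa Ea; have := mulr_ge0 wb Eb.
    by rewrite /beta /E; case: cs => -[-> _ ->]; lra.
  by move: hid; rewrite e1 mulrBl; lra.
have pQ := C1_on_primitive (C1_onM Ca hQ).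
set e_ := expR (mu_ * (b - a)) in w_le G_le Q'_le *.
have e_0 : 0 < e_ by exact: expR_gt0.
have Ia : mu.-integrable `[s, t] (EFin \o alpha).
  by apply: cont_on_integrable; have [] := Ca.
have IE : mu.-integrable `[s, t] (EFin \o E) by exact: cont_on_integrable.
have main : alpha t * Q t - alpha s * Q s <= \int[mu]_(r in `[s, t])
    (e_ * E r + (- (2 * N (T t x) ^+ 2)) * alpha r).
  apply: (primitive_on_increment st pQ).
    by apply: integrable_realD => //; exact: integrable_realZ.
  move=> r; rewrite in_itv /= => /andP[sr rt].
  have r0 : 0 <= r by rewrite (le_trans (ltW spos)).
  have E0 : 0 <= E r by exact: energy_at_ge0.
  have a1 : alpha r <= 1 by exact: sech_weight_le1.
  have Gr := G_ge _ r0 rt.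
  have G0 : 0 <= G r by apply: le_trans Gr; rewrite mulr_ge0// exprn_ge0// energy_norm_ge0.
  have i1 : Q r * alpha' r <= nu * gamma * (alpha r * G r).
    apply: (le_trans (ler_norm _)); rewrite normrM.
    apply: (@le_trans _ _ (gamma * G r * (nu * alpha r))); last first.
      by rewrite le_eqVlt; apply/orP; left; apply/eqP; ring.
    by apply: ler_pM => //; exact: QG.
  have i2 : alpha r * Q' r <= e_ * E r + (kappa - mu_) * (alpha r * G r).
    apply: (@le_trans _ _ (alpha r * (e_ * E r + (kappa - mu_) * G r))).
      by rewrite ler_pM2l// Q'_le.
    rewrite mulrDr [_ * (_ * G r)]mulrCA lerD2r -[leRHS]mul1r ler_wpM2r//.
    by rewrite mulr_ge0// ltW.
  have i3 : alpha r * (2 * N (T t x) ^+ 2) <= alpha r * G r by rewrite ler_pM2l.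
  have -> : e_ * E r + - (2 * N (T t x) ^+ 2) * alpha r =
     e_ * E r - alpha r * (2 * N (T t x) ^+ 2) by ring.
  (* This cancellation dictates the choice of the rate [mu_]. *)
  have i4 : nu * gamma * (alpha r * G r) + (kappa - mu_) * (alpha r * G r) =
     - (alpha r * G r) by rewrite /mu_; ring.
  lra.
move: main; rewrite RintegralD//; try exact: integrable_realZ.
rewrite !RintegralZl// => main.
have ha p : 0 <= p -> `|alpha p * Q p| <= 2 * gamma * e_ * N x ^+ 2 * alpha p.
  move=> p0; rewrite normrM (ger0_norm (ltW (a0 p))) mulrC ler_pM2r//.
  apply: (le_trans (QG _ p0)).
  have -> : 2 * gamma * e_ * N x ^+ 2 = gamma * (2 * e_ * N x ^+ 2) by ring.
  by rewrite ler_pM2l// G_le.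
have := ha _ (ltW spos); have := ha _ (ltW (lt_trans spos st)).
have := ler_norm (alpha s * Q s); have := ler_norm (- (alpha t * Q t)).
rewrite normrN mulrDr; lra.
Qed.

End trajectories.

(** * Stability and strict contractions *)

Section stability.
Variables (R : realType) (k : scalar_kind) (n : nat) (a b m : R).
Local Notation K := (scalars R k).
Local Notation mu := (@lebesgue_measure R).
Local Notation state := (R -> 'cV[K]_n).
Local Notation L2 := (@L2 R k n a b).
Implicit Types (f g x y : state) (e d r s t h : R).

Hypothesis leab : a <= b.
Variable H : R -> 'M[R]_n.
Hypothesis H_cont : cont_mx a b H.
Hypothesis H_sym : forall z, z \in `[a, b] -> (H z)^T = H z.
Hypothesis m_gt0 : 0 < m.
Hypothesis H_ge : forall z, z \in `[a, b] -> m%:M ⪯ H z.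
Local Notation N := (@energy_norm R k n a b H).
Variable T : R -> state -> state.
Hypothesis T_semigroup : contraction_semigroup k a b H T.

Lemma orbit_norm_add s t f : 0 <= s -> 0 <= t -> L2 f ->
  N (T (s + t) f) = N (T s (T t f)).
Proof.
move=> s0 t0 hf; apply: (energy_norm_congr H_cont m_gt0 H_ge).
- by apply: (orbit_L2 T_semigroup) => //; exact: addr_ge0.
- by do 2 apply: (orbit_L2 T_semigroup) => //.
- exact: (orbit_add T_semigroup).
Qed.

(** After [j] periods of length [tf] the norm has been multiplied by [q ^+ j];
    the constant [q^-1] absorbs the incomplete last period. *)
Lemma exponentially_stable_of_contraction (q tf : R) : 0 < q -> q < 1 -> 0 < tf ->
  (forall f, L2 f -> N (T tf f) <= q * N f) -> exponentially_stable a b H T.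
Proof.
move=> q0 q1 tf0 hq; have n0 := @energy_norm_ge0 R k n a b H.
have iter_le j r f : 0 <= r -> L2 f -> N (T (r + tf *+ j) f) <= q ^+ j * N f.
  move=> r0; elim: j f => [|j IH] f hf.
    rewrite mulr0n addr0 expr0 mul1r.
    exact: (orbit_contract leab H_cont m_gt0 H_ge T_semigroup).
  rewrite mulrS [tf + _]addrC addrA orbit_norm_add//; last 2 first.
  - by rewrite addr_ge0// mulrn_wge0// ltW.
  - exact: ltW.
  have hTf : L2 (T tf f) by apply: (orbit_L2 T_semigroup) => //; exact: ltW.
  apply: (le_trans (IH _ hTf)); rewrite exprSr -mulrA ler_wpM2l ?exprn_ge0 ?(ltW q0)//.
  exact: hq.
have lnq : ln q < 0 by rewrite -ln1 ltr_ln ?posrE.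
exists q^-1, (- ln q / tf); split; first by rewrite invr_gt0.
  by rewrite divr_gt0// oppr_gt0.
move=> t t0; apply: op_norm_le => [f hf|]; last first.
  by rewrite mulr_ge0 ?expR_ge0// invr_ge0 ltW.
pose j := Num.truncn (t / tf).
have ttf : 0 <= t / tf by rewrite divr_ge0// ltW.
have := truncn_itv ttf; rewrite -/j => /andP[j1 j2].
have r0 : 0 <= t - tf *+ j.
  by rewrite subr_ge0 -mulr_natr mulrC -ler_pdivlMr.
rewrite -(subrK (tf *+ j) t); apply: (le_trans (iter_le _ _ _ r0 hf)).
rewrite subrK; apply: ler_wpM2r => //.
have -> : q ^+ j = expR (j%:R * ln q).
  by rewrite expRM_natl lnK// posrE.
have -> : q^-1 = expR (- ln q) by rewrite expRN lnK// posrE.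
rewrite -expRD ler_expR.
have -> : - ln q + - (- ln q / tf) * t = ln q * (t / tf - 1) by ring.
rewrite mulrC; apply: ler_wnM2l; first exact: ltW.
by rewrite lerBlDr natr1 ltW.
Qed.

Lemma exponentially_stable_small : exponentially_stable a b H T ->
  forall t0, exists2 tf, t0 < tf & forall f, L2 f ->
    N (T tf f) ^+ 2 <= 2^-1 * N f ^+ 2.
Proof.
move=> [C [om [C0 om0 hC]]] t0; have n0 := @energy_norm_ge0 R k n a b H.
pose tf := `|t0| + 2 * C / om + 1.
have Com : 0 < 2 * C / om by rewrite divr_gt0// mulr_gt0.
have tf0 : 0 <= tf by rewrite !addr_ge0// ltW.
exists tf => [|f hf]; first by have := ler_norm t0; rewrite /tf; lra.
have small : C * expR (- om * tf) <= 2^-1.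
  rewrite mulNr expRN ler_pdivrMr ?expR_gt0//.
  have := expR_ge1Dx (om * tf); have : 2 * C <= om * tf.
    rewrite /tf mulrDr mulrDr.
    have -> : om * (2 * C / om) = 2 * C by field; rewrite gt_eqF.
    have : 0 <= om * `|t0| by rewrite mulr_ge0// ltW.
    by lra.
  lra.
have c0 : 0 <= C * expR (- om * tf) by rewrite mulr_ge0 ?expR_ge0// ltW.
have h := op_norm_le_bound leab H_cont m_gt0 H_ge (orbit_op T_semigroup tf0) c0 (hC _ tf0) hf.
have h2 : N (T tf f) <= 2^-1 * N f by apply: (le_trans h); rewrite ler_wpM2r.
rewrite -(@ler_pXn2r _ 2) ?nnegrE ?mulr_ge0// in h2.
apply: (le_trans h2); rewrite exprMn ler_wpM2r ?exprn_ge0//.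
rewrite expr2; lra.
Qed.

(** Compare [f] with a close [x] in [D]: [T t] is Lipschitz. *)
Lemma contraction_by_density (D : set state) (q t : R) : 0 <= q -> 0 <= t ->
  (forall f e, L2 f -> 0 < e -> exists x, [/\ L2 x, D x & N (f - x) < e]) ->
  (forall x, L2 x -> D x -> N (T t x) <= q * N x) ->
  forall f, L2 f -> N (T t f) <= q * N f.
Proof.
move=> q0 t0 dense hq f hf; have n0 := @energy_norm_ge0 R k n a b H.
apply/ler_addgt0Pr => e e0.
have c0 : 0 < 1 + q by lra.
have [x [hx Dx fx]] := dense f _ hf (divr_gt0 e0 c0).
have hfx : L2 (f - x) by exact: L2B.
have hT g : L2 g -> L2 (T t g) by exact: (orbit_L2 T_semigroup).
have -> : T t f = (T t f - T t x) + T t x by rewrite subrK.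
have h1 : N (T t f - T t x) <= N (f - x).
  rewrite (operator_normB leab H_cont m_gt0 H_ge (orbit_op T_semigroup t0))//.
  exact: (orbit_contract leab H_cont m_gt0 H_ge T_semigroup).
have h2 : N x <= N f + N (f - x).
  rewrite (energy_norm_distC leab H_cont m_gt0 H_ge)//.
  rewrite -{1}(subrKC f x).
  by apply: (energy_normD leab H_cont H_sym m_gt0 H_ge) => //; exact: L2B.
have h3 : N (T t f - T t x + T t x) <= N (T t f - T t x) + N (T t x).
  by apply: (energy_normD leab H_cont H_sym m_gt0 H_ge); auto; apply: L2B; auto.
have h4 := hq _ hx Dx.
have h5 : q * N x <= q * (N f + N (f - x)) by rewrite ler_wpM2l.
have h6 : (1 + q) * N (f - x) <= e.
  by rewrite mulrC -ler_pdivlMr// ltW.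
rewrite mulrDr in h5; rewrite mulrDl mul1r in h6; lra.
Qed.

End stability.

Lemma le_Rintegral_sub (R : realType) (A B : set R) (f : R -> R) :
  measurable A -> measurable B -> A `<=` B ->
  (@lebesgue_measure R).-integrable B (EFin \o f) -> (forall z, B z -> 0 <= f z) ->
  \int[@lebesgue_measure R]_(z in A) f z <= \int[@lebesgue_measure R]_(z in B) f z.
Proof.
move=> mA mB AB If f0; apply: fine_le.
- by apply: integrable_fin_num => //; exact: integrableS If.
- exact: integrable_fin_num.
- apply: ge0_subset_integral => //.
  by have /integrableP[] := If.
Qed.

(** The time needed to cross the segment is [gamma * l], and [L] is half the
    length of the observation interval. With [d = (L - gamma * l) / 2] the left
    side decays like [exp (- 2 nu d)] and the right side like [exp (- nu d)]. *)
Lemma decay_rate_exists (R : realType) (gamma l L kappa : R) :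
  0 < gamma -> gamma * l < L ->
  exists2 nu, 0 <= nu &
    4 * gamma * expR ((nu * gamma + kappa + 1) * l) * expR (- nu * L) <
    (L - gamma * l) * expR (- nu * ((L - gamma * l) / 2)).
Proof.
move=> g0 lL; pose d := (L - gamma * l) / 2.
have d0 : 0 < d by rewrite divr_gt0// subr_gt0.
pose B := 2 * gamma / d * expR ((kappa + 1) * l).
have B0 : 0 < B by rewrite mulr_gt0 ?expR_gt0// divr_gt0// mulr_gt0.
exists (B / d) => [|]; first by rewrite divr_ge0 ?ltW.
set nu := B / d; rewrite -/d.
have -> : L - gamma * l = 2 * d by rewrite /d; field.
have -> : 4 * gamma * expR ((nu * gamma + kappa + 1) * l) * expR (- nu * L) =
   2 * d * expR (- nu * d) * (B * expR (- (nu * d))).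
  have -> : 2 * d * expR (- nu * d) * (B * expR (- (nu * d))) =
    4 * gamma * (expR ((kappa + 1) * l) * (expR (- nu * d) * expR (- (nu * d)))).
    by rewrite /B; field; rewrite gt_eqF.
  rewrite -mulrA -!expRD; congr (_ * expR _).
  by rewrite /d; field.
rewrite -[ltRHS]mulr1 ltr_pM2l; last first.
  by apply: mulr_gt0; [rewrite mulr_gt0|exact: expR_gt0].
rewrite expRN ltr_pdivrMr ?expR_gt0// mul1r.
apply: lt_le_trans (expR_ge1Dx _).
have -> : nu * d = B by rewrite /nu; field; rewrite gt_eqF.
by rewrite ltrDr.
Qed.

(** * From observation to contraction *)

Section observability.
Variables (R : realType) (k : scalar_kind) (n : nat) (a b m : R).
Local Notation K := (scalars R k).
Local Notation mu := (@lebesgue_measure R).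
Local Notation state := (R -> 'cV[K]_n).
Local Notation L2 := (@L2 R k n a b).
Implicit Types (f g x y : state) (e d r s t h : R).

Hypothesis ltab : a < b.
Let leab := ltW ltab.
Variables (P1 P0 : 'M[R]_n) (H dH : R -> 'M[R]_n) (WB : 'M[R]_(n, n + n)).
Hypothesis H_C1 : forall i j, C1_on a b (fun z => H z i j) (fun z => dH z i j).
Hypothesis H_sym : forall z, z \in `[a, b] -> (H z)^T = H z.
Hypothesis m_gt0 : 0 < m.
Hypothesis H_ge : forall z, z \in `[a, b] -> m%:M ⪯ H z.
Hypothesis P1_sym : P1^T = P1.
Hypothesis P1_unit : P1 \in unitmx.
Local Notation N := (@energy_norm R k n a b H).
Variable T : R -> state -> state.
Hypothesis T_semigroup : contraction_semigroup k a b H T.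
Hypothesis T_generated : generated_by a b H (pH_operator k a b P1 P0 H WB) T.
Variable gamma : R.
Hypothesis gamma_gt0 : 0 < gamma.
Hypothesis gamma_large : forall z, z \in `[a, b] ->
  invmx P1 ⪯ gamma *: H z /\ - invmx P1 ⪯ gamma *: H z.

(** The sideways estimate with temporal weight centred in the middle of [[s, t]].
    The integral of the weight is bounded below on the interval of half length
    [D] around the centre, its values at the ends above by [exp (- nu L)]. *)
Lemma final_energy_observed c c' s0 s t : endpoint a b c c' s0 -> 0 < s ->
  2 * gamma * (b - a) < t - s ->
  exists p r, [/\ 0 <= r, r < p & forall x, pH_domain k a b P1 H WB x ->
    p * N (T t x) ^+ 2 <=
    \int[mu]_(u in `[s, t]) energy_at a b H (T u x) c + r * N x ^+ 2].
Proof.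
move=> cs spos stg; have ab0 : 0 < b - a by rewrite subr_gt0.
have st : s < t by rewrite -subr_gt0; apply: le_lt_trans stg; rewrite !mulr_ge0// ltW.
have [kappa kappa0 hside] := sideways_estimate ltab H_C1 H_sym m_gt0 H_ge P1_sym P1_unit
  T_semigroup T_generated gamma_gt0 gamma_large cs.
pose L := (t - s) / 2; pose q := (s + t) / 2.
have gL : gamma * (b - a) < L by rewrite /L ltr_pdivlMr//; lra.
have [nu nu0 hnu] := decay_rate_exists kappa gamma_gt0 gL.
set D := (L - gamma * (b - a)) / 2 in hnu.
have D0 : 0 < D by rewrite divr_gt0// subr_gt0.
set e_ := expR ((nu * gamma + kappa + 1) * (b - a)) in hnu.
have e0 : 0 < e_ by exact: expR_gt0.
exists ((L - gamma * (b - a)) * expR (- nu * D) / e_), (4 * gamma * expR (- nu * L)).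
split; first by rewrite !mulr_ge0 ?expR_ge0// ltW.
  by rewrite ltr_pdivlMr//; move: hnu; rewrite mulrAC.
move=> x dx; have n0 := @energy_norm_ge0 R k n a b H.
have main := hside nu q s t x nu0 spos st dx; rewrite -/e_ in main.
have Ia : mu.-integrable `[s, t] (EFin \o sech_weight nu q).
  by apply: cont_on_integrable; have [da [] ] := sech_weight_C1 s t q nu0.
have as_ : sech_weight nu q s <= expR (- nu * L).
  apply: (le_trans (sech_weight_le q s nu0)).
  have -> : s - q = - L by rewrite /q /L; field.
  by rewrite normrN ger0_norm// ltW// divr_gt0// subr_gt0.
have at_ : sech_weight nu q t <= expR (- nu * L).
  apply: (le_trans (sech_weight_le q t nu0)).
  have -> : t - q = L by rewrite /q /L; field.
  by rewrite ger0_norm// ltW// divr_gt0// subr_gt0.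
have qD : q - D < q + D by lra.
have DL : D <= L.
  have : 0 <= gamma * (b - a) by rewrite mulr_ge0 ?ltW.
  have : 0 < L by apply: le_lt_trans gL; rewrite mulr_ge0 ?ltW.
  rewrite /D; lra.
have intge : D * expR (- nu * D) <= \int[mu]_(r in `[s, t]) sech_weight nu q r.
  have sub : `[q - D, q + D] `<=` `[s, t].
    move=> z /=; rewrite !in_itv /= => /andP[z1 z2].
    by have := DL; rewrite /q /L in z1 z2 *; move=> ?; apply/andP; split; lra.
  apply: (@le_trans _ _ (\int[mu]_(r in `[q - D, q + D]) sech_weight nu q r)); last first.
    apply: le_Rintegral_sub => // z _; exact/ltW/sech_weight_gt0.
  have -> : D * expR (- nu * D) =
      \int[mu]_(r in `[q - D, q + D]) (2^-1 * expR (- nu * D)).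
    by rewrite Rintegral_itv_cst//; field.
  apply: le_Rintegral => //.
  - by apply: cont_on_integrable; exact: cont_on_cst.
  - exact: integrableS Ia.
  - move=> z; rewrite /= in_itv /= => /andP[z1 z2].
    apply: le_trans (sech_weight_ge q z nu0).
    rewrite ler_pM2l// ler_expR !mulNr lerN2 ler_wpM2l//.
    by rewrite ler_norml; apply/andP; split; lra.
rewrite mulrAC ler_pdivrMr//.
apply: (@le_trans _ _ (2 * N (T t x) ^+ 2 * \int[mu]_(r in `[s, t]) sech_weight nu q r)).
  have -> : (L - gamma * (b - a)) * expR (- nu * D) * N (T t x) ^+ 2 =
     2 * N (T t x) ^+ 2 * (D * expR (- nu * D)) by rewrite /D; field.
  by rewrite ler_wpM2l// mulr_ge0// exprn_ge0.
apply: (le_trans main).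
set I := \int[mu]_(u in `[s, t]) energy_at a b H (T u x) c.
have -> : (I + 4 * gamma * expR (- nu * L) * N x ^+ 2) * e_ =
    e_ * I + 4 * gamma * expR (- nu * L) * N x ^+ 2 * e_ by ring.
rewrite lerD2l.
apply: (@le_trans _ _ (2 * gamma * e_ * N x ^+ 2 * (2 * expR (- nu * L)))).
  rewrite ler_wpM2l//; first by rewrite !mulr_ge0 ?exprn_ge0// ltW.
  by lra.
by rewrite le_eqVlt; apply/orP; left; apply/eqP; ring.
Qed.

(** Eliminating the observation between [p |x(t)|^2 <= I + r |x|^2] and
    [|x(tf)|^2 - |x|^2 <= - kap I] gives the factor
    [(1 + kap r) / (1 + kap p) < 1] for the energy. *)
Lemma observed_contraction c c' s0 s t tf kap : endpoint a b c c' s0 -> 0 < s -> t < tf ->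
  2 * gamma * (b - a) < t - s -> 0 < kap ->
  (forall x, pH_domain k a b P1 H WB x ->
    N (T tf x) ^+ 2 - N x ^+ 2 <=
    - kap * \int[mu]_(u in `[s, t]) energy_at a b H (T u x) c) ->
  exists q, [/\ 0 < q, q < 1 & forall x, pH_domain k a b P1 H WB x ->
    N (T tf x) <= q * N x].
Proof.
move=> cs spos ttf stg kap0 obs; have n0 := @energy_norm_ge0 R k n a b H.
have [p [r [r0 rp hp]]] := final_energy_observed cs spos stg.
have p0 : 0 < p by exact: le_lt_trans rp.
have st : s < t.
  rewrite -subr_gt0; apply: le_lt_trans stg; rewrite !mulr_ge0 ?ltW//.
  by rewrite subr_gt0.
have A0 : 0 < 1 + kap * r by rewrite ltr_wpDr// mulr_ge0// ltW.
have B0 : 0 < 1 + kap * p by rewrite ltr_wpDr// mulr_ge0// ltW.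
have AB : 1 + kap * r < 1 + kap * p by rewrite ltrD2l ltr_pM2l.
exists (Num.sqrt ((1 + kap * r) / (1 + kap * p))); split.
- by rewrite sqrtr_gt0 divr_gt0.
- by rewrite -[ltRHS]sqrtr1 ltr_sqrt// ltr_pdivrMr// mul1r.
- move=> x dx; have [y L2y Axy] := pH_domain_operator ltab P0 dx.
  have tf_le : N (T tf x) <= N (T t x).
    exact: (orbit_energy_nonincreasing ltab H_C1 m_gt0 H_ge T_semigroup Axy
      (ltW (lt_trans spos st)) (ltW ttf)).
  have sq : N (T tf x) ^+ 2 <= N (T t x) ^+ 2 by rewrite ler_pXn2r ?nnegrE.
  have h1 := hp _ dx; have h2 := obs _ dx.
  set I := Rintegral _ _ _ in h1 h2.
  rewrite -(@ler_pXn2r _ 2) ?nnegrE ?mulr_ge0 ?sqrtr_ge0//.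
  rewrite exprMn [Num.sqrt (_ / _) ^+ 2]sqr_sqrtr ?divr_ge0 ?(ltW A0) ?(ltW B0)//.
  rewrite mulrAC ler_pdivlMr// mulrC.
  have h3 : kap * (p * N (T tf x) ^+ 2) <= kap * (I + r * N x ^+ 2).
    by rewrite ler_pM2l//; apply: le_trans h1; rewrite ler_pM2l.
  rewrite mulrDr in h3; rewrite mulNr in h2.
  rewrite !mulrDl !mul1r -!mulrA; lra.
Qed.

End observability.

(** * Approximation in mean square by smooth functions *)

Section density.
Variables (R : realType) (a b : R).
Hypothesis ltab : a < b.
Let leab := ltW ltab.
Local Notation mu := (@lebesgue_measure R).
Implicit Types (f g v w : R -> R) (e C h : R).

(** The approximants vanish at both ends because co-energies that do so satisfy
    every boundary condition. *)
Definition C1_approximable f := forall e, 0 < e -> exists v dv,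
  [/\ C1_on a b v dv, v a = 0, v b = 0 &
      (\int[mu]_(z in `[a, b]) ((f z - v z) ^+ 2)%:E < e%:E)%E].

(** Closure under dominated limits, the one tool used to pass from each class of
    functions to the next larger one. *)
Lemma C1_approximable_limit (f_ : nat -> R -> R) f g :
  (forall j, measurable_fun `[a, b] (f_ j)) -> measurable_fun `[a, b] f ->
  (forall j z, z \in `[a, b] -> `|f_ j z| <= g z) ->
  (forall z, z \in `[a, b] -> `|f z| <= g z) ->
  mu.-integrable `[a, b] (EFin \o (fun z => g z ^+ 2)) ->
  (\forall z \ae mu, z \in `[a, b] -> f_ j z @[j --> \oo] --> f z) ->
  (forall j, C1_approximable (f_ j)) -> C1_approximable f.
Proof.
move=> mf_ mf f_g fg Ig cvgf appr e e0.
have e40 : 0 < e / 4 by rewrite divr_gt0.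
have msq (u v : R -> R) : measurable_fun `[a, b] u -> measurable_fun `[a, b] v ->
    measurable_fun `[a, b] (fun z => ((u z - v z) ^+ 2)%:E).
  move=> mu_ mv; apply/measurable_EFinP; apply: measurable_funX.
  exact: measurable_funB.
have h1 : \forall z \ae mu, `[a, b]%classic z ->
    ((f z - f_ j z) ^+ 2)%:E @[j --> \oo] --> (0 : \bar R).
  move: cvgf; apply: filterS => z + zab => /(_ zab) h.
  apply/fine_cvgP; split; first by near=> j.
  have -> : (0 : R) = (f z - f z) * (f z - f z) by rewrite subrr mul0r.
  by apply: cvgM; apply: cvgB => //; exact: cvg_cst.
have h2 : mu.-integrable `[a, b] (fun z => (4 * g z ^+ 2)%:E).
  exact: integrable_realZ.
have h3 : \forall z \ae mu, forall j, `[a, b]%classic z ->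
    (`|((f z - f_ j z) ^+ 2)%:E| <= (4 * g z ^+ 2)%:E)%E.
  apply: aeW => z j zab; rewrite abse_EFin lee_fin ger0_norm ?sqr_ge0//.
  have : `|f z - f_ j z| <= 2 * g z.
    apply: (le_trans (ler_normB _ _)).
    by have := fg _ zab; have := f_g j _ zab; lra.
  move=> hle; have hge := le_trans (normr_ge0 _) hle.
  have := ler_pM (normr_ge0 _) (normr_ge0 _) hle hle.
  by rewrite -expr2 real_normK ?num_real// !expr2; lra.
have [_ _ cv] := @dominated_convergence _ _ _ mu _ (measurable_itv `[a, b])
  (fun j z => ((f z - f_ j z) ^+ 2)%:E) (cst 0%E) (fun z => (4 * g z ^+ 2)%:E)
  (fun j => msq _ _ mf (mf_ j)) (measurable_cst _) h1 h2 h3.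
rewrite integral_cst// mul0e in cv.
have /fine_cvgP[cvfin cvlim] := cv.
have cvlt : \forall j \near \oo,
    fine (\int[mu]_(z in `[a, b]) ((f z - f_ j z) ^+ 2)%:E)%E < e / 4.
  exact: (cvgr_lt _ cvlim _ e40).
near \oo => j.
have hj : (\int[mu]_(z in `[a, b]) ((f z - f_ j z) ^+ 2)%:E < (e / 4)%:E)%E.
  have fin : (\int[mu]_(z in `[a, b]) ((f z - f_ j z) ^+ 2)%:E)%E \is a fin_num.
    by near: j.
  by rewrite -(fineK fin) lte_fin; near: j.
have [v [dv [Cv va vb hv]]] := appr j _ e40.
have mv : measurable_fun `[a, b] v by apply: cont_on_measurable; have [] := Cv.
exists v, dv; split=> //.
apply: (@le_lt_trans _ _ (\int[mu]_(z in `[a, b]) (2%:E * ((f z - f_ j z) ^+ 2)%:E +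
    2%:E * ((f_ j z - v z) ^+ 2)%:E))%E).
  apply: ge0_le_integral => //.
  - by move=> z _; rewrite lee_fin sqr_ge0.
  - exact: msq.
  - by apply: emeasurable_funD; apply: emeasurable_funM => //; exact: msq.
  - move=> z _; rewrite -!EFinM -EFinD lee_fin.
    have := sqr_ge0 ((f z - f_ j z) - (f_ j z - v z)); rewrite !expr2; lra.
have sq0 (x : R) : (0 <= (x ^+ 2)%:E)%E by rewrite lee_fin sqr_ge0.
rewrite ge0_integralD//=; last 4 first.
- by move=> z _; rewrite mule_ge0.
- by apply: emeasurable_funM => //; exact: msq.
- by move=> z _; rewrite mule_ge0.
- by apply: emeasurable_funM => //; exact: msq.
rewrite !ge0_integralZl//; try exact: msq.
have -> : e%:E = (2%:E * (e / 4)%:E + 2%:E * (e / 4)%:E)%E.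
  by rewrite -!EFinM -EFinD; congr EFin; field.
by apply: lteD; rewrite lte_pmul2l.
Unshelve. all: by end_near.
Qed.

(** Multiply by the cutoffs [1 - rho ^+ j], where the square [rho] of the affine
    function mapping [[a, b]] to [[-1, 1]] is one at the ends and less than one
    inside. *)
Lemma C1_approximable_C1 v : is_C1_on a b v -> C1_approximable v.
Proof.
move=> [dv Cv]; have ab0 : 0 < b - a by rewrite subr_gt0.
pose rho z := 1 + - 4 / (b - a) ^+ 2 * ((z + - a) * (-1 * z + b)).
have C1rho : is_C1_on a b rho.
  have C1l (p q : R) : C1_on a b (fun z => p * z + q) (fun=> p * 1 + 0).
    by apply: C1_onD; [apply: C1_onZ; exact: C1_on_id|exact: C1_on_cst].
  have h1 := C1_onD (C1_on_id a b) (C1_on_cst a b (- a)).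
  have h2 := C1_onD (C1_onZ (-1) (C1_on_id a b)) (C1_on_cst a b b).
  have h3 := C1_onD (C1_on_cst a b 1) (C1_onZ (- 4 / (b - a) ^+ 2) (C1_onM h1 h2)).
  by eexists; exact: h3.
have rhoX j : is_C1_on a b (fun z => rho z ^+ j).
  elim: j => [|j [dr IH]].
    by exists (fun=> 0); under eq_fun do rewrite expr0; exact: C1_on_cst.
  have [d hd] := C1rho; eexists; under eq_fun do rewrite exprS.
  exact: (C1_onM hd IH).
have rho_a : rho a = 1 by rewrite /rho; ring.
have rho_b : rho b = 1 by rewrite /rho; ring.
have rho_in z : z \in `[a, b] -> 0 <= rho z /\ rho z <= 1.
  rewrite in_itv /= => /andP[az zb].
  have -> : rho z = ((2 * z - a - b) / (b - a)) ^+ 2 by rewrite /rho; field; rewrite gt_eqF.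
  split; first exact: sqr_ge0.
  rewrite expr_div_n ler_pdivrMr ?exprn_gt0// mul1r.
  have : 0 <= (z - a) * (b - z) by rewrite mulr_ge0// subr_ge0.
  rewrite !expr2; lra.
have rho_lt z : z \in `]a, b[ -> `|rho z| < 1.
  move=> zab; have zab' : z \in `[a, b].
    by move: zab; rewrite !in_itv /= => /andP[/ltW-> /ltW->].
  have [r0 _] := rho_in _ zab'; rewrite ger0_norm//.
  move: zab; rewrite in_itv /= => /andP[az zb].
  rewrite /rho gtrDl mulNr mulNr oppr_lt0 mulr_gt0 ?divr_gt0 ?exprn_gt0//.
  by rewrite mulr_gt0; lra.
pose f_ j z := v z + -1 * (v z * rho z ^+ j).
have f_C1 j : exists df, C1_on a b (f_ j) df.
  have [d hd] := rhoX j; eexists.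
  exact: (C1_onD Cv (C1_onZ (-1) (C1_onM Cv hd))).
have cv : cont_on a b v by have [] := Cv.
apply: (@C1_approximable_limit f_ v (fun z => `|v z|)).
- by move=> j; apply: cont_on_measurable; have [df []] := f_C1 j.
- exact: cont_on_measurable.
- move=> j z zab; have [r0 r1] := rho_in _ zab.
  have -> : f_ j z = v z * (1 - rho z ^+ j) by rewrite /f_; ring.
  rewrite normrM -[leRHS]mulr1 ler_wpM2l// ger0_norm ?subr_ge0 ?exprn_ile1//.
  by rewrite lerBlDr lerDl exprn_ge0.
- by [].
- apply: cont_on_integrable; under [X in cont_on _ _ X]eq_fun do rewrite real_normK ?num_real// expr2.
  exact: cont_onM.
- have : \forall z \ae mu, z != a /\ z != b.
    by move: (ae_neq a) (ae_neq b); apply: filterS2.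
  apply: filterS => z [za zb] zab.
  have zoo : z \in `]a, b[.
    move: zab; rewrite !in_itv /= => /andP[az bz].
    by rewrite !lt_neqAle eq_sym za az zb.
  have -> : v z = v z + -1 * (v z * 0) by ring.
  apply: cvgD; first exact: cvg_cst.
  apply: cvgM; first exact: cvg_cst.
  by apply: cvgM; [exact: cvg_cst|apply: cvg_expr; exact: rho_lt].
- move=> j e e0; have [df hdf] := f_C1 j; exists (f_ j), df; split=> //.
  + by rewrite /f_ rho_a expr1n; ring.
  + by rewrite /f_ rho_b expr1n; ring.
  + under eq_integral do rewrite subrr expr0n /=.
    by rewrite integral0 lte_fin.
Qed.

Section steklov_averages.
Variables (f : R -> R) (l u C : R).
Hypotheses (lta : l < a) (ltu : b + 1 < u).
Hypothesis If : mu.-integrable `[l, u] (EFin \o f).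
Hypothesis fC : forall z, z \in `[l, u] -> `|f z| <= C.

Let F y := \int[mu]_(t in `[l, y]) f t.

(** The average of [f] over [[z, z + 1 / (j + 1)]]; [f] lives on the larger
    segment [[l, u]] so that the average makes sense up to [b]. *)
Definition steklov (j : nat) z := j.+1%:R * (F (z + j.+1%:R^-1) - F z).

Let h_gt0 (j : nat) : 0 < j.+1%:R^-1 :> R. Proof. by rewrite invr_gt0. Qed.

Let h_le1 (j : nat) : j.+1%:R^-1 <= 1 :> R.
Proof. by rewrite invf_le1// ler1n. Qed.

Lemma steklov_bound j z : z \in `[a, b] -> `|steklov j z| <= C.
Proof.
have [la bu] := (lta, ltu).
rewrite in_itv /= => /andP[az zb]; have h0 := h_gt0 j; have h1 := h_le1 j.
set h := j.+1%:R^-1 in h0 h1 *.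
have zh : z < z + h by rewrite ltrDl.
have Iz : mu.-integrable `[l, z + h] (EFin \o f).
  by apply: integrableS If => // t /=; rewrite !in_itv /= => /andP[-> ?] /=; lra.
have Izz : mu.-integrable `]z, z + h] (EFin \o f).
  by apply: integrableS Iz => // t /=; rewrite !in_itv /= => /andP[? ->]; rewrite andbT; lra.
have -> : steklov j z = h^-1 * \int[mu]_(t in `[z, z + h]) f t.
  rewrite /steklov /F Rintegral_itvB// ?bnd_simp ?ltW//; last by lra.
  by rewrite Rintegral_itv_obnd_cbnd// invrK.
have Izc : mu.-integrable `[z, z + h] (EFin \o f).
  by apply: integrableS Iz => // t /=; rewrite !in_itv /= => /andP[? ->]; rewrite andbT; lra.
rewrite normrM ger0_norm ?invr_ge0 ?(ltW h0)// ler_pdivrMl//.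
apply: (le_trans (le_normr_Rintegral _ Izc)) => //.
have -> : h * C = \int[mu]_(t in `[z, z + h]) C.
  by rewrite Rintegral_itv_cst//; ring.
apply: le_Rintegral => //.
- by apply: eq_integrable (integrable_abse Izc).
- by apply: cont_on_integrable; exact: cont_on_cst.
- by move=> t; rewrite /= in_itv /= => /andP[? ?]; apply: fC; rewrite in_itv /=; lra.
Qed.

Lemma steklov_cvg z : is_derive (z : R) (1 : R) F (f z) -> steklov j z @[j --> \oo] --> f z.
Proof.
move=> [dF F'].
have : h^-1 *: (F (h *: (1 : R) + z) - F z) @[h --> 0^'] --> f z.
  by rewrite -F'; exact: dF.
move=> /cvgrPdist_lt hF; apply/cvgrPdist_lt => e e0.
have /nbhs_ballP[d /= d0 hd] := hF _ e0.
near=> j.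
have jd : j.+1%:R^-1 < d.
  near: j; exact: (near_infty_natSinv_lt (PosNum d0)).
have h0 := h_gt0 j.
have := hd j.+1%:R^-1; rewrite /ball /= sub0r normrN ger0_norm ?(ltW h0)//.
move=> /(_ jd); rewrite gt_eqF// => /(_ isT).
by rewrite /steklov invrK /GRing.scale /= mulr1 [_ + z]addrC.
Unshelve. all: by end_near.
Qed.

Let cont_F : cont_on l u F.
Proof.
apply: parameterized_integral_continuous => //.
by have := (lta, ltu) => -[la bu]; have := ltab; lra.
Qed.

Lemma steklov_continuous (z : R) j : l < z -> z + j.+1%:R^-1 < u ->
  {for z, continuous (steklov j)}.
Proof.
have h0 := h_gt0 j; set h := j.+1%:R^-1 in h0 * => lz zu.
have lu : l < u by apply: lt_trans lz (lt_trans _ zu); rewrite ltrDl.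
have [cF _ _] := (continuous_within_itvP F lu).1 cont_F.
have c1 : {for z, continuous F} by apply: cF; rewrite in_itv /= lz; lra.
have c2 : {for z + h, continuous F} by apply: cF; rewrite in_itv /= zu; lra.
apply: cvgM; first exact: cvg_cst.
apply: cvgB => //.
apply: (@cvg_comp _ _ _ (fun x => x + h) F _ _ _ _ c2).
by apply: cvgD; [exact: cvg_id|exact: cvg_cst].
Qed.

Hypothesis f_cont : forall z : R, z \in `]l, u[ -> {for z, continuous f}.

Lemma steklov_derive (z : R) : z \in `]l, u[ -> is_derive z (1 : R) F (f z).
Proof.
move=> zlu; have := zlu; rewrite in_itv /= => /andP[lz zu].
have [dF F'] := continuous_FTC1_closed zu If lz (f_cont zlu).
by split; [exact: dF|rewrite -derive1E; exact: F'].
Qed.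

Lemma C1_approximable_continuous : C1_approximable f.
Proof.
have [la bu] := (lta, ltu).
have in_lu z : z \in `[a, b] -> z \in `]l, u[.
  by rewrite !in_itv /= => /andP[? ?]; apply/andP; split; lra.
have in_lu' z : z \in `[a, b] -> z \in `[l, u].
  by rewrite !in_itv /= => /andP[? ?]; apply/andP; split; lra.
have in_luh j z : z \in `[a, b] -> z + j.+1%:R^-1 \in `]l, u[.
  have := h_gt0 j; have := h_le1 j; set h := j.+1%:R^-1 => ? ?.
  by rewrite !in_itv /= => /andP[? ?]; apply/andP; split; lra.
have cf : cont_on a b f.
  by apply: continuous_in_subspaceT => z; rewrite mem_setE => /in_lu; exact: f_cont.
have st_C1 j : C1_on a b (steklov j) (fun z => j.+1%:R * (f (z + j.+1%:R^-1) - f z)).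
  apply: C1_on_continuous => z zab.
    have d1 := steklov_derive (in_lu _ zab).
    have d2 := steklov_derive (in_luh j _ zab).
    have sh : is_derive z (1 : R) (fun x : R => x + j.+1%:R^-1) 1.
      have h1 := is_deriveD (is_derive_id z (1 : R)) (is_derive_cst (j.+1%:R^-1 : R) z (1 : R)).
      by apply: is_derive_eq h1 _; rewrite addr0.
    have d3 := @is_derive1_comp _ F (fun x : R => x + j.+1%:R^-1) z _ _ d2 sh.
    have d4 := is_deriveZ (j.+1%:R : R) (is_deriveB d3 d1).
    by apply: is_derive_eq d4 _; rewrite mulr1.
  apply: cvgM; first exact: cvg_cst.
  apply: cvgB; last exact: f_cont (in_lu _ zab).
  apply: (@cvg_comp _ _ _ (fun x => x + j.+1%:R^-1) f _ _ _ _ (f_cont (in_luh j _ zab))).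
  by apply: cvgD; [exact: cvg_id|exact: cvg_cst].
apply: (@C1_approximable_limit steklov f (fun=> C)).
- by move=> j; apply: cont_on_measurable; have [] := st_C1 j.
- exact: cont_on_measurable.
- by move=> j z zab; exact: steklov_bound.
- by move=> z /in_lu'; exact: fC.
- by apply: cont_on_integrable; exact: cont_on_cst.
- by apply: aeW => z zab; apply: steklov_cvg; exact: steklov_derive (in_lu _ zab).
- by move=> j; apply: C1_approximable_C1; eexists; exact: st_C1.
Qed.

End steklov_averages.

(** The Steklov averages of the extension by zero are continuous, and
    converge almost everywhere by Lebesgue's differentiation theorem. *)
Lemma C1_approximable_bounded f C : measurable_fun `[a, b] f ->
  (forall z, z \in `[a, b] -> `|f z| <= C) -> C1_approximable f.
Proof.
move=> mf fC; pose f0 := f \_ `[a, b].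
have C0 : 0 <= C by apply: le_trans (fC a _); rewrite // in_itv /= lexx leab.
have f0E z : z \in `[a, b] -> f0 z = f z by move=> zab; rewrite /f0 patchE mem_setE zab.
have f0C z : `|f0 z| <= C.
  by rewrite /f0 patchE mem_setE; case: ifPn => [/fC//|_]; rewrite normr0.
have If : mu.-integrable `[a, b] (EFin \o f).
  apply: (@le_integrable _ _ _ mu _ _ _ (EFin \o (fun=> C))) => //.
  - exact/measurable_EFinP.
  - move=> z /= zab; rewrite lee_fin [leRHS]ger0_norm//; exact: fC.
  - by apply: cont_on_integrable; exact: cont_on_cst.
have If0 : mu.-integrable setT (EFin \o f0).
  by move: If => /integrable_mkcond => /(_ (measurable_itv _)); rewrite restrict_EFin.
have lf0 := integrable_locally (measurable_itv `[a, b]) If.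
pose l := a - 2; pose u := b + 4.
have la : l < a by rewrite /l; lra.
have bu : b + 1 < u by rewrite /u; lra.
have If0lu : mu.-integrable `[l, u] (EFin \o f0) by apply: integrableS If0.
have If0y (y : R) : mu.-integrable [set` Interval (BLeft l) (BRight y)] (EFin \o f0).
  exact: integrableS If0.
have dF := FTC1 (a := BLeft l) If0y lf0.
pose w := steklov f0 l.
have w_cont j (z : R) : z \in `[a - 1, b + 2] -> {for z, continuous (w j)}.
  rewrite in_itv /= => /andP[z1 z2].
  apply: (steklov_continuous la bu If0lu).
    by rewrite /l; lra.
  have : j.+1%:R^-1 <= 1 :> R by rewrite invf_le1// ler1n.
  set h := j.+1%:R^-1; rewrite /u; lra.
have w_con j : cont_on (a - 1) (b + 2) (w j).
  by apply: continuous_in_subspaceT => z; rewrite mem_setE; exact: w_cont.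
have sub : `[a, b] `<=` `[a - 1, b + 2].
  by move=> z /=; rewrite !in_itv /= => /andP[? ?]; apply/andP; split; lra.
apply: (@C1_approximable_limit w f (fun=> C)) => //.
- move=> j; apply: measurable_funS (cont_on_measurable (w_con j)) => //.
- by move=> j z zab; apply: (steklov_bound la bu If0lu) => // ? _.
- by apply: cont_on_integrable; exact: cont_on_cst.
- move: dF; apply: filterS => z + zab; rewrite -(f0E _ zab).
  move=> [].
    by rewrite lte_fin; apply: lt_le_trans la _; move: zab; rewrite in_itv /= => /andP[].
  move=> d1 d2; apply: steklov_cvg.
  by split; [exact: d1|rewrite -derive1E; exact: d2].
- move=> j; have ab12 : a - 1 <= b + 2 by have := ltab; lra.
  have [C' _ hC'] := cont_on_bounded ab12 (w_con j).
  apply: (@C1_approximable_continuous (w j) (a - 1) (b + 2) C').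
  + by lra.
  + by lra.
  + exact: cont_on_integrable.
  + exact: hC'.
  + move=> z; rewrite in_itv /= => /andP[z1 z2]; apply: w_cont.
    by rewrite in_itv /= !ltW.
Qed.

(** Replace by zero the values larger than [j] in modulus. *)
Lemma C1_approximable_L2 f : measurable_fun `[a, b] f ->
  mu.-integrable `[a, b] (EFin \o (fun z => f z ^+ 2)) -> C1_approximable f.
Proof.
move=> mf If; pose f_ (j : nat) z := f z * ((`|f z| <= (j%:R : R))%R : nat)%:R.
have f_le j z : `|f_ j z| <= `|f z|.
  by rewrite /f_; case: (`|f z| <= _); rewrite ?mulr1// mulr0 normr0.
have mf_ j : measurable_fun `[a, b] (f_ j).
  apply: measurable_funM => //.
  apply: (measurableT_comp (f := fun b0 : bool => b0%:R : R)) => //.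
  apply: measurable_fun_ler => //; exact: measurableT_comp.
apply: (@C1_approximable_limit f_ f (fun z => `|f z|)) => //.
- by apply: eq_integrable If => // z _ /=; rewrite real_normK ?num_real.
- apply: aeW => z _; apply/cvgrPdist_lt => e e0; near=> j.
  have -> : f_ j z = f z.
    rewrite /f_; have -> : `|f z| <= j%:R; last by rewrite mulr1.
    by near: j; exact: nbhs_infty_ger.
  by rewrite subrr normr0.
- move=> j; apply: (@C1_approximable_bounded _ j%:R) => // z _.
  by rewrite /f_; case: (leP `|f z| j%:R) => h; rewrite ?mulr1// mulr0 normr0.
Unshelve. all: by end_near.
Qed.

End density.

(** * Density of the domain *)

Section domain_density.
Variables (R : realType) (k : scalar_kind) (n : nat) (a b m : R).
Local Notation K := (scalars R k).
Local Notation mu := (@lebesgue_measure R).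
Local Notation state := (R -> 'cV[K]_n).
Local Notation L2 := (@L2 R k n a b).
Implicit Types (f g x y h : state).

Lemma vpart_cplx_of (u : bool -> 'cV[R]_n) c :
  (k = RealScalars -> u false = 0) -> vpart c (cplx_of k u) = u c.
Proof.
rewrite /vpart /part /cplx_of; case: k => u0; apply/matrixP => i j; rewrite !mxE.
  by case: c => //=; rewrite u0// mxE.
by rewrite ord1; case: c.
Qed.

Lemma Rintegral_sum p (D : set R) (F : 'I_p -> R -> R) : measurable D ->
  (forall i, mu.-integrable D (EFin \o F i)) ->
  mu.-integrable D (EFin \o (fun z => \sum_i F i z)) /\
  \int[mu]_(z in D) (\sum_i F i z) = \sum_i \int[mu]_(z in D) F i z.
Proof.
move=> mD; elim: p F => [|p IH] F IF.
  have -> : (fun z => \sum_(i < 0) F i z) = fun=> 0.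
    by apply/funext => z; rewrite big_ord0.
  by split; [exact: integrable_real_cst0|rewrite big_ord0 Rintegral_cst// mul0r].
have -> : (fun z => \sum_(i < p.+1) F i z) =
    fun z => F ord0 z + \sum_(i < p) F (lift ord0 i) z.
  by apply/funext => z; rewrite big_ord_recl.
have [I1 E1] := IH (fun i => F (lift ord0 i)) (fun i => IF _).
split; first exact: integrable_realD.
by rewrite RintegralD// E1 [RHS]big_ord_recl.
Qed.

Lemma L2_of_cont h : (forall c i, cont_on a b (fun z => part c (h z i 0))) -> L2 h.
Proof.
move=> ch; apply/L2P; split=> [c i|]; first exact: cont_on_measurable.
apply: cont_on_integrable.
have -> : (fun z => bilc 1%:M (h z) (h z)) =
    (fun z => \sum_i (part true (h z i 0)) * (part true (h z i 0)) +
              \sum_i (part false (h z i 0)) * (part false (h z i 0))).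
  apply/funext => z; rewrite bilc_sum big_bool.
  by congr (_ + _); apply: eq_bigr => i _; rewrite expr2.
by apply: cont_onD; apply: cont_on_sum => i; apply: cont_onM.
Qed.

Hypothesis ltab : a < b.
Let leab := ltW ltab.
Variables (P1 : 'M[R]_n) (H dH : R -> 'M[R]_n) (WB : 'M[R]_(n, n + n)).
Hypothesis H_C1 : forall i j, C1_on a b (fun z => H z i j) (fun z => dH z i j).
Hypothesis H_sym : forall z, z \in `[a, b] -> (H z)^T = H z.
Hypothesis m_gt0 : 0 < m.
Hypothesis H_ge : forall z, z \in `[a, b] -> m%:M ⪯ H z.
Local Notation N := (@energy_norm R k n a b H).

Let H_cont : cont_mx a b H.
Proof. exact: cont_mxH H_C1. Qed.

Let Hinv_cont : cont_mx a b (Hinv H).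
Proof. exact: (cont_mxHinv H_C1 m_gt0 H_ge). Qed.

(** The co-energy [H x = h] vanishes at both ends, so the boundary vector is
    zero whatever [WB] is. *)
Lemma pH_domain_of_C1 h (dh : state) :
  (forall c i, C1_on a b (fun z => part c (h z i 0)) (fun z => part c (dh z i 0))) ->
  h a = 0 -> h b = 0 ->
  pH_domain k a b P1 H WB (fun z => of_real_mx k (Hinv H z) *m h z).
Proof.
move=> Ch ha hb; set x := fun z => _.
have ch c i : cont_on a b (fun z => part c (h z i 0)) by have [] := Ch c i.
have L2h : L2 h by exact: L2_of_cont.
have L2x : L2 x by exact: L2_mulmx.
have xh : same_state a b (mulH H x) h.
  apply: aeW => z zab; rewrite /mulH /x; apply: vpart_inj => c.
  by rewrite !vpart_mul mulmxA (HHinv m_gt0 H_ge zab) mul1mx.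
split=> //.
  split; first exact: L2_mulmx.
  exists dh; split; first by apply: L2_of_cont => c i; have [] := Ch c i.
  exists h; split=> // z zab; apply: vpart_inj => c; apply/matrixP => i j.
  have pv (w : 'cV[K]_n) : vpart c w i 0 = part c (w i 0) by rewrite mxE.
  rewrite ord1 vpartD [RHS]mxE !pv part_vec_integral.
  by have [_ hp] := C1_on_primitive (Ch c i); exact: hp.
rewrite /boundary_vector !(cont_rep_unique ltab xh ch) ?in_itv /= ?lexx ?leab//.
by rewrite ha hb col_mx0 mulmx0 scaler0 mulmx0.
Qed.

(** Approximate the real and imaginary parts of the components of [H f] by
    functions vanishing at both ends, and multiply by [H^-1]. Over the reals the
    approximation of the imaginary part has to be zero exactly. *)
Lemma pH_domain_dense f (e : R) : L2 f -> 0 < e ->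
  exists x, [/\ L2 x, pH_domain k a b P1 H WB x & N (f - x) < e].
Proof.
move=> L2f e0.
have L2u : L2 (mulH H f) by exact: L2_mulmx.
set u := mulH H f in L2u.
have [C C0 hC] := bilc_bounded k leab Hinv_cont.
pose e' := e ^+ 2 / (C * (2 * n%:R) + 1).
have den0 : 0 < C * (2 * n%:R) + 1 by rewrite ltr_wpDl// mulr_ge0// mulr_ge0.
have e'0 : 0 < e' by rewrite divr_gt0// exprn_gt0.
have part_int (w : state) c i : L2 w ->
    mu.-integrable `[a, b] (EFin \o (fun z => part c (w z i 0) ^+ 2)).
  move=> /L2P[mw Iw].
  apply: (@le_integrable _ _ _ mu _ _ _ (EFin \o (fun z => bilc 1%:M (w z) (w z)))) => //.
    by apply/measurable_EFinP; apply: measurable_funX; exact: mw.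
  move=> z zab; rewrite /= lee_fin ger0_norm ?sqr_ge0// ger0_norm ?bilc1_ge0//.
  exact: part_sqr_le.
have hex (ci : bool * 'I_n) : exists vdv : (R -> R) * (R -> R),
    [/\ C1_on a b vdv.1 vdv.2, vdv.1 a = 0, vdv.1 b = 0,
     (\int[mu]_(z in `[a, b]) ((part ci.1 (u z ci.2 0) - vdv.1 z) ^+ 2)%:E < e'%:E)%E &
     k = RealScalars -> ci.1 = false -> vdv.1 = (fun=> 0) /\ vdv.2 = (fun=> 0)].
  have [|nreal] := pselect (k = RealScalars /\ ci.1 = false).
    move=> [kr c0]; exists (fun=> 0, fun=> 0); split=> //; first exact: C1_on_cst.
    under eq_integral => z _.
      have -> : part ci.1 (u z ci.2 0) = 0.
        by rewrite c0 /part; move: (u z ci.2 0); rewrite kr.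
      rewrite subrr expr0n /=; over.
    by rewrite integral0 lte_fin.
  have mui : measurable_fun `[a, b] (fun z => part ci.1 (u z ci.2 0)).
    by have /L2P[mu_ _] := L2u; exact: mu_.
  have [v [dv [h1 h2 h3 h4]]] :=
    C1_approximable_L2 ltab mui (part_int _ ci.1 ci.2 L2u) e'0.
  by exists (v, dv); split=> // kr c0; exfalso; apply: nreal.
have [V hV] := choice hex.
pose hc c z : 'cV[R]_n := \col_i (V (c, i)).1 z.
pose dhc c z : 'cV[R]_n := \col_i (V (c, i)).2 z.
pose h : state := fun z => cplx_of k (fun c => hc c z).
pose dh : state := fun z => cplx_of k (fun c => dhc c z).
have hE c i z : part c (h z i 0) = (V (c, i)).1 z.
  have -> : part c (h z i 0) = vpart c (h z) i 0 by rewrite mxE.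
  rewrite vpart_cplx_of ?mxE// => kr; apply/matrixP => i' j; rewrite !mxE.
  by have [_ _ _ _ /(_ kr erefl)[-> _]] := hV (false, i').
have dhE c i z : part c (dh z i 0) = (V (c, i)).2 z.
  have -> : part c (dh z i 0) = vpart c (dh z) i 0 by rewrite mxE.
  rewrite vpart_cplx_of ?mxE// => kr; apply/matrixP => i' j; rewrite !mxE.
  by have [_ _ _ _ /(_ kr erefl)[_ ->]] := hV (false, i').
have Ch c i : C1_on a b (fun z => part c (h z i 0)) (fun z => part c (dh z i 0)).
  have -> : (fun z => part c (h z i 0)) = (V (c, i)).1 by apply/funext => z; exact: hE.
  have -> : (fun z => part c (dh z i 0)) = (V (c, i)).2 by apply/funext => z; exact: dhE.
  by have [] := hV (c, i).
have ha : h a = 0.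
  apply: vpart_inj => c; apply/matrixP => i j; rewrite ord1 vpart0 !mxE hE.
  by have [] := hV (c, i).
have hb : h b = 0.
  apply: vpart_inj => c; apply/matrixP => i j; rewrite ord1 vpart0 !mxE hE.
  by have [] := hV (c, i).
have dx := pH_domain_of_C1 Ch ha hb.
set x := (fun z => of_real_mx k (Hinv H z) *m h z) in dx.
have L2x : L2 x by have [] := dx.
have L2h : L2 h by apply: L2_of_cont => c i; have [] := Ch c i.
have L2uh : L2 (u - h) by exact: L2B.
exists x; split=> //.
have n0 := @energy_norm_ge0 R k n a b H (f - x).
rewrite -(@ltr_pXn2r _ 2) ?nnegrE ?(ltW e0)// (energy_norm_sqr m_gt0 H_ge).
have -> : L2form a b H (f - x) (f - x) = L2form a b (Hinv H) (u - h) (u - h).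
  apply: eq_Rintegral => z; rewrite mem_setE => zab.
  have -> : (f - x) z = of_real_mx k (Hinv H z) *m (u - h) z.
    apply: vpart_inj => c.
    rewrite -[(f - x) z]/(f z - x z) -[(u - h) z]/(u z - h z).
    rewrite vpart_mul !vpartB mulmxBr /x /u /mulH !vpart_mul mulmxA.
    by rewrite (HinvK m_gt0 H_ge zab) mul1mx.
  by rewrite /bilc !vpart_mul !(bil_H_Hinv H_sym m_gt0 H_ge).
have step1 : L2form a b (Hinv H) (u - h) (u - h) <=
    \int[mu]_(z in `[a, b]) (2 * C * bilc 1%:M ((u - h) z) ((u - h) z)).
  have I1 : mu.-integrable `[a, b] (EFin \o (fun z => bilc 1%:M ((u - h) z) ((u - h) z))).
    by have /L2P[] := L2uh.
  apply: le_Rintegral => //; first exact: integrable_bilc.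
    exact: integrable_realZ.
  move=> z zab; apply: (le_trans (ler_norm _)).
  apply: (le_trans (hC z _ _ 1 zab ltr01)); rewrite invr1 !mul1r; lra.
have I1 : mu.-integrable `[a, b] (EFin \o (fun z => bilc 1%:M ((u - h) z) ((u - h) z))).
  by have /L2P[] := L2uh.
have step2 : \int[mu]_(z in `[a, b]) (bilc 1%:M ((u - h) z) ((u - h) z)) <= 2 * n%:R * e'.
  have -> : (fun z => bilc 1%:M ((u - h) z) ((u - h) z)) =
      (fun z => \sum_i part true ((u - h) z i 0) ^+ 2 + \sum_i part false ((u - h) z i 0) ^+ 2).
    by apply/funext => z; rewrite bilc_sum big_bool.
  have [It Et] := Rintegral_sum (measurable_itv `[a, b]) (fun i => part_int _ true i L2uh).
  have [If Ef] := Rintegral_sum (measurable_itv `[a, b]) (fun i => part_int _ false i L2uh).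
  rewrite RintegralD// Et Ef.
  have le c i : \int[mu]_(z in `[a, b]) (part c ((u - h) z i 0) ^+ 2) <= e'.
    have [_ _ _ hlt _] := hV (c, i).
    have Ici := part_int _ c i L2uh.
    rewrite -lee_fin /Rintegral fineK; last exact: integrable_fin_num.
    apply: (le_trans _ (ltW hlt)).
    rewrite le_eqVlt; apply/orP; left; apply/eqP; apply: eq_integral => z _ /=.
    rewrite -hE; congr ((_ ^+ 2)%:E).
    have := congr1 (fun v : 'cV[R]_n => v i 0) (vpartB c (u z) (h z)).
    by rewrite !mxE.
  have -> : 2 * n%:R * e' = \sum_(i < n) e' + \sum_(i < n) e'.
    by rewrite sumr_const card_ord -[e' *+ n]mulr_natl; ring.
  by apply: lerD; apply: ler_sum => i _; exact: le.
apply: (@le_lt_trans _ _ (C * (2 * n%:R * e'))).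
  rewrite ler_pdivrMl//; apply: (le_trans step1); rewrite RintegralZl// mulrA.
  by rewrite ler_wpM2l// mulr_ge0.
have -> : C * (2 * n%:R * e') = e ^+ 2 * (C * (2 * n%:R) / (C * (2 * n%:R) + 1)).
  by rewrite /e'; ring.
by rewrite -[ltRHS]mulr1 ltr_pM2l ?exprn_gt0// ltr_pdivrMr// mul1r ltrDl.
Qed.

End domain_density.

(** * The equivalence *)

Theorem theorem2 (R : realType) (k : scalar_kind) (n : nat) (a b m M gamma : R)
    (P1 P0 : 'M[R]_n) (H : R -> 'M[R]_n) (WB : 'M[R]_(n, n + n))
    (T : R -> (R -> 'cV[scalars R k]_n) -> (R -> 'cV[scalars R k]_n))
    (n_ge1 : (1 <= n)%N) (ltab : a < b)
    (WB_rank : \rank WB = n)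
    (WB_nonneg : quad_nonneg (WB *m swap_mx R n *m WB^T))
    (H_C1 : continuously_differentiable a b H)
    (H_sym : forall z, z \in `[a, b] -> (H z)^T = H z)
    (m_gt0 : 0 < m) (M_gt0 : 0 < M)
    (H_bounds : forall z, z \in `[a, b] -> m%:M ⪯ H z /\ H z ⪯ M%:M)
    (P1_sym : P1^T = P1) (P1_unit : P1 \in unitmx)
    (P0_skew : P0^T = - P0)
    (T_semigroup : contraction_semigroup k a b H T)
    (T_generated : generated_by a b H (pH_operator k a b P1 P0 H WB) T)
    (gamma_gt0 : 0 < gamma)
    (gamma_large : forall z, z \in `[a, b] ->
       invmx P1 ⪯ gamma *: H z /\ - invmx P1 ⪯ gamma *: H z) :
  let observed_at (c : R) :=
    exists sigma tau tf kappa : R,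
      [/\ 0 < sigma, sigma < tau, tau < tf,
          2 * gamma * (b - a) < tau - sigma & 0 < kappa] /\
      forall x0, pH_domain k a b P1 H WB x0 ->
        energy_norm a b H (T tf x0) ^+ 2 - energy_norm a b H x0 ^+ 2 <=
        - kappa * \int[lebesgue_measure]_(t in `[sigma, tau])
                    energy_at a b H (T t x0) c in
  (exponentially_stable a b H T <-> observed_at b) /\
  (exponentially_stable a b H T <-> observed_at a).
Proof.
have [dH C1H] := H_C1.
have {}C1H i j : C1_on a b (fun z => H z i j) (fun z => dH z i j) := C1H i j.
have H_ge z : z \in `[a, b] -> m%:M ⪯ H z by move=> /H_bounds[].
have H_cont := cont_mxH C1H; have leab := ltW ltab.
have n0 := @energy_norm_ge0 R k n a b H.
have ab0 : 0 < b - a by rewrite subr_gt0.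
move=> observed_at.
have main c c' s0 : endpoint a b c c' s0 ->
    exponentially_stable a b H T <-> observed_at c.
  move=> cs; split.
    move=> stable.
    (* Observe on [[1, 2 + 2 gamma (b - a)]], longer by one than required. *)
    have st : 1 < 2 + 2 * gamma * (b - a) :> R.
      have : 0 < 2 * gamma * (b - a) by rewrite !mulr_gt0.
      lra.
    have [C C0 hC] := observation_admissible ltab C1H H_sym m_gt0 H_ge P1_sym
      P1_unit T_semigroup T_generated cs ltr01 st.
    have [tf tf_gt small] := exponentially_stable_small leab H_cont m_gt0 H_ge
      T_semigroup stable (2 + 2 * gamma * (b - a)).
    have C1 : 0 < 2 * (C + 1) by lra.
    exists 1, (2 + 2 * gamma * (b - a)), tf, (2 * (C + 1))^-1; split.
      by split=> //; [lra | rewrite invr_gt0].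
    move=> x0 dx; have [L2x _ _] := dx.
    have h1 := small _ L2x; have h2 := hC _ dx.
    have h3 : (2 * (C + 1))^-1 * (C * energy_norm a b H x0 ^+ 2) <=
        2^-1 * energy_norm a b H x0 ^+ 2.
      rewrite mulrA ler_wpM2r ?exprn_ge0// ler_pdivrMl//; lra.
    have h4 := ler_wpM2l (ltW (_ : 0 < (2 * (C + 1))^-1)) h2.
    rewrite mulNr; have {}h4 := h4 _; move: h4; rewrite invr_gt0 => /(_ C1); lra.
  move=> [sigma [tau [tf [kappa [[s_gt0 st tau_tf stg kappa0] obs]]]]].
  have [q [q0 q1 hq]] := observed_contraction ltab C1H H_sym m_gt0 H_ge P1_sym
    P1_unit T_semigroup T_generated gamma_gt0 gamma_large cs s_gt0 tau_tf stg kappa0 obs.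
  have tf0 : 0 < tf by apply: lt_trans tau_tf; exact: lt_trans st.
  apply: (exponentially_stable_of_contraction leab H_cont m_gt0 H_ge T_semigroup q0 q1 tf0).
  apply: (contraction_by_density leab H_cont H_sym m_gt0 H_ge T_semigroup
    (D := pH_domain k a b P1 H WB) (ltW q0) (ltW tf0)).
  - by move=> f e; exact: (pH_domain_dense ltab P1 WB C1H H_sym m_gt0 H_ge).
  - by move=> x _; exact: hq.
by split; [apply: (main b a 1); left|apply: (main a b (-1)); right].
Qed.
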